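(* Let $S$ be a locally compact second countable Hausdorff space with Borel $\sigma$-field, let $\xi_n$, $n\in\mathbb{N}$, be a sequence of point processes on $S$, and let $\lambda$ be a non-atomic locally finite measure on $S$. Let $\mathcal{U}\subseteq\widehat{\mathcal{S}}_{\lambda}$ be a ring containing a countable topological basis of $S$. Then the following statements are equivalent: (i) For all open sets $B\in\mathcal{U}$ the sequence $\xi_n(B)$, $n\in\mathbb{N}$, is tight, and for all open $B\in\mathcal{U}$ and all $k\in\mathbb{N}$, $$\lim_{n\to\infty}\Big( k\,\mathbb{P}(\xi_n(B)=k)-\lambda(B)\,\mathbb{P}(\xi_n(B)=k-1)\Big)=0.$$ (ii) $\xi_n$ converges in distribution to a Poisson process on $S$ with intensity measure $\lambda$.
   Context: $\widehat{\mathcal{S}}$ denotes the class of relatively compact Borel subsets of $S$, and $\widehat{\mathcal{S}}_\lambda=\{B\in\widehat{\mathcal{S}}:\lambda(\partial B)=0\}$. A ring is a non-empty class of subsets closed under finite unions, finite intersections and proper differences. A measure $\lambda$ is non-atomic if $\lambda(\{x\})=0$ for all $x\in S$. A point process is a random element of the space of locally finite counting measures on $S$, which is a subspace of the space $\mathcal{M}(S)$ of locally finite measures endowed with the vague topology (generated by $\mu\mapsto\int h\,d\mu$ for non-negative continuous compactly supported $h$) and the corresponding Borel $\sigma$-field; convergence in distribution refers to this topology. *)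

(* Defs.v *)
From HB Require Import structures.
From mathcomp Require Import all_boot all_order all_algebra.
From mathcomp Require Import all_classical all_reals all_analysis measurable_realfun.
Set Implicit Arguments. Unset Strict Implicit. Unset Printing Implicit Defensive.
Import Order.TTheory GRing.Theory Num.Theory.
Import numFieldNormedType.Exports.
Local Open Scope classical_set_scope.
Local Open Scope ring_scope.

Definition BorelS (S : ptopologicalType) := g_sigma_algebraType (@open S).

Section PointProcesses.
Variables (R : realType) (S : ptopologicalType).

Local Notation measS := {measure set (BorelS S) -> \bar R}.

Definition rc_borel (B : set S) :=
  (measurable (B : set (BorelS S))) /\ precompact B.

Definition locally_finite (mu : measS) :=
  forall B : set S, rc_borel B -> (mu B < +oo)%E.

Definition non_atomic (mu : measS) := forall x : S, mu [set x] = 0%E.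

Definition counting_valued (mu : measS) :=
  forall B : set (BorelS S), measurable B ->
    (exists k : nat, mu B = (k%:R)%:E) \/ mu B = +oo%E.

Definition lf_counting (mu : measS) := locally_finite mu /\ counting_valued mu.

Definition lambda_cont_sets (lam : measS) (B : set S) :=
  rc_borel B /\ lam (closure B `\` interior B) = 0%E.

Definition ring_of_sets (U : set (set S)) :=
  U !=set0 /\
  (forall A B, U A -> U B -> U (A `|` B)) /\
  (forall A B, U A -> U B -> U (A `&` B)) /\
  (forall A B, U A -> U B -> B `<=` A -> U (A `\` B)).

(* point process on a probability space: a random element of N(S), i.e.
   every realization is a locally finite counting measure and
   w |-> xi w B is measurable for every relatively compact Borel B
   (these maps generate the Borel sigma-field of the vague topology). *)
Definition point_process d (Omega : measurableType d)
    (xi : Omega -> measS) :=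
  (forall w, lf_counting (xi w)) /\
  (forall B : set S, rc_borel B -> measurable_fun [set: Omega] (fun w => (xi w B : \bar R))).

Definition Ccplus (h : S -> R) :=
  continuous h /\ (forall x, 0 <= h x) /\
  compact (closure [set x | h x != 0]).

Definition integ (mu : measS) (h : S -> R) : R :=
  fine (\int[mu]_(x in [set: BorelS S]) (h x)%:E)%E.

(* F : N(S) -> R is continuous for the (subspace) vague topology, i.e. the
   topology generated by mu |-> \int h dmu, h in C_c^+ : at every mu in N(S),
   every epsilon-ball of F mu contains the image of a basic neighbourhood. *)
Definition vague_continuous (F : measS -> R) :=
  forall mu, lf_counting mu -> forall e : R, 0 < e ->
    exists (k : nat) (hs : 'I_k -> S -> R),
      (forall i, Ccplus (hs i)) /\
      exists2 delta : R, 0 < delta &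
        forall nu, lf_counting nu ->
          (forall i, `| integ nu (hs i) - integ mu (hs i) | < delta) ->
          `| F nu - F mu | < e.

Definition bounded_on_N (F : measS -> R) :=
  exists M : R, forall nu, lf_counting nu -> `| F nu | <= M.

Definition conv_in_dist d (Omega : measurableType d) (P : probability Omega R)
    (xi : nat -> Omega -> measS)
    d' (Omega' : measurableType d') (Q : probability Omega' R)
    (eta : Omega' -> measS) :=
  forall F : measS -> R, bounded_on_N F -> vague_continuous F ->
    ((fun n => \int[P]_w (F (xi n w))%:E) @ \oo -->
       \int[Q]_w (F (eta w))%:E)%E.

Definition poisson_p (a : R) (k : nat) : R :=
  expR (- a) * a ^+ k / (k`!)%:R.

Definition poisson_process d (Omega : measurableType d)
    (Q : probability Omega R) (eta : Omega -> measS) (lam : measS) :=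
  point_process eta /\
  (forall B : set S, rc_borel B -> forall k : nat,
     Q [set w | eta w B = (k%:R)%:E] = (poisson_p (fine (lam B)) k)%:E) /\
  (forall (m : nat) (Bs : 'I_m -> set S) (ks : 'I_m -> nat),
     (forall i, rc_borel (Bs i)) ->
     (forall i j, i != j -> Bs i `&` Bs j = set0) ->
     Q [set w | forall i, eta w (Bs i) = ((ks i)%:R)%:E] =
       (\prod_(i < m) fine (Q [set w | eta w (Bs i) = ((ks i)%:R)%:E]))%:E).

Definition tight_seq d (Omega : measurableType d) (P : probability Omega R)
    (X : nat -> Omega -> \bar R) :=
  forall e : R, 0 < e -> exists M : R, forall n,
    (P [set w | (M%:E < X n w)%E] <= e%:E)%E.

End PointProcesses.

(* Main.v *)
(* The recursion [k p_k = a p_{k-1}] characterizes the Poisson law, so (i) says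
   that [xi_n B] converges in law to a Poisson variable of mean [lam B] for
   every open [B] in the ring [U].  Only the void probabilities of these
   limits matter: cutting the sets into small open cells of [U] (up to a set of
   small [lam]-measure, since boundaries are null and [lam] has no atoms), with
   high probability no cell contains more than one point, and the joint law of
   the occupied cells is determined by void probabilities of finite unions of
   cells through inclusion-exclusion.  Hence probabilities of events that
   constrain finitely many counts of open members of [U] and of their closures
   converge to those of the Poisson process.  Every set [{F > t}] with [F]
   vaguely continuous is a countable union of such events, so
   [liminf P(F xi_n > t) >= Q(F eta > t)], and the layer-cake formula applied
   to [F + M] and [M - F] gives convergence of expectations.  Conversely, (ii)
   gives the limit law of [xi_n B] by sandwiching the indicator of [B] between
   Urysohn functions that differ only on a neighbourhood of the boundary of
   small measure.  The Poisson process itself is built on a countable product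
   of independent Poisson numbers of independent points in disjoint bounded
   pieces of [S]. *)
Require Import Defs.
From HB Require Import structures.
From mathcomp Require Import all_boot all_order all_algebra.
From mathcomp Require Import all_classical all_reals all_analysis measurable_realfun ring lra.
Set Implicit Arguments. Unset Strict Implicit. Unset Printing Implicit Defensive.
Import Order.TTheory GRing.Theory Num.Theory.
Import numFieldNormedType.Exports.
Local Open Scope classical_set_scope.
Local Open Scope ring_scope.

(** Vague continuity provides neighbourhoods given by arbitrary test functions, whereas
    probabilities require countable unions. Integrality bridges the gap: around a counting measure,
    lower bounds on the masses of small open sets that contain its atoms and one upper bound on a
    closed set add up to the same number, so all of them become equalities; such constraints range
    over a countable type. The upper bound bears on a closure, and cells that lie in a set or miss
    its closure treat open sets and closures alike. The law of the Poisson process is never computed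
    on these events: the error of the approximation by occupied cells involves counts of single sets
    only, so [xi_n] and [eta] are compared with one and the same number. Absence of atoms enters
    through the sum of the squared cell masses, at most the largest mass times the total. Since (ii)
    asserts that a Poisson process exists, one is constructed, and every realization, not almost
    every one, must be a locally finite counting measure; this shapes the construction. *)

(** * Countable products of probability measures *)

(* [probability_setT] with the head constant that integration lemmas produce. *)
Lemma measure_probability_setT d (T : measurableType d) (R : realType)
    (P : probability T R) : (P : {measure set T -> \bar R}) [set: T] = 1%E.
Proof. exact: probability_setT. Qed.

Section infinite_product.
Local Open Scope ereal_scope.
Context d (T : measurableType d) (R : realType).
Variable mu : nat -> probability T R.

Definition coord_sets : set (set (nat -> T)) :=
  [set [set w : nat -> T | A (w n)] | n in [set: nat] & A in @measurable _ T].

Definition seqspace := g_sigma_algebraType coord_sets.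

HB.instance Definition _ := Measurable.on seqspace.

Lemma measurable_coord n :
  measurable_fun [set: seqspace] (fun w : seqspace => w n).
Proof.
move=> _ A mA; rewrite setTI; apply: sub_sigma_algebra.
by exists n => //; exists A.
Qed.

Definition upd (w : seqspace) (n : nat) (y : T) : seqspace :=
  fun k => if k == n then y else w k.

Lemma measurable_upd n :
  measurable_fun [set: seqspace * T] (fun p => upd p.1 n p.2).
Proof.
refine (@measurability _ _ _ seqspace _ _ coord_sets erefl _).
move=> _ [_ [k _ [A mA <-]] <-]; rewrite setTI /upd.
have [kn|kn] := eqVneq k n.
  rewrite [X in measurable X](_ : _ = [set: seqspace] `*` A).
    exact: measurableX.
  by apply/seteqP; split => [[w y]|[w y]] /=; rewrite ?kn ?eqxx//; case.
rewrite [X in measurable X](_ : _ = [set w : seqspace | A (w k)] `*` [set: T]).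
  apply: measurableX => //; rewrite -[X in measurable X]setTI.
  exact: measurable_coord.
apply/seteqP; split => [[w y]|[w y]] /=; rewrite ?(negbTE kn)//.
by case.
Qed.

Definition avg (n : nat) (f : seqspace -> \bar R) (w : seqspace) : \bar R :=
  \int[mu n]_y f (upd w n y).

Definition nnmeas (f : seqspace -> \bar R) :=
  measurable_fun [set: seqspace] f /\ forall w, 0 <= f w.

Lemma nnmeas_upd n f w : nnmeas f ->
  measurable_fun [set: T] (fun y => f (upd w n y)).
Proof.
move=> [mf _].
have := measurableT_comp mf (measurable_upd n).
by move=> /(@measurable_fun_pair2 _ _ _ _ _ _ _ w); exact.
Qed.

Lemma nnmeas_avg n f : nnmeas f -> nnmeas (avg n f).
Proof.
move=> [mf f0]; split=> [|w]; last exact: integral_ge0.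
apply: (@measurable_fun_fubini_tonelli_F _ _ _ _ _ (mu n)
  (fun p : seqspace * T => f (upd p.1 n p.2))).
- exact: (measurableT_comp mf (measurable_upd n)).
- by move=> x; exact: f0.
Qed.

(** Integrates out the coordinates [n], ..., [n + m - 1], the last one innermost, so that further
    coordinates are appended inside ([iavg_add]). *)
Fixpoint iavg (m n : nat) (f : seqspace -> \bar R) : seqspace -> \bar R :=
  if m is m'.+1 then avg n (iavg m' n.+1 f) else f.

Lemma nnmeas_iavg m n f : nnmeas f -> nnmeas (iavg m n f).
Proof. by elim: m n => [//|m ih] n mf /=; apply: nnmeas_avg; exact: ih. Qed.

Lemma iavg_le m n f g : nnmeas f -> nnmeas g -> (forall w, f w <= g w) ->
  forall w, iavg m n f w <= iavg m n g w.
Proof.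
move=> mf mg fg; elim: m n => [//|m ih] n w /=.
apply: ge0_le_integral => //.
- by move=> y _; exact: (nnmeas_iavg _ _ mf).2.
- by apply: nnmeas_upd; exact: nnmeas_iavg.
- by apply: nnmeas_upd; exact: nnmeas_iavg.
Qed.

Lemma iavgD m n f g : nnmeas f -> nnmeas g ->
  iavg m n (fun w => f w + g w) = fun w => iavg m n f w + iavg m n g w.
Proof.
move=> mf mg; elim: m n => [//|m ih] n /=.
rewrite ih; apply/funext => w; rewrite /avg ge0_integralD//.
- by move=> y _; exact: (nnmeas_iavg _ _ mf).2.
- by apply: nnmeas_upd; exact: nnmeas_iavg.
- by move=> y _; exact: (nnmeas_iavg _ _ mg).2.
- by apply: nnmeas_upd; exact: nnmeas_iavg.
Qed.

Lemma iavgZ m n f (c : \bar R) : nnmeas f -> 0 <= c ->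
  iavg m n (fun w => c * f w) = fun w => c * iavg m n f w.
Proof.
move=> mf c0; elim: m n => [//|m ih] n /=.
rewrite ih; apply/funext => w; rewrite /avg ge0_integralZl//.
- by apply: nnmeas_upd; exact: nnmeas_iavg.
- by move=> y _; exact: (nnmeas_iavg _ _ mf).2.
Qed.

Lemma iavg_add m k n f : iavg (m + k) n f = iavg m n (iavg k (n + m) f).
Proof.
by elim: m n => [|m ih] n; rewrite ?addn0//= ih addSnnS.
Qed.

Definition depends_below {X : Type} (N : nat) (f : seqspace -> X) :=
  forall w w' : seqspace, (forall i, (i < N)%N -> w i = w' i) -> f w = f w'.

Lemma depends_belowW X N N' (f : seqspace -> X) : (N <= N')%N ->
  depends_below N f -> depends_below N' f.
Proof. by move=> NN' fN w w' ww'; apply: fN => i /leq_trans/(_ NN')/ww'. Qed.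

(** Integrating a constant against a probability returns it. Total mass one enters here and makes
    the averages of a cylinder over longer and longer blocks consistent. *)
Lemma iavg_id m n f : depends_below n f -> iavg m n f = f.
Proof.
elim: m n => [//|m ih] n fn /=.
rewrite ih; last exact: depends_belowW fn.
apply/funext => w; rewrite /avg.
under eq_integral => y _.
  rewrite (fn _ w); last by move=> i; rewrite /upd ltn_neqAle => /andP[/negbTE->].
  over.
by rewrite integral_cst// measure_probability_setT mule1.
Qed.

Lemma iavg_stable n m m' f : depends_below (n + m) f -> (m <= m')%N ->
  iavg m' n f = iavg m n f.
Proof. by move=> fm mm'; rewrite -(subnKC mm') iavg_add (@iavg_id (m' - m)). Qed.

End infinite_product.

(** * Sigma-additivity of the product content on cylinders *)

Section infinite_product_measure.
Local Open Scope ereal_scope.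
Context d (T : measurableType d) (R : realType).
Variable mu : nat -> probability T R.
Local Notation Om := (seqspace T).

Definition cylinder (A : set Om) :=
  measurable A /\ exists N, depends_below N A.

(** A copy of [seqspace] whose measurable sets are the cylinders only: they form an algebra, the
    domain of the content to be extended. *)
Definition cylspace := seqspace T.
HB.instance Definition _ := Pointed.on cylspace.

Let cylinder0 : cylinder set0.
Proof. by split; [exact: measurable0 | exists 0%N]. Qed.

Let cylinderC : setC_closed cylinder.
Proof.
move=> A [mA [N AN]]; split; first exact: measurableC.
by exists N => w w' ww'; rewrite /setC /= (AN _ w').
Qed.

Let cylinderU : setU_closed cylinder.
Proof.
move=> A B [mA [N AN]] [mB [M BM]]; split; first exact: measurableU.
exists (maxn N M) => w w' ww'; rewrite /setU /mkset.
rewrite (AN _ w') ?(BM _ w')// => i iN; apply: ww'; rewrite leq_max iN//.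
by rewrite orbT.
Qed.

HB.instance Definition _ := @isAlgebraOfSets.Build default_measure_display
  cylspace cylinder cylinder0 cylinderU cylinderC.

Definition ind (A : set Om) : Om -> \bar R := fun w => (\1_A w)%:E.

Lemma nnmeas_ind A : measurable A -> nnmeas (ind A).
Proof.
move=> mA; split; last by move=> w; rewrite /ind lee_fin.
by apply/measurable_EFinP; exact: measurable_indic.
Qed.

Lemma depends_below_ind N (A : set Om) : depends_below N A -> depends_below N (ind A).
Proof.
move=> AN w w' ww'; rewrite /ind !indicE.
suff -> : (w \in A) = (w' \in A) by [].
apply/idP/idP => /set_mem h; apply/mem_set; first by rewrite -(AN w w').
by rewrite (AN w w').
Qed.

Lemma ind_le1 A w : ind A w <= 1.
Proof. by rewrite /ind lee_fin indicE; case: (w \in A). Qed.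

(* [iavg mu m 0 (ind A)] is stationary in [m] as soon as [A] is a cylinder. *)
Definition cylmeas (A : set cylspace) : \bar R :=
  if `[< cylinder A >] then limn (fun m => iavg mu m 0 (ind A) point) else 0.

Lemma cylmeasE N A : measurable A -> depends_below N A ->
  cylmeas A = iavg mu N 0 (ind A) point.
Proof.
move=> mA AN; rewrite /cylmeas asboolT; last by split => //; exists N.
move/depends_below_ind : AN => AN; apply: lim_near_cst => //.
by exists N => // m /= Nm; rewrite (@iavg_stable _ _ _ _ 0%N N).
Qed.

Let cylmeas_ge0 A : 0 <= cylmeas A.
Proof.
have [[mA [N AN]]|/asboolPn nA] := pselect (cylinder A).
  by rewrite (cylmeasE mA AN); exact: (nnmeas_iavg _ _ _ (nnmeas_ind mA)).2.
by rewrite /cylmeas (negbTE nA).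
Qed.

Lemma cylmeasU : @additive2 _ _ cylspace cylmeas.
Proof.
move=> A B [mA [N AN]] [mB [M BM]] AB0.
have AK : depends_below (maxn N M) A by apply: depends_belowW AN; rewrite leq_maxl.
have BK : depends_below (maxn N M) B by apply: depends_belowW BM; rewrite leq_maxr.
rewrite (cylmeasE mA AK) (cylmeasE mB BK) (@cylmeasE (maxn N M)).
- rewrite (_ : ind (A `|` B) = fun w => ind A w + ind B w).
    by rewrite iavgD//; exact: nnmeas_ind.
  apply/funext => w; rewrite /ind !indicE in_setU -EFinD -natrD.
  case: (boolP (w \in A)) => // /set_mem wA; case: (boolP (w \in B)) => // /set_mem wB.
  by have : set0 w by rewrite -AB0.
- exact: measurableU.
- by move=> w w' ww'; rewrite /setU /mkset (AK w w')// (BK w w').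
Qed.

Lemma cylmeas0 : cylmeas set0 = 0.
Proof.
rewrite (@cylmeasE 0%N _ (@measurable0 _ (seqspace T)))//=.
by rewrite /ind indic0.
Qed.

HB.instance Definition _ := isContent.Build _ cylspace R cylmeas cylmeas_ge0
  ((additive2P cylmeas0).2 cylmeasU).

(** [g] is below [e / 2] off the event and at most 1 on it, so its mean is at most [e / 2] plus the
    probability of the event. *)
Lemma probability_ge_half (P : probability T R) (g : T -> \bar R) (e : R) :
  (0 < e)%R -> measurable_fun [set: T] g -> (forall y, 0 <= g y <= 1) ->
  e%:E <= \int[P]_y g y -> (e / 2)%:E <= P [set y | (e / 2)%:E <= g y].
Proof.
move=> e0 mg g01 eg; set B := [set y | _].
have mB : measurable B.
  by rewrite /B -[X in measurable X]setTI; exact: emeasurable_fun_c_infty.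
have : \int[P]_y g y <= \int[P]_y ((e / 2)%:E + (\1_B y)%:E).
  apply: ge0_le_integral => //.
  - by move=> y _; have /andP[] := g01 y.
  - by apply: emeasurable_funD => //; apply/measurable_EFinP; exact: measurable_indic.
  - move=> y _; rewrite indicE; case: (boolP (y \in B)) => [_|].
      have /andP[_] := g01 y; move/le_trans; apply.
      by rewrite -EFinD lee_fin lerDr divr_ge0// ltW.
    rewrite notin_setE /B /= adde0 => /negP; rewrite -ltNge; exact: ltW.
rewrite ge0_integralD//=; last 2 first.
  by move=> y _; rewrite lee_fin divr_ge0// ltW.
  by apply/measurable_EFinP; exact: measurable_indic.
rewrite integral_cst// integral_indic// setIT measure_probability_setT mule1.
move=> /(le_trans eg); rewrite -leeBlDl//.
by rewrite -EFinB; congr (_%:E <= _); rewrite [X in (X - _)%R](splitr e) addrK.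
Qed.

(* Kolmogorov's compactness argument: coordinates are chosen one by one so
   that the conditional measures of all the [F n] stay bounded below. *)
Lemma cylmeas_bigcap (F : nat -> set Om) (e : R) : (0 < e)%R ->
  (forall n, cylinder (F n)) -> nonincreasing_seq F ->
  (forall n, e%:E <= cylmeas (F n)) -> exists w, forall n, F n w.
Proof.
move=> e0 cF niF eF.
have mF n : measurable (F n) := (cF n).1.
(* A positive bound [N.+1] lets [iavg] unfold one coordinate in [HE]. *)
have /choice[N NF] n : exists N, depends_below N.+1 (F n).
  by have [_ [N FN]] := cF n; exists N; exact: depends_belowW FN.
(* [H k n w] is the conditional measure of [F n] given the first [k] coordinates of [w]. *)
pose H k n := iavg mu (N n).+1 k (ind (F n)).
have HE k n : H k n = avg mu k (H k.+1 n).
  rewrite /H (@iavg_stable _ _ _ _ k.+1 (N n))//.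
  apply: depends_belowW (depends_below_ind (NF n)).
  by rewrite addSn ltnS leq_addl.
have nnH k n : nnmeas (H k n) by apply: nnmeas_iavg; exact: nnmeas_ind.
have H01 k n w : 0 <= H k n w <= 1.
  rewrite (nnH k n).2/=.
  have -> : 1 = iavg mu (N n).+1 k (fun=> 1) w by rewrite iavg_id.
  apply: iavg_le; [exact: nnmeas_ind| |exact: ind_le1].
  by split.
have niH k n m w : (n <= m)%N -> H k m w <= H k n w.
  move=> nm; rewrite /H.
  set M := maxn (N n).+1 (N m).+1.
  have stab i : (N i < M)%N ->
      iavg mu (N i).+1 k (ind (F i)) = iavg mu M k (ind (F i)).
    move=> NM; rewrite (@iavg_stable _ _ _ _ k (N i).+1 M)//.
    apply: depends_belowW (depends_below_ind (NF i)).
    by rewrite leq_addl.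
  rewrite !stab ?leq_max ?leqnn ?orbT//.
  apply: iavg_le; [exact: nnmeas_ind|exact: nnmeas_ind|move=> w'].
  rewrite /ind lee_fin !indicE; case: (boolP (w' \in F m)) => // /set_mem Fw'.
  by rewrite mem_set//; move/(_ _ _ nm) : niF => /subsetPset; exact.
(* Each chosen coordinate costs a factor 2, through [probability_ge_half]. *)
pose ek k : R := (e / 2 ^+ k)%R.
have ek0 k : (0 < ek k)%R by rewrite divr_gt0// exprn_gt0.
pose Q k w := forall n, (ek k)%:E <= H k n w.
have Q0 : Q 0%N point.
  by move=> n; rewrite /ek expr0 divr1 (le_trans (eF n))// (cylmeasE (mF n) (NF n)).
have step k w : Q k w -> exists y, Q k.+1 (upd w k y).
  move=> Qkw; pose B n := [set y | (ek k.+1)%:E <= H k.+1 n (upd w k y)].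
  have mH n : measurable_fun [set: T] (fun y => H k.+1 n (upd w k y)).
    exact: nnmeas_upd.
  have mB n : measurable (B n).
    rewrite /B -[X in measurable X]setTI.
    by apply: emeasurable_fun_c_infty => //; exact: mH.
  have PB n : (ek k.+1)%:E <= mu k (B n).
    have := @probability_ge_half (mu k) _ (ek k) (ek0 k) (mH n).
    rewrite /B (_ : ek k / 2 = ek k.+1)%R; last first.
      by rewrite /ek exprSr invfM mulrA.
    by apply=> [y|]; [exact: H01|have := Qkw n; rewrite HE].
  have niB : nonincreasing_seq B.
    move=> n m nm; apply/subsetPset => y /le_trans; apply.
    exact: niH.
  suff [y By] : \bigcap_n B n !=set0 by exists y => n; exact: By.
  (* The sets [B n] decrease and have measure at least [ek k.+1], so continuity from above forbids
     an empty intersection. *)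
  apply/set0P/eqP => B0.
  have : mu k \o B @ \oo --> mu k (\bigcap_n B n).
    apply: nonincreasing_cvg_mu => //.
      by apply: le_lt_trans (ltry 1); exact: probability_le1.
    exact: bigcap_measurableType.
  rewrite B0 measure0 => /cvg_lim B00.
  have : (ek k.+1)%:E <= limn (mu k \o B).
    apply: lime_ge; last by near=> n; exact: PB.
    apply: ereal_nonincreasing_is_cvgn => n m nm.
    apply: le_measure; rewrite ?inE//.
    by move/(_ _ _ nm) : niB => /subsetPset.
  by rewrite B00// lee_fin leNgt ek0.
pose y w k := xget point [set y | Q k.+1 (upd w k y)].
pose W := fix W k := if k is k'.+1 then upd (W k') k' (y (W k') k') else point.
have QW k : Q k (W k).
  elim: k => [//|k ih] /=; rewrite /y.
  by case: xgetP => [z _ //|nQ]; have [z /nQ] := step _ _ ih.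
pose w : Om := fun k => y (W k) k.
have Ww k i : (i < k)%N -> W k i = w i.
  elim: k => [//|k ih]; rewrite ltnS leq_eqVlt /= /upd.
  by have [->//|ik] := eqVneq i k; exact: ih.
exists w => n.
(* Once [(N n).+1] coordinates are fixed, the conditional measure of [F n] is its indicator; being
   positive at [w], it equals 1. *)
have := QW (N n).+1 n.
have FH : depends_below (N n).+1 (ind (F n)) := depends_below_ind (NF n).
rewrite /H iavg_id// (FH (W (N n).+1) w); last exact: Ww.
rewrite /ind indicE; case: (boolP (w \in F n)) => [/set_mem//|_].
by rewrite lee_fin leNgt ek0.
Unshelve. all: by end_near. Qed.

Let cylmeas_sigma_additive : semi_sigma_additive cylmeas.
Proof.
move=> F mF tF mUF.
(* This half holds for any content; the converse inequality needs compactness, applied to the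
   remainders [Rn]. *)
have le := content_ring_sup_sigma_additive cylmeas mF mUF tF.
suff <- : \sum_(i <oo) cylmeas (F i) = cylmeas (\bigcup_n F n).
  by apply: is_cvg_nneseries => n _ _; exact: cylmeas_ge0.
apply/eqP; rewrite eq_le le/=; apply/lee_addgt0Pr => e e0.
pose Rn n := (\bigcup_n F n) `\` \big[setU/set0]_(i < n) F i.
have mUn n : measurable (\big[setU/set0]_(i < n) F i : set cylspace).
  exact: bigsetU_measurable.
have mRn n : measurable (Rn n : set cylspace) by exact: measurableD.
have [n Rne] : exists n, cylmeas (Rn n) < e%:E.
  apply/not_existsP => nR.
  have [|||w wR] := @cylmeas_bigcap Rn e e0.
  - by move=> n; exact: mRn.
  - move=> n m nm; apply/subsetPset => w [Uw nw]; split => // w'; apply: nw.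
    by move: w'; rewrite -!bigcup_mkord => -[i /= im Fi]; exists i => //=; exact: leq_trans im nm.
  - by move=> n; rewrite leNgt; apply/negP; exact: nR.
  have [[i _ Fi] _] := wR 0%N.
  have [_] := wR i.+1; apply; rewrite -bigcup_mkord; exists i => //=.
have -> : \bigcup_n F n = \big[setU/set0]_(i < n) F i `|` Rn n.
  rewrite /Rn setUDr setDv setD0 setUidr//.
  by rewrite -bigcup_mkord; apply: bigcup_sub => i _; exact: bigcup_sup.
rewrite measureU//; last by rewrite /Rn setDIK.
rewrite measure_bigsetU// leeD//; last exact: ltW.
rewrite -(big_mkord predT (fun i => cylmeas (F i))).
by apply: nneseries_lim_ge => i _ _; exact: cylmeas_ge0.
Qed.

HB.instance Definition _ := Content_isMeasure.Build _ cylspace R cylmeas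
  cylmeas_sigma_additive.

End infinite_product_measure.

Section sequence_probability.
Local Open Scope ereal_scope.
Context d (T : measurableType d) (R : realType).
Variable mu : nat -> probability T R.

Let I := g_sigma_algebraType (@measurable _ (cylspace T)).

Let ext : {measure set I -> \bar R} := measure_extension (cylmeas mu).

(** The generators of the product sigma-algebra are cylinders, so the Caratheodory extension
    measures all of it. *)
Let measurable_ext (A : set (seqspace T)) :
  measurable A -> measurable (A : set I).
Proof.
apply: smallest_sub; first exact: sigma_algebra_measurable.
move=> _ [n _ [B mB <-]]; apply: sub_sigma_algebra; split.
  by rewrite -[X in measurable X]setTI; exact: measurable_coord.
by exists n.+1 => w w' ww'; rewrite /mkset ww'.
Qed.

Definition seqprob : set (seqspace T) -> \bar R := fun A => ext A.

Let seqprob0 : seqprob set0 = 0. Proof. exact: measure0. Qed.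

Let seqprob_ge0 A : 0 <= seqprob A. Proof. exact: measure_ge0. Qed.

Let seqprob_sigma_additive : semi_sigma_additive seqprob.
Proof.
move=> F mF tF mUF; apply: (@measure_semi_sigma_additive _ _ _ ext) => //.
  by move=> i; exact: measurable_ext.
exact: measurable_ext.
Qed.

HB.instance Definition _ := isMeasure.Build _ (seqspace T) R seqprob
  seqprob0 seqprob_ge0 seqprob_sigma_additive.

Lemma seqprobE N (A : set (seqspace T)) : measurable A -> depends_below N A ->
  seqprob A = iavg mu N 0 (ind R A) point.
Proof.
move=> mA AN; rewrite -(cylmeasE mu mA AN) /seqprob /ext/= /measure_extension.
by rewrite measurable_mu_extE//; split => //; exists N.
Qed.

Let seqprobT : seqprob [set: seqspace T] = 1.
Proof. by rewrite (@seqprobE 0)//= /ind indicT. Qed.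

HB.instance Definition _ := @Measure_isProbability.Build _ _ R seqprob seqprobT.

(** Coordinate [n] is integrated innermost, where the indicator of [A] is constant and comes out. *)
Lemma seqprob_indep n (A : set (seqspace T)) (D : set T) :
  measurable A -> depends_below n A -> measurable D ->
  seqprob (A `&` [set w | D (w n)]) = seqprob A * mu n D.
Proof.
move=> mA An mD.
have mDn : measurable [set w : seqspace T | D (w n)].
  by rewrite -[X in measurable X]setTI; exact: measurable_coord.
rewrite (@seqprobE n.+1); last 2 first.
- exact: measurableI.
- move=> w w' ww'; rewrite /setI /mkset ww'// (An w w')// => i /ltnW; exact: ww'.
rewrite (seqprobE mA An) -(addn1 n) iavg_add /= add0n.
rewrite (_ : avg _ _ _ = fun w => mu n D * ind R A w).
  by rewrite iavgZ 1?muleC//; exact: nnmeas_ind.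
apply/funext => w; rewrite /avg.
under eq_integral => y _.
  rewrite (_ : ind R _ _ = ind R A w * (\1_D y)%:E); first over.
  have <- : ind R A (upd w n y) = ind R A w.
    apply: (depends_below_ind R An) => i ni.
    by rewrite /upd (ltn_eqF ni).
  rewrite /ind !indicE -EFinM in_setI -mulnb natrM; congr (_ * _%:R)%:E.
  apply: congr1; apply/idP/idP => /set_mem h; apply/mem_set; move: h.
    by rewrite /mkset /upd eqxx.
  by rewrite /mkset /upd eqxx.
have nA := nnmeas_ind R mA.
rewrite ge0_integralZl//; last 2 first.
- by apply/measurable_EFinP; exact: measurable_indic.
- exact: nA.2.
by rewrite integral_indic// setIT muleC.
Qed.

End sequence_probability.

(** * Poisson numbers of independent points *)

Lemma measure_fibers d (T : measurableType d) (R : realType)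
    (P : {measure set T -> \bar R}) (I : finType) (A : set T) (X : T -> I) :
  (forall i, measurable (A `&` [set x | X x = i])) ->
  P A = (\sum_(i : I) P (A `&` [set x | X x = i]))%E.
Proof.
move=> mA; rewrite [in LHS](_ : A = \bigcup_(i in [set` index_enum I])
    (A `&` [set x | X x = i])); last first.
  apply/seteqP; split => [x Ax|x [i _ []//]].
  by exists (X x) => //; exact: mem_index_enum.
rewrite measure_fin_bigcup//; last by move=> i j _ _ [x [[_ <-] [_ <-]]].
by rewrite (fsbig_seq _ _ (index_enum_uniq I)).
Qed.

Lemma measurable_prod_nat d (T : measurableType d) d' (U : measurableType d')
    (f : nat -> T -> U) : (forall n, measurable_fun [set: T] (f n)) ->
  measurable_fun [set: nat * T] (fun z => f z.1 z.2).
Proof.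
move=> mf _ Y mY; rewrite setTI.
rewrite (_ : _ @^-1` Y = \bigcup_n ([set n] `*` (f n @^-1` Y))).
  apply: bigcupT_measurable => n; apply: measurableX => //.
  by rewrite -[X in measurable X]setTI; exact: mf.
apply/seteqP; split => [[n x] /= Yf|[n x] [_ _ [/= -> Yf]]//].
by exists n.
Qed.

Section counting.
Context d (E : measurableType d).

Definition count (n : nat) (w : seqspace E) (B : set E) : nat :=
  (\sum_(k < n) (w k \in B))%N.

Lemma countS n w B : count n.+1 w B = (count n w B + (w n \in B))%N.
Proof. by rewrite /count big_ord_recr. Qed.

Lemma measurable_count n B : measurable B ->
  measurable_fun [set: seqspace E] (fun w => count n w B).
Proof.
move=> mB; elim: n => [|n ih].
  rewrite (_ : (fun w => _) = cst 0%N); first exact: measurable_cst.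
  by apply/funext => w; rewrite /count big_ord0.
rewrite (_ : (fun w => _) = (fun w => count n w B + (w n \in B))%N); last first.
  by apply/funext => w; exact: countS.
apply: measurable_fun_addn => //.
have mf : measurable_fun [set: E] (fun x => (x \in B : nat)).
  rewrite (_ : (fun x => _) = (fun x => if x \in B then 1%N else 0%N)).
    apply: measurable_fun_ifT => //; apply: (measurable_fun_bool true).
    rewrite setTI [X in measurable X](_ : _ = B)//.
    by apply/seteqP; split => x; [exact: set_mem|exact: mem_set].
  by apply/funext => x; case: (x \in B).
exact: (measurableT_comp mf (measurable_coord n)).
Qed.

Lemma measurable_count_eq n B k : measurable B ->
  measurable [set w | count n w B = k].
Proof.
move=> mB; rewrite -[X in measurable X]setTI.
exact: (measurable_count n mB measurableT (_ : measurable [set k])).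
Qed.

Lemma count_depends_below n B : depends_below n (fun w => count n w B).
Proof.
move=> w w' ww'; rewrite /count; apply: eq_bigr => i _.
by rewrite ww'.
Qed.

End counting.

Section multinomial.
Context d (E : measurableType d) (R : realType) (nu : probability E R).
Variables (I : finType) (c : E -> I).
Hypothesis mc : forall i, measurable [set x | c x = i].

Let p i : R := fine (nu [set x | c x = i]).

Let event n (ks : {ffun I -> nat}) : set (seqspace E) :=
  [set w | forall i, count n w [set x | c x = i] = ks i].

Let mevent n ks : measurable (event n ks).
Proof.
rewrite (_ : event n ks = \bigcap_(i in setT) [set w | count n w [set x | c x = i] = ks i]).
  apply: fin_bigcap_measurable => [|i _]; first exact: finite_finset.
  exact: measurable_count_eq.
by apply/seteqP; split => w h i; [move=> _|]; exact: h.
Qed.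

Let dec (ks : {ffun I -> nat}) i : {ffun I -> nat} :=
  [ffun j => (ks j - (j == i))%N].

(** Conditioning on the cell [i] of the last point leaves the [n]-point law with one point removed
    from [i]. Each case contributes the same product times [ks i], and these weights sum to
    [n.+1]. *)
Lemma seqprob_multinomial n (ks : {ffun I -> nat}) :
  seqprob (fun=> nu) (event n ks) =
  ((\sum_i ks i == n)%N%:R * n`!%:R * \prod_i (p i ^+ ks i / (ks i)`!%:R))%:E.
Proof.
elim: n ks => [|n ih] ks.
  have [ks0|/eqP ks0] := eqVneq (\sum_i ks i)%N 0%N.
    have k0 i : ks i = 0%N by move/eqP: ks0; rewrite sum_nat_eq0 => /forallP/(_ i)/eqP.
    rewrite big1 ?mulr1; last by move=> i _; rewrite k0 expr0 divr1.
    rewrite [event _ _](_ : _ = setT) ?probability_setT//.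
    by apply/seteqP; split => // w _ i; rewrite k0 /count big_ord0.
  rewrite !mul0r [event _ _](_ : _ = set0) ?measure0//.
  apply/seteqP; split => // w /= wk; apply: ks0; rewrite big1// => i _.
  by rewrite -wk /count big_ord0.
have mcell i : measurable [set w : seqspace E | c (w n) = i].
  by rewrite -[X in measurable X]setTI; exact: (measurable_coord n measurableT (mc i)).
rewrite (@measure_fibers _ _ _ _ I _ (fun w : seqspace E => c (w n))); last first.
  by move=> i; exact: measurableI.
have term i : seqprob (fun=> nu) (event n.+1 ks `&` [set w | c (w n) = i]) =
    ((\sum_i ks i == n.+1)%N%:R * n`!%:R * (ks i)%:R *
      \prod_i (p i ^+ ks i / (ks i)`!%:R))%:E.
  (* The last point lies in cell [i], so a null count there is impossible; otherwise the subtraction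
     in [dec] is not truncated. *)
  have [ki0|ki0] := posnP (ks i).
    rewrite ki0 mulr0 mul0r [X in seqprob _ X](_ : _ = set0) ?measure0//.
    apply/seteqP; split => // w [/(_ i)]; rewrite countS ki0 => + cwi.
    by rewrite mem_set// addn1.
  have -> : event n.+1 ks `&` [set w | c (w n) = i] =
      event n (dec ks i) `&` [set w | [set x | c x = i] (w n)].
    apply/seteqP; split => [w [ew cw]|w [ew cw]]; split => // j.
      rewrite ffunE -ew countS; have [->|ji] := eqVneq j i.
        by rewrite mem_set// addnK.
      by rewrite memNset ?addn0 ?subn0// => /= cj; move: ji; rewrite -cj cw eqxx.
    rewrite countS ew ffunE; have [->|ji] := eqVneq j i.
      by rewrite mem_set// subnK.
    by rewrite memNset ?addn0 ?subn0// => /= cj; move: ji; rewrite -cj cw eqxx.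
  rewrite seqprob_indep//; last first.
    move=> w w' ww'; apply/propext; split => h j.
      by rewrite -(h j); apply: (@count_depends_below _ _ n) => k /ww' ->.
    by rewrite -(h j); apply: (@count_depends_below _ _ n) => k /ww' ->.
  rewrite ih -[nu _]fineK ?fin_num_measure// -EFinM; congr EFin.
  have -> : (\sum_i0 dec ks i i0 == n)%N = (\sum_i0 ks i0 == n.+1)%N.
    rewrite (bigD1 i)//= [in RHS](bigD1 i)//= ffunE eqxx subn1.
    rewrite [in LHS](eq_bigr ks); last first.
      by move=> j /negbTE ji; rewrite ffunE ji subn0.
    by rewrite -[in RHS](prednK ki0) addSn eqSS.
  rewrite -!mulrA; congr (_ * (_ * _)).
  rewrite (bigD1 i)//= [in RHS](bigD1 i)//= ffunE eqxx subn1.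
  rewrite [in LHS](eq_bigr (fun j => p j ^+ ks j / (ks j)`!%:R)); last first.
    by move=> j /negbTE ji; rewrite ffunE ji subn0.
  rewrite -/(p i) mulrAC [RHS]mulrA; congr (_ * _).
  case: (ks i) ki0 => // k _; rewrite factS exprSr natrM /=; field.
  by rewrite nat1r !pnatr_eq0 -lt0n fact_gt0.
rewrite (eq_bigr _ (fun i _ => term i)) sumEFin; congr EFin.
rewrite -mulr_suml -mulr_sumr -natr_sum.
have [->|_] := eqVneq (\sum_i ks i)%N n.+1; last by rewrite !mul0r.
by rewrite !mul1r factS natrM [in RHS]mulrC [in LHS]mulrC; congr (_ * _); rewrite mulrC.
Qed.

End multinomial.

Lemma big_option (R : Type) (idx : R) (op : Monoid.com_law idx) (I : finType)
    (F : option I -> R) :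
  \big[op/idx]_o F o = op (F None) (\big[op/idx]_i F (Some i)).
Proof.
rewrite (bigD1 None)//=; congr (op _ _).
rewrite (reindex_omap Some id)/=; last by case.
by apply: eq_bigl => i; rewrite eqxx.
Qed.

Section poisson_mixture.
Context d (E : measurableType d) (R : realType).

Lemma poisson_p_ge0 (a : R) k : 0 <= a -> 0 <= poisson_p a k.
Proof.
by move=> a0; rewrite divr_ge0// mulr_ge0 ?expR_ge0// exprn_ge0.
Qed.

(** At rate 0 [poisson_prob] is the Dirac mass at 0, which the formula reproduces because
    [0 ^+ 0 = 1]. *)
Lemma poisson_prob1 (a : R) k : 0 <= a ->
  poisson_prob a 0 [set k] = (poisson_p a k)%:E.
Proof.
rewrite le_eqVlt /poisson_prob /poisson_p => /predU1P[<-|a0].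
  rewrite ltxx oppr0 expR0 mul1r diracE; congr EFin.
  case: k => [|k]; first by rewrite mem_set// expr0 fact0 divr1.
  by rewrite memNset// expr0n mul0r.
rewrite a0 esum_set1; last by rewrite lee_fin poisson_pmf_ge0.
by rewrite /poisson_pmf a0 mulrC mulrA.
Qed.

Lemma poisson_p_sum (a : R) : 0 <= a ->
  (\sum_(k <oo) (poisson_p a k)%:E = 1)%E.
Proof.
move=> a0; rewrite -(measure_probability_setT (poisson_prob a 0)).
rewrite (_ : [set: nat] = \bigcup_k [set k]).
  rewrite measure_bigcup//; last by move=> i j _ _ [k [-> ->]].
  rewrite [RHS](@eq_eseriesl _ _ xpredT); last by move=> k; rewrite in_setT.
  by apply: eq_eseriesr => k _; rewrite -poisson_prob1.
by apply/seteqP; split => // k _; exists k.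
Qed.

Variables (a : R) (nu : probability E R).
Hypothesis a0 : 0 <= a.

(** The first component is the number of points; only that many terms of the sequence are read. *)
Definition mixture : probability (nat * seqspace E)%type R :=
  (poisson_prob a 0 \x seqprob (fun=> nu))%E.

(** Given the total, the counts are multinomial; the factorial of the total cancels the one in the
    Poisson weight, and the exponential splits because the cell probabilities sum to 1. *)
Lemma mixture_partition (I : finType) (c : E -> I) (ks : I -> nat) :
  (forall i, measurable [set x | c x = i]) ->
  mixture [set z | forall i, count z.1 z.2 [set x | c x = i] = ks i] =
  (\prod_i poisson_p (a * fine (nu [set x | c x = i])) (ks i))%:E.
Proof.
move=> mc; set p := fun i => fine (nu [set x | c x = i]).
have p1 : \sum_i p i = 1.
  apply: EFin_inj; rewrite -sumEFin -[RHS](measure_probability_setT nu).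
  rewrite (@measure_fibers _ _ _ _ _ _ c).
    by apply: eq_bigr => i _; rewrite setTI fineK ?fin_num_measure.
  by move=> i; rewrite setTI.
pose K := (\sum_i ks i)%N.
have sumc n w : (\sum_i count n w [set x | c x = i] = n)%N.
  rewrite /count exchange_big/= (eq_bigr (fun=> 1%N)) ?sum_nat_const ?card_ord ?muln1// => k _.
  rewrite (bigD1 (c (w k)))//= mem_set// big1 ?addn0// => i ci.
  by rewrite memNset// => /= e; rewrite e eqxx in ci.
(* The cells partition [E], so the prescribed counts determine the number of points. *)
have -> : [set z | forall i, count z.1 z.2 [set x | c x = i] = ks i] =
   [set K] `*` [set w | forall i, count K w [set x | c x = i] = [ffun i => ks i] i].
  apply/seteqP; split => [[n w] /= h|[n w] [/= -> h] i]; last by rewrite h ffunE.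
  have nK : n = K by rewrite -(sumc n w); apply: eq_bigr => i _; rewrite h.
  by split => // i; rewrite ffunE -nK h.
have mev : measurable [set w : seqspace E |
    forall i, count K w [set x | c x = i] = [ffun i => ks i] i].
  rewrite (_ : mkset _ = \bigcap_(i in setT)
      [set w | count K w [set x | c x = i] = [ffun i => ks i] i]).
    apply: fin_bigcap_measurable => [|i _]; first exact: finite_finset.
    exact: measurable_count_eq.
  by apply/seteqP; split => w h i; [move=> _|]; exact: h.
rewrite /mixture/= product_measure1E//= poisson_prob1// seqprob_multinomial//.
rewrite (eq_bigr ks); last by move=> i _; rewrite ffunE.
rewrite eqxx mul1r -EFinM /poisson_p; congr EFin.
rewrite mulrA divfK ?pnatr_eq0 -?lt0n ?fact_gt0//.
rewrite [RHS](eq_bigr (fun i => expR (- (a * p i)) * a ^+ ks i *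
    (p i ^+ ks i / (ks i)`!%:R))); last first.
  by move=> i _; rewrite -/(p i) exprMn !mulrA.
rewrite !big_split/= prodrXr -/K; congr (_ * _ * _).
  by rewrite -expR_sum sumrN -mulr_sumr p1 mulr1.
by congr (_ * _); apply: eq_bigr => i _; rewrite ffunE.
Qed.

Lemma mixture_count m (B : 'I_m -> set E) (ks : 'I_m -> nat) :
  (forall i, measurable (B i)) -> (forall i j, i != j -> B i `&` B j = set0) ->
  mixture [set z | forall i, count z.1 z.2 (B i) = ks i] =
  (\prod_i poisson_p (a * fine (nu (B i))) (ks i))%:E.
Proof.
(* The complement of the [B i] becomes an extra cell [None], whose count is left free and summed
   out. *)
move=> mB dB; pose c x : option 'I_m := [pick i | x \in B i].
have cS i : [set x | c x = Some i] = B i.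
  apply/seteqP; split => x; rewrite /c /=.
    by case: pickP => // j /set_mem Bj [<-].
  move=> Bi; case: pickP => [j /set_mem Bj|/(_ i)]; last by rewrite mem_set.
  have [->//|ji] := eqVneq j i.
  by have : set0 x by rewrite -(dB _ _ ji).
have cN : [set x | c x = None] = ~` \bigcup_(i in setT) B i.
  apply/seteqP; split => x; rewrite /c /=.
    by case: pickP => // h _ [i _ Bi]; have := h i; rewrite mem_set.
  by case: pickP => // j /set_mem Bj; case; exists j.
have mc i : measurable [set x | c x = i].
  case: i => [i|]; first by rewrite cS.
  rewrite cN; apply: measurableC; apply: fin_bigcup_measurable => // i _.
pose ks' k0 (o : option 'I_m) := if o is Some i then ks i else k0.
pose F k0 := [set z : nat * seqspace E |
  forall o, count z.1 z.2 [set x | c x = o] = ks' k0 o].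
have -> : [set z | forall i, count z.1 z.2 (B i) = ks i] = \bigcup_k0 F k0.
  apply/seteqP; split => [[n w] /= h|[n w] [k0 _ h] i]; last first.
    by have := h (Some i); rewrite cS.
  exists (count n w [set x | c x = None]) => // -[i|] //=.
  by rewrite cS h.
have mF k0 : measurable (F k0).
  rewrite (_ : F k0 = \bigcap_(o in setT)
      [set z | count z.1 z.2 [set x | c x = o] = ks' k0 o]).
    apply: fin_bigcap_measurable => [|o _]; first exact: finite_finset.
    rewrite -[X in measurable X]setTI.
    have mco n := measurable_count n (mc o).
    have mks : measurable [set ks' k0 o] by [].
    exact: (measurable_prod_nat mco measurableT mks).
  by apply/seteqP; split => w h i; [move=> _|]; exact: h.
rewrite measure_bigcup//; last first.
  move=> k l _ _ [z [/(_ None) zk /(_ None)]].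
  by rewrite zk.
rewrite (@eq_eseriesl _ _ xpredT); last by move=> k; rewrite in_setT.
set b := a * fine (nu [set x | c x = None]).
rewrite (@eq_eseriesr _ _ (fun k0 =>
   (\prod_i poisson_p (a * fine (nu (B i))) (ks i))%:E * (poisson_p b k0)%:E)%E).
  rewrite nneseriesZl ?poisson_p_sum ?mule1//.
    by rewrite mulr_ge0// fine_ge0.
  by move=> k0 _; rewrite lee_fin poisson_p_ge0// mulr_ge0// fine_ge0.
move=> k0 _; apply: (etrans (mixture_partition (ks' k0) mc)).
rewrite -EFinM; congr EFin.
rewrite big_option /= [LHS]mulrC; congr (_ * _).
by apply: eq_bigr => i _; rewrite cS.
Qed.

End poisson_mixture.

Lemma poisson_p_conv (R : realType) (a b : R) n :
  \sum_(k < n.+1) poisson_p a k * poisson_p b (n - k) = poisson_p (a + b) n.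
Proof.
rewrite /poisson_p opprD expRD addrC exprDn.
rewrite mulr_sumr mulr_suml; apply: eq_bigr => -[k /=]; rewrite ltnS => kn _.
have := bin_fact kn; move/(congr1 (fun n => n%:R : R)); rewrite !natrM => <-.
rewrite mulr_natr -mulr_natr.
have := fact_gt0 k; have := fact_gt0 (n - k); have := bin_gt0 n k; rewrite kn.
rewrite !lt0n => h1 h2 h3.
by field; rewrite ?pnatr_eq0 ?h1 ?h2 ?h3.
Qed.

(** * Superposition of independent finite Poisson samples *)

Section superposition.
Context d (E : measurableType d) (R : realType).
Variables (lam : {measure set E -> \bar R}) (Sj : nat -> set E).
Hypothesis mS : forall j, measurable (Sj j).
Hypothesis lamS : forall j, (lam (Sj j) < +oo)%E.

(** The Dirac mass is a default for a null piece, whose Poisson rate is then 0; [piece_probE]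
    multiplies by the mass and so covers this case. *)
Definition piece_prob j : probability E R :=
  mnormalize (mrestr lam (mS j)) (dirac point).

Lemma piece_probE j (B : set E) : measurable B ->
  fine (lam (Sj j)) * fine (piece_prob j (B `&` Sj j)) = fine (lam (B `&` Sj j)).
Proof.
move=> mB; rewrite /piece_prob /= /mnormalize /= /mrestr setTI.
have lamB : lam (B `&` Sj j) \is a fin_num.
  rewrite ge0_fin_numE//; apply: le_lt_trans (lamS j).
  by apply: le_measure; rewrite ?inE//; exact: measurableI.
case: ifPn => [/orP[/eqP l0|/eqP loo]|].
- rewrite l0 mul0r; suff -> : lam (B `&` Sj j) = 0%E by [].
  apply/eqP; rewrite eq_le measure_ge0 andbT -l0.
  by apply: le_measure; rewrite ?inE//; exact: measurableI.
- by have := lamS j; rewrite loo ltxx.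
rewrite negb_or => /andP[l0 loo].
have lf : lam (Sj j) \is a fin_num by rewrite ge0_fin_numE// ltey.
rewrite -setIA setIid fineM//= mulrCA divff ?mulr1//.
by rewrite fine_eq0.
Qed.

Definition marked : nat -> probability (nat * seqspace E)%type R :=
  fun j => mixture (fine (lam (Sj j))) (piece_prob j).

Local Notation Om := (seqspace (nat * seqspace E)%type).

(** Sampled points may leave their piece on a null event. Restricting each sample to its piece makes
    the count of a bounded set a finite sum for every outcome. *)
Definition superpose (w : Om) : {measure set E -> \bar R} :=
  mseries (fun j => mrestr (msum (fun i => dirac ((w j).2 i)) (w j).1) (mS j)) 0.

Definition total J (w : Om) (B : set E) : nat :=
  (\sum_(j < J) count (w j).1 (w j).2 (B `&` Sj j))%N.

Lemma superposeE w B :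
  superpose w B = (\sum_(j <oo) (count (w j).1 (w j).2 (B `&` Sj j))%:R%:E)%E.
Proof.
apply: eq_eseriesr => j _; rewrite /= /mrestr /msum /count natr_sum -sumEFin.
by apply: eq_bigr => i _; exact: diracE.
Qed.

Lemma superpose_total J w B : B `<=` \bigcup_(j < J) Sj j -> trivIset setT Sj ->
  superpose w B = (total J w B)%:R%:E.
Proof.
move=> BJ tS; rewrite superposeE (nneseries_split 0 J)//.
rewrite [X in (_ + X)%E](_ : _ = 0%E) ?adde0.
  by rewrite add0n big_mkord /total natr_sum sumEFin.
rewrite eseries0// => j Jj _; rewrite /count big1// => i _.
rewrite memNset// => -[/BJ[k /= kJ Sk] Sjj].
have kj : k = j by apply: tS => //; exists ((w j).2 i).
by move: kJ; rewrite kj ltnNge Jj.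
Qed.

Lemma measurable_total J B : measurable B ->
  measurable_fun [set: Om] (fun w => total J w B).
Proof.
move=> mB; elim: J => [|J ih].
  rewrite (_ : (fun w => _) = cst 0%N); first exact: measurable_cst.
  by apply/funext => w; rewrite /total big_ord0.
rewrite (_ : (fun w => _) = (fun w => total J w B +
    count (w J).1 (w J).2 (B `&` Sj J))%N); last first.
  by apply/funext => w; rewrite /total big_ord_recr.
apply: measurable_fun_addn => //.
have mc n := measurable_count n (measurableI _ _ mB (mS J)).
exact: (measurableT_comp (measurable_prod_nat mc) (measurable_coord J)).
Qed.

Lemma total_depends_below J B : depends_below J (fun w => total J w B).
Proof. by move=> w w' ww'; apply: eq_bigr => j _; rewrite ww'. Qed.

(** Piece [J] adds independent Poisson counts: the event is split along the counts in the earlier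
    pieces, and the sums over the splits are Poisson convolutions. *)
Lemma seqprob_total J m (B : 'I_m -> set E) (ks : 'I_m -> nat) :
  (forall i, measurable (B i)) -> (forall i j, i != j -> B i `&` B j = set0) ->
  seqprob marked [set w | forall i, total J w (B i) = ks i] =
  (\prod_i poisson_p (\sum_(j < J) fine (lam (B i `&` Sj j))) (ks i))%:E.
Proof.
move=> mB dB.
have mtot J' (ks' : 'I_m -> nat) :
    measurable [set w : Om | forall i, total J' w (B i) = ks' i].
  rewrite (_ : mkset _ = \bigcap_(i in setT) [set w | total J' w (B i) = ks' i]).
    apply: fin_bigcap_measurable => [|i _]; first exact: finite_finset.
    rewrite -[X in measurable X]setTI.
    have mks : measurable [set ks' i] by [].
    exact: (measurable_total J' (mB i) measurableT mks).
  by apply/seteqP; split => w h i; [move=> _|]; exact: h.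
elim: J ks => [|J ih] ks.
  have [k0|/existsP[i ki]] := boolP [forall i, ks i == 0%N].
    rewrite [mkset _](_ : _ = setT) ?probability_setT.
      rewrite big1// => i _; rewrite big_ord0 (eqP (forallP k0 i)).
      by rewrite /poisson_p oppr0 expR0 mul1r expr0 fact0 divr1.
    apply/seteqP; split => // w _ i.
    by rewrite (eqP (forallP k0 i)) /total big_ord0.
  rewrite [mkset _](_ : _ = set0) ?measure0.
    rewrite (bigD1 i)//= big_ord0 /poisson_p expr0n (negbTE ki).
    by rewrite mulr0 !mul0r.
  by apply/seteqP; split => // w /= /(_ i); rewrite /total big_ord0 => k0; rewrite -k0 eqxx in ki.
(* On the event no partial count exceeds [K], so there are finitely many splits and [inord] loses
   nothing. *)
pose K := (\max_i ks i)%N.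
have ksK i : (ks i < K.+1)%N by rewrite ltnS /K leq_bigmax.
pose X (w : Om) : {ffun 'I_m -> 'I_K.+1} := [ffun i => inord (total J w (B i))].
pose D (f : {ffun 'I_m -> 'I_K.+1}) := [set z : nat * seqspace E |
  forall i, count z.1 z.2 (B i `&` Sj J) = (ks i - f i)%N].
have mD f : measurable (D f).
  rewrite (_ : D f = \bigcap_(i in setT)
      [set z | count z.1 z.2 (B i `&` Sj J) = (ks i - f i)%N]).
    apply: fin_bigcap_measurable => [|i _]; first exact: finite_finset.
    rewrite -[X in measurable X]setTI.
    have mc n := measurable_count n (measurableI _ _ (mB i) (mS J)).
    have mks : measurable [set (ks i - f i)%N] by [].
    exact: (measurable_prod_nat mc measurableT mks).
  by apply/seteqP; split => w h i; [move=> _|]; exact: h.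
have totS w i : total J.+1 w (B i) =
    (total J w (B i) + count (w J).1 (w J).2 (B i `&` Sj J))%N.
  by rewrite /total big_ord_recr.
have fiberE f : [set w | forall i, total J.+1 w (B i) = ks i] `&` [set w | X w = f] =
    if [forall i, f i <= ks i]%N then
      [set w | forall i, total J w (B i) = f i] `&` [set w | D f (w J)]
    else set0.
  case: ifPn => [/forallP fk|/forallPn[i]]; last first.
    rewrite -ltnNge => ki; apply/seteqP; split => // w [h wf].
    have tK : (total J w (B i) < K.+1)%N.
      by apply: leq_ltn_trans (ksK i); rewrite -(h i) totS leq_addr.
    by move: ki; rewrite -wf ffunE inordK// -(h i) totS ltnNge leq_addr.
  apply/seteqP; split => [w [h wf]|w [h hD]].
    have tf i : total J w (B i) = f i.
      rewrite -wf ffunE inordK//; apply: leq_ltn_trans (ksK i).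
      by rewrite -(h i) totS leq_addr.
    by split => // i; rewrite -(h i) totS -tf addKn.
  split => [i|]; first by rewrite totS h hD subnKC.
  by apply/ffunP => i; apply/val_inj; rewrite ffunE h inord_val.
rewrite (@measure_fibers _ _ _ _ _ _ X); last first.
  move=> f; rewrite fiberE; case: ifP => // _.
  apply: measurableI; first exact: (mtot J (fun i => f i)).
  rewrite -[X in measurable X]setTI.
  exact: (measurable_coord J measurableT (mD f)).
set alpha := fun i => \sum_(j < J) fine (lam (B i `&` Sj j)).
set beta := fun i => fine (lam (B i `&` Sj J)).
(* The indicator discards the splits for which [ks i - f i] would be truncated; distributivity then
   turns the sum over [f] into a product of convolutions. *)
rewrite (eq_bigr (fun f : {ffun 'I_m -> 'I_K.+1} => (\prod_i ((f i <= ks i)%N%:R *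
    (poisson_p (alpha i) (f i) * poisson_p (beta i) (ks i - f i))))%:E)).
  rewrite sumEFin; congr EFin.
  rewrite -(bigA_distr_bigA (fun i (k : 'I_K.+1) => (k <= ks i)%N%:R *
    (poisson_p (alpha i) k * poisson_p (beta i) (ks i - k)))).
  apply: eq_bigr => i _; rewrite [in RHS]big_ord_recr/= -/(alpha i) -/(beta i).
  rewrite -[RHS]poisson_p_conv [RHS](big_ord_widen K.+1 (fun k =>
    poisson_p (alpha i) k * poisson_p (beta i) (ks i - k)))// [RHS]big_mkcond/=.
  by apply: eq_bigr => k _; rewrite ltnS; case: ifP; rewrite ?mul1r ?mul0r.
move=> f _; rewrite fiberE; case: ifPn => [/forallP fk|/forallPn[i ki]]; last first.
  by rewrite measure0 (bigD1 i)//= (negbTE ki) !mul0r.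
have dep : depends_below J [set w : Om | forall i, total J w (B i) = f i].
  move=> w w' ww'; apply/propext; split => h i.
    by rewrite -(h i); apply: total_depends_below => j /ww' ->.
  by rewrite -(h i); apply: total_depends_below => j /ww' ->.
apply: (etrans (seqprob_indep marked (mtot J (fun i => f i)) dep (mD f))).
rewrite (ih (fun i => f i)) /marked mixture_count; last 3 first.
- by rewrite fine_ge0.
- by move=> i; exact: measurableI.
- by move=> i j ij; rewrite setIACA dB// set0I.
rewrite -EFinM -big_split/=; congr EFin; apply: eq_bigr => i _.
by rewrite fk mul1r /beta -piece_probE.
Qed.

End superposition.

(** * Second countable spaces and rings of Borel sets *)

Section basis_sequence.
Context {S : ptopologicalType}.
Implicit Types (c : nat -> set S) (A B K O : set S).

Definition basis_seq c :=
  (forall i, open (c i)) /\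
  (forall x O, open O -> O x -> exists2 i, c i x & c i `<=` O).

Lemma basis_seq_exists (C : set (set S)) : countable C -> basis C ->
  exists2 c : nat -> set S, basis_seq c & forall i, C (c i).
Proof.
move=> cC [Co Cb].
have CO x O : open O -> O x -> exists2 B, C B /\ B x & B `<=` O.
  move=> oO Ox; have : nbhs x O by apply: open_nbhs_nbhs; split.
  by move=> /(Cb x)[B [CB Bx] BO]; exists B.
have [|[f]] := pfcard_geP cC.
  by move=> C0; have [B [+ _] _] := CO point setT openT I; rewrite C0.
exists f; last by move=> i; exact: (@funS _ _ _ _ f).
split=> [i|x O oO Ox]; first by apply: Co; exact: (@funS _ _ _ _ f).
have [B [CB Bx] BO] := CO x O oO Ox.
have [i _ fi] := @surj _ _ _ _ f B CB.
by exists i; rewrite fi.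
Qed.

Definition bunion c (s : seq nat) : set S := \bigcup_(i in [set` s]) c i.

Lemma open_bunion c s : basis_seq c -> open (bunion c s).
Proof. by move=> [oc _]; apply: bigcup_open => i _; exact: oc. Qed.

Lemma compact_subcover c K (P : nat -> Prop) : basis_seq c -> compact K ->
  (forall x, K x -> exists2 i, P i & c i x) ->
  exists2 s : seq nat, (forall i, i \in s -> P i) & K `<=` bunion c s.
Proof.
move=> [oc _] + KP; rewrite compact_cover => /(_ nat [set i | P i] c) [].
- by move=> i _; exact: oc.
- by move=> x /KP[i Pi cix]; exists i.
move=> s sP Ks; exists (finmap.enum_fset s); last exact: Ks.
by move=> i /sP; rewrite inE.
Qed.

Lemma compact_bunion c K : basis_seq c -> compact K ->
  exists s : seq nat, K `<=` bunion c s.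
Proof.
move=> bc cK; have [x _|s _ Ks] := compact_subcover (P := fun=> True) bc cK.
  by have [i ci _] := bc.2 x setT openT I; exists i.
by exists s.
Qed.

(** Makes a compact set the intersection of the finite unions of basic sets that contain it. *)
Lemma compact_avoid c K x : hausdorff_space S -> basis_seq c -> compact K ->
  ~ K x -> exists2 s : seq nat, K `<=` bunion c s & ~ bunion c s x.
Proof.
move=> hS bc cK Kx.
have [y Ky|s sx Ks] := compact_subcover (P := fun i => ~ c i x) bc cK.
  have yx : y != x by apply/eqP => yx; apply: Kx; rewrite -yx.
  have [V [oV /set_mem Vy /set_mem Vx]] := hausdorff_accessible hS yx.
  have [i ciy ciV] := bc.2 y V oV Vy.
  by exists i => // /ciV.
by exists s => // -[i /= /sx].
Qed.

End basis_sequence.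

Section ring_of_sets_theory.
Context {S : ptopologicalType}.
Variable U : set (set S).
Hypothesis ringU : ring_of_sets U.

Lemma ring_set0 : U set0.
Proof. by have [[A UA] [_ [_ UD]]] := ringU; rewrite -(setDv A); exact: UD. Qed.

Lemma ring_setD A B : U A -> U B -> U (A `\` B).
Proof.
have [_ [_ [UI UD]]] := ringU => UA UB.
have -> : A `\` B = A `\` (A `&` B) by rewrite setDIr setDv set0U.
by apply: UD => //; exact: UI.
Qed.

Lemma ring_bunion (c : nat -> set S) s : (forall i, U (c i)) -> U (bunion c s).
Proof.
have [_ [UU _]] := ringU => Uc; rewrite /bunion; elim: s => [|i s ih].
  rewrite (_ : \bigcup_(i in _) _ = set0); first exact: ring_set0.
  by apply/seteqP; split => // x [].
rewrite (_ : \bigcup_(i in _) _ = c i `|` bunion c s); first exact: UU.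
apply/seteqP; split => [x [j /=]|x [cx|[j /= js cx]]].
- by rewrite inE => /orP[/eqP-> cx|js cx]; [left|right; exists j].
- by exists i => //=; rewrite inE eqxx.
- by exists j => //=; rewrite inE js orbT.
Qed.

(** A ring has no complements, so the cell is cut out of a member [Z]. *)
Lemma ring_cell (I : finType) (X : I -> set S) (Z : set S) (s : {set I}) :
  (forall i, U (X i)) -> U Z -> U (Z `&` [set x | forall i, X i x <-> i \in s]).
Proof.
move=> UX UZ; have [_ [_ [UI _]]] := ringU.
suff h (r : seq I) : U (Z `&` [set x | forall i, i \in r -> X i x <-> i \in s]).
  rewrite (_ : _ `&` _ =
    Z `&` [set x | forall i, i \in index_enum I -> X i x <-> i \in s])//.
  by congr (_ `&` _); apply/seteqP; split => x h' i; [move=> _|];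
    apply: h'; rewrite mem_index_enum.
elim: r => [|i r ih].
  rewrite (_ : _ `&` _ = Z)//.
  by apply/seteqP; split => [x []//|x Zx]; split.
rewrite (_ : _ `&` _ =
    if i \in s then (Z `&` [set x | forall i, i \in r -> X i x <-> i \in s]) `&` X i
    else (Z `&` [set x | forall i, i \in r -> X i x <-> i \in s]) `\` X i).
  by case: ifP => _; [exact: UI|exact: ring_setD].
case: ifPn => si; apply/seteqP; split => x.
- move=> [Zx h]; split; last by apply/h; rewrite ?inE ?eqxx.
  by split => // j jr; apply: h; rewrite inE jr orbT.
- move=> [[Zx h] Xx]; split => // j; rewrite inE => /orP[/eqP->|/h//].
  by split.
- move=> [Zx h]; split; last by move/(h i (mem_head _ _)); rewrite (negbTE si).
  by split => // j jr; apply: h; rewrite inE jr orbT.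
- move=> [[Zx h] Xx]; split => // j; rewrite inE => /orP[/eqP->|/h//].
  by split => //; rewrite (negbTE si).
Qed.

End ring_of_sets_theory.

Section borel.
Context {R : realType} {S : ptopologicalType}.
Local Notation measS := {measure set (BorelS S) -> \bar R}.
Implicit Types (c : nat -> set S) (A B K O : set S).

Lemma borel_open O : open O -> measurable (O : set (BorelS S)).
Proof. by move=> oO; apply: sub_sigma_algebra. Qed.

Lemma borel_closed O : closed O -> measurable (O : set (BorelS S)).
Proof.
move=> cO; rewrite -[X in measurable X]setCK; apply: measurableC.
by apply: borel_open; exact: closed_openC.
Qed.

Lemma rc_borel_closure B : rc_borel B -> rc_borel (closure B).
Proof.
move=> [_ pB]; split; first by apply: borel_closed; exact: closed_closure.
by rewrite precompactE -(closure_id _).1 -?precompactE//; exact: closed_closure.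
Qed.

Lemma rc_borelS A B : measurable (A : set (BorelS S)) -> A `<=` B ->
  rc_borel B -> rc_borel A.
Proof. by move=> mA AB [_ pB]; split => //; exact: precompact_subset pB. Qed.

(* [K] is the intersection of a decreasing sequence of open members of [U]. *)
Lemma outer_open (lam : measS) (U : set (set S)) c K (e : R) :
  hausdorff_space S -> locally_finite lam -> ring_of_sets U ->
  (forall B, U B -> rc_borel B) -> basis_seq c -> (forall i, U (c i)) ->
  compact K -> (lam K < e%:E)%E ->
  exists N, [/\ U N, open N, K `<=` N & (lam N < e%:E)%E].
Proof.
move=> hS lf rU Urc bc Uc cK Ke.
have Ub s : U (bunion c s) by exact: ring_bunion.
have UI : forall A B, U A -> U B -> U (A `&` B) by case: rU => _ [_ []].
have [s0 Ks0] := compact_bunion bc cK.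
(* [D] runs through all finite unions of basic sets that cover [K]; every other code falls back on
   the cover [s0]. *)
pose D (n : nat) : set S :=
  if unpickle n is Some s then
    if `[< K `<=` bunion c s >] then bunion c s else bunion c s0
  else bunion c s0.
have UDn n : U (D n) by rewrite /D; case: unpickle => // s; case: ifP.
have oD n : open (D n).
  by rewrite /D; case: unpickle => [s|]; [case: ifP => _|]; exact: open_bunion.
have KD n : K `<=` D n.
  by rewrite /D; case: unpickle => // s; case: ifPn => // /asboolP.
pose N := fix N n := if n is n'.+1 then N n' `&` D n' else bunion c s0.
have UN n : U (N n) by elim: n => [|n ih] //=; exact: UI.
have oN n : open (N n).
  by elim: n => [|n ih] /=; [exact: open_bunion|exact: openI].
have KN n : K `<=` N n.
  by elim: n => [|n ih] //= x Kx; split; [exact: ih|exact: KD].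
have niN : nonincreasing_seq N.
  by apply/nonincreasing_seqP => n; apply/subsetPset => x [].
have capN : \bigcap_n N n = K.
  apply/seteqP; split => [x Nx|x Kx n _]; last exact: KN.
  apply: contrapT => nKx.
  have [s Ks nsx] := compact_avoid hS bc cK nKx; apply: nsx.
  have [_] := Nx (choice.pickle s).+1 I.
  by rewrite /D pickleK asboolT.
have : lam \o N @ \oo --> lam (\bigcap_n N n).
  apply: nonincreasing_cvg_mu => //.
  - by apply: lf; exact: Urc.
  - by move=> n; apply: borel_open.
  - by apply: bigcap_measurableType => n _; exact: borel_open.
rewrite capN => /(_ _ (open_ereal_lt' Ke))[n _ /(_ n (leqnn n)) Nne].
by exists (N n).
Qed.

End borel.

(** * Existence of the Poisson process *)

(** Bounded partial sums of naturals attain their maximum and stay there; unbounded ones exceed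
    every real. *)
Lemma nneseries_natE (R : realType) (u : nat -> nat) :
  (exists k : nat, (\sum_(j <oo) (u j)%:R%:E)%E = k%:R%:E :> \bar R) \/
  (\sum_(j <oo) (u j)%:R%:E)%E = +oo%E :> \bar R.
Proof.
pose s n := (\sum_(0 <= j < n) u j)%N.
have sE n : (\sum_(0 <= j < n) (u j)%:R%:E)%E = (s n)%:R%:E :> \bar R.
  by rewrite sumEFin /s natr_sum.
have ns m n : (m <= n)%N -> (s m <= s n)%N.
  by move=> mn; rewrite /s (big_cat_nat (leq0n m) mn)/= leq_addr.
have [[M sM]|] := pselect (exists M, forall n, (s n <= M)%N).
  have [N sN] : exists N, forall n, (s n <= s N)%N.
    have ex : exists m, `[< exists n, m = s n >] by exists (s 0%N); apply/asboolP; exists 0%N.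
    have bd m : `[< exists n, m = s n >] -> (m <= M)%N by move/asboolP => -[n ->].
    case: (ex_maxnP ex bd) => m /asboolP[N ->] h; exists N => n.
    by apply: h; apply/asboolP; exists n.
  left; exists (s N); apply: lim_near_cst => //.
  exists N => // n /= Nn; rewrite sE; congr (_%:R%:E).
  by apply/eqP; rewrite eqn_leq sN ns.
move=> nM; right; apply/eqyP => r r0.
have [n sn] : exists n, (Num.bound r < s n)%N.
  apply: contrapT => /forallNP nsn; apply: nM; exists (Num.bound r) => n.
  by rewrite leqNgt; apply/negP; exact: nsn.
apply: (@le_trans _ _ (s n)%:R%:E).
  by rewrite lee_fin ltW// (lt_trans (archi_boundP (ltW r0)))// ltr_nat.
by rewrite -sE; apply: nneseries_lim_ge => j _ _; rewrite lee_fin.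
Qed.

Section poisson_process_exists.
Context {R : realType} {S : ptopologicalType}.
Local Notation measS := {measure set (BorelS S) -> \bar R}.

Lemma poisson_process_exists (lam : measS) (c : nat -> set S) :
  basis_seq c -> (forall i, rc_borel (c i)) -> locally_finite lam ->
  exists (d : measure_display) (Om : measurableType d) (Q : probability Om R)
    (eta : Om -> measS), poisson_process Q eta lam.
Proof.
move=> bc rc lf.
pose Sj : nat -> set (BorelS S) := seqDU c.
have mc i : measurable (c i : set (BorelS S)) := (rc i).1.
have mS j : measurable (Sj j : set (BorelS S)).
  by apply: measurableD => //; exact: bigsetU_measurable.
have lamS j : (lam (Sj j) < +oo)%E.
  apply: le_lt_trans (lf _ (rc j)); apply: le_measure; rewrite ?inE//.
  exact: subset_seqDU.
(* Finitely many basic sets cover the compact closure of [B], and the pieces with indices up to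
   their maximum have the same union as the basic sets. *)
have rcJ (B : set S) : rc_borel B -> exists J, B `<=` \bigcup_(j < J) Sj j.
  move=> [mB pB]; have cB : compact (closure B) by rewrite -precompactE.
  have [s Bs] := compact_bunion bc cB.
  exists (\max_(i <- s) i).+1 => x /subset_closure/Bs[i /= is_ cx].
  rewrite bigcup_mkord -bigsetU_seqDU -bigcup_mkord; exists i => //=.
  by rewrite ltnS; exact: (leq_bigmax_seq (F := id)).
have rcJW (B : set S) J J' : (J <= J')%N -> B `<=` \bigcup_(j < J) Sj j ->
    B `<=` \bigcup_(j < J') Sj j.
  by move=> JJ' BJ x /BJ[j /= jJ Sx]; exists j => //=; exact: leq_trans JJ'.
have lamE (B : set S) J : rc_borel B -> B `<=` \bigcup_(j < J) Sj j ->
    \sum_(j < J) fine (lam (B `&` Sj j)) = fine (lam B).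
  move=> rB BJ; have mB := rB.1.
  apply: EFin_inj; rewrite -sumEFin fineK ?ge0_fin_numE ?lf//.
  rewrite -[in RHS](setIidl BJ) bigcup_mkord big_distrr/=.
  rewrite measure_bigsetU_ord//=; last 2 first.
  - by move=> i; exact: measurableI.
  - apply: trivIset_setIl => i j _ _ ij; apply/val_inj.
    by apply: (trivIset_seqDU c) => //.
  apply: eq_bigr => j _; rewrite fineK// ge0_fin_numE//.
  apply: le_lt_trans (lamS j); apply: le_measure; rewrite ?inE//.
  exact: measurableI.
pose Q := seqprob (marked lam mS).
pose eta := @superpose _ (BorelS S) R Sj mS.
have etaE w (B : set (BorelS S)) J : B `<=` \bigcup_(j < J) Sj j ->
    eta w B = (total Sj J w B)%:R%:E.
  by move=> BJ; apply: superpose_total => //; exact: trivIset_seqDU.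
have joint m (Bs : 'I_m -> set S) (ks : 'I_m -> nat) :
    (forall i, rc_borel (Bs i)) -> (forall i j, i != j -> Bs i `&` Bs j = set0) ->
    Q [set w | forall i, eta w (Bs i) = ((ks i)%:R)%:E] =
    (\prod_i poisson_p (fine (lam (Bs i))) (ks i))%:E.
  move=> rB dB.
  have /choice[J BJ] i : exists J, Bs i `<=` \bigcup_(j < J) Sj j by exact: rcJ.
  pose JJ := (\max_i J i)%N.
  have {}BJ i : Bs i `<=` \bigcup_(j < JJ) Sj j.
    by apply: rcJW (BJ i); exact: leq_bigmax.
  have mB i : measurable (Bs i : set (BorelS S)) := (rB i).1.
  have := seqprob_total mS lamS JJ ks mB dB; rewrite -/Q => H.
  rewrite (_ : mkset _ =
      [set w | forall i, total Sj JJ w (Bs i) = ks i]); last first.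
    apply/seteqP; split => w /= h i.
      by have := h i; rewrite (etaE _ _ JJ)// => -[] /eqP; rewrite eqr_nat => /eqP.
    by rewrite (etaE _ _ JJ)// h.
  rewrite H; congr EFin; apply: eq_bigr => i _.
  by rewrite (lamE (Bs i) JJ).
have marginal (B : set S) : rc_borel B -> forall k : nat,
    Q [set w | eta w B = (k%:R)%:E] = (poisson_p (fine (lam B)) k)%:E.
  move=> rB k; have := joint 1%N (fun=> B) (fun=> k) (fun=> rB).
  rewrite big_ord1 => <-; last by move=> i j; rewrite !ord1 eqxx.
  congr (Q _); apply/seteqP; split => w /=; first by move=> h _.
  by move/(_ ord0).
exists _, _, [the probability _ R of Q], eta; split; [split|split] => //.
- move=> w; split.
    move=> B rB; have [J BJ] := rcJ _ rB.
    by rewrite (etaE _ _ J)// ltry.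
  move=> B mB; rewrite /eta superposeE.
  have [[k ->]|->] := nneseries_natE R
      (fun j => count (w j).1 (w j).2 (B `&` Sj j)); last by right.
  by left; exists k.
- move=> B rB; have [J BJ] := rcJ _ rB.
  rewrite (_ : (fun w => _) = (fun w => (total Sj J w B)%:R%:E)); last first.
    by apply/funext => w; rewrite (etaE _ _ J).
  apply/measurable_EFinP.
  have mnat : measurable_fun [set: nat] (fun n : nat => n%:R : R) by [].
  exact: (measurableT_comp mnat (measurable_total mS J rB.1)).
- move=> m Bs ks rB dB; apply: (etrans (joint m Bs ks rB dB)).
  congr EFin; apply: eq_bigr => i _.
  by have := congr1 fine (marginal (Bs i) (rB i) (ks i)) => /= ->.
Qed.

End poisson_process_exists.

(** * The Poisson recursion *)

Lemma cvg_sumr (R : realType) (I : Type) (r : seq I) (P : pred I)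
    (f : I -> nat -> R) (l : I -> R) : (forall i, P i -> f i @ \oo --> l i) ->
  (fun n => \sum_(i <- r | P i) f i n) @ \oo --> \sum_(i <- r | P i) l i.
Proof.
move=> fl; elim: r => [|i r ih].
  rewrite big_nil (_ : (fun n => _) = cst 0); first exact: cvg_cst.
  by apply/funext => n; rewrite big_nil.
rewrite big_cons (_ : (fun n => _) = (fun n =>
  if P i then f i n + \sum_(j <- r | P j) f j n else \sum_(j <- r | P j) f j n)).
  by case: ifPn => // Pi; apply: cvgD => //; exact: fl.
by apply/funext => n; rewrite big_cons.
Qed.

(** The recursion ties every [p n k] asymptotically to [p n 0], with ratio [a ^+ k / k!]. The total
    mass then fixes the limit of [p n 0], and tightness keeps this mass from escaping to
    infinity. *)
Lemma poisson_recurrence (R : realType) (p : nat -> nat -> R) (a : R) :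
  (forall n k, 0 <= p n k) -> (forall n K, \sum_(k < K) p n k <= 1) ->
  (forall e, 0 < e -> exists K, forall n, 1 - e <= \sum_(k < K) p n k) ->
  (forall k, (fun n => k.+1%:R * p n k.+1 - a * p n k) @ \oo --> (0 : R)) ->
  forall k, (fun n => p n k) @ \oo --> poisson_p a k.
Proof.
move=> p0 p1 pt rec.
(* Splits [1 - x q] as [(1 - s) + (s - E q) + (E - x) q], where [s] is a partial mass, [E] a partial
   sum of the exponential series, [x] its limit and [q] the mass at 0. *)
have aux (e s E x q : R) : 0 <= q -> q <= 1 -> 1 - e / 3 <= s -> s <= 1 ->
    `|s - E * q| <= e / 3 -> `|x - E| <= e / 3 -> `|1 - x * q| <= e.
  move=> q0 q1 s0 s1; rewrite !ler_norml => /andP[h1 h2] /andP[h3 h4].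
  have h5 : (x - E) * q <= e / 3 by nra.
  have h6 : - (e / 3) <= (x - E) * q by nra.
  by apply/andP; split; lra.
have d0 k : (fun n => p n k - a ^+ k / k`!%:R * p n 0%N) @ \oo --> (0 : R).
  elim: k => [|k ih].
    rewrite (_ : (fun n => _) = cst 0); first exact: cvg_cst.
    by apply/funext => n; rewrite expr0 fact0 divr1 mul1r subrr.
  rewrite (_ : (fun n => _) = (fun n => k.+1%:R^-1 * (k.+1%:R * p n k.+1 - a * p n k)
      + a / k.+1%:R * (p n k - a ^+ k / k`!%:R * p n 0%N))).
    rewrite -[X in _ --> X](_ : k.+1%:R^-1 * 0 + a / k.+1%:R * 0 = 0); last first.
      by rewrite !mulr0 addr0.
    by apply: cvgD; apply: cvgMr.
  apply/funext => n; rewrite factS natrM exprS; field.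
  by rewrite nat1r !pnatr_eq0 -lt0n fact_gt0.
have p00 : (fun n => p n 0%N) @ \oo --> expR (- a).
  suff h : (fun n => expR a * p n 0%N) @ \oo --> (1 : R).
    rewrite (_ : (fun n => _) = (fun n => expR (- a) * (expR a * p n 0%N))).
      by rewrite -[X in _ --> X]mulr1; apply: cvgMr.
    by apply/funext => n; rewrite mulrA -expRD addNr expR0 mul1r.
  apply/cvgrPdist_le => e e0.
  have e3 : 0 < e / 3 by rewrite divr_gt0.
  have [K1 hK1] := pt _ e3.
  have : series (exp_coeff a) @ \oo --> expR a by exact: is_cvg_series_exp_coeff.
  move/cvgrPdist_le => /(_ _ e3)[K2 _ hK2].
  (* Large enough both for tightness and for the exponential series. *)
  pose K := maxn K1 K2.
  have hK n : 1 - e / 3 <= \sum_(k < K) p n k.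
    apply: (le_trans (hK1 n)).
    by rewrite /K -(subnKC (leq_maxl K1 K2)) big_split_ord/= lerDl sumr_ge0.
  have {}hK2 : `|expR a - \sum_(k < K) a ^+ k / k`!%:R| <= e / 3.
    have := hK2 K (leq_maxr _ _); rewrite /series/= big_mkord.
    by rewrite /exp_coeff.
  have : (fun n => \sum_(k < K) (p n k - a ^+ k / k`!%:R * p n 0%N)) @ \oo --> (0 : R).
    rewrite -[X in _ --> X](_ : \sum_(k < K) (0 : R) = 0); last by rewrite big1.
    by apply: cvg_sumr => k _; exact: d0.
  move/cvgrPdist_le => /(_ _ e3); apply: filterS => n.
  rewrite sub0r normrN sumrB -mulr_suml => h.
  have q0 := p0 n 0%N.
  have q1 : p n 0%N <= 1 by have := p1 n 1%N; rewrite big_ord1.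
  have := hK n; have := p1 n K.
  by move=> h5 h6; apply: (aux e _ _ _ _ q0 q1 h6 h5 h hK2).
move=> k.
rewrite (_ : (fun n => _) = (fun n => (p n k - a ^+ k / k`!%:R * p n 0%N) +
   a ^+ k / k`!%:R * p n 0%N)); last by apply/funext => n; rewrite subrK.
rewrite (_ : poisson_p a k = 0 + a ^+ k / k`!%:R * expR (- a)); last first.
  by rewrite add0r /poisson_p -mulrA mulrC.
by apply: cvgD; [exact: d0|apply: cvgMr].
Qed.

Section nat_valued.
Context d (Om : measurableType d) (R : realType) (P : probability Om R).

Lemma fine_probability_le1 (A : set Om) : measurable A -> fine (P A) <= 1.
Proof.
by move=> mA; rewrite -lee_fin fineK ?fin_num_measure// probability_le1.
Qed.

Lemma fine_probability_le (A B : set Om) : measurable A -> measurable B ->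
  A `<=` B -> fine (P A) <= fine (P B).
Proof.
move=> mA mB AB; apply: fine_le; rewrite ?fin_num_measure//.
by apply: le_measure; rewrite ?inE.
Qed.

Lemma fine_probabilityC (A : set Om) : measurable A ->
  fine (P (~` A)) = 1 - fine (P A).
Proof.
move=> mA; rewrite probability_setC// -[X in (_ - X)%E]fineK ?fin_num_measure//.
Qed.

Lemma measurable_eq_cst (X : Om -> \bar R) (x : \bar R) :
  measurable_fun [set: Om] X -> measurable [set w | X w = x].
Proof.
move=> mX; rewrite -[Y in measurable Y]setTI.
exact: (mX measurableT _ (emeasurable_set1 x)).
Qed.

Lemma sum_pmf (X : Om -> \bar R) (K : nat) : measurable_fun [set: Om] X ->
  (forall w, exists k : nat, X w = k%:R%:E) ->
  \sum_(k < K) fine (P [set w | X w = k%:R%:E]) = fine (P [set w | (X w < K%:R%:E)%E]).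
Proof.
move=> mX Xn; apply: EFin_inj; rewrite -sumEFin.
have mk k : measurable [set w | X w = k%:R%:E] by exact: measurable_eq_cst.
have -> : [set w | (X w < K%:R%:E)%E] =
    \big[setU/set0]_(k < K) [set w | X w = k%:R%:E].
  rewrite -(bigcup_mkord K (fun k => [set w | X w = k%:R%:E])).
  apply/seteqP; split => [w /=|w [k /= kK ->]]; last by rewrite lte_fin ltr_nat.
  by have [k Xk] := Xn w; rewrite Xk lte_fin ltr_nat => kK; exists k.
rewrite fineK ?fin_num_measure//; last by exact: bigsetU_measurable.
rewrite (measure_bigsetU P (F := fun k => [set w | X w = k%:R%:E]))//.
  by apply: eq_bigr => k _; rewrite fineK ?fin_num_measure.
by move=> i j _ _ [w [/= -> [/eqP]]]; rewrite eqr_nat => /eqP.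
Qed.

Lemma tight_poisson (X : nat -> Om -> \bar R) (a : R) :
  (forall n, measurable_fun [set: Om] (X n)) ->
  (forall n w, exists k : nat, X n w = k%:R%:E) ->
  tight_seq P X ->
  (forall k, (fun n => k.+1%:R * fine (P [set w | X n w = k.+1%:R%:E])
      - a * fine (P [set w | X n w = k%:R%:E])) @ \oo --> (0 : R)) ->
  forall k, (fun n => fine (P [set w | X n w = k%:R%:E])) @ \oo --> poisson_p a k.
Proof.
move=> mX Xn tX rec.
have mlt n K : measurable [set w | (X n w < K%:R%:E)%E].
  by rewrite -[Y in measurable Y]setTI; exact: emeasurable_fun_infty_o.
apply: (@poisson_recurrence _ (fun n k => fine (P [set w | X n w = k%:R%:E]))) => //.
- by move=> n k; rewrite fine_ge0.
- by move=> n K /=; rewrite (sum_pmf K (mX n) (Xn n)) fine_probability_le1.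
- move=> e e0; have [M MP] := tX _ e0.
  (* The tightness bound [M] is an arbitrary real; this natural number exceeds it. *)
  exists (Num.bound `|M|).+1 => n /=; rewrite (sum_pmf _ (mX n) (Xn n)).
  rewrite -[X in fine (P X)]setCK fine_probabilityC; last exact: measurableC.
  rewrite lerD2l lerN2 -lee_fin fineK ?fin_num_measure//; last exact: measurableC.
  apply: le_trans (MP n); apply: le_measure; rewrite ?inE.
  + exact: measurableC.
  + by rewrite -[Y in measurable Y]setTI; exact: emeasurable_fun_o_infty.
  + move=> w /= /negP; rewrite -leNgt; apply: lt_le_trans.
    rewrite lte_fin (le_lt_trans (ler_norm M))// (lt_trans (archi_boundP _))//.
    by rewrite ltr_nat.
Qed.

End nat_valued.

(** * Joint law of finitely many counts *)

Lemma measure_bigcup_le d (T : measurableType d) (R : realType)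
    (mu : {measure set T -> \bar R}) (I : finType) (A : set T) (F : I -> set T) :
  measurable A -> (forall i, measurable (F i)) ->
  A `<=` \bigcup_(i in setT) F i -> (mu A <= \sum_i mu (F i))%E.
Proof.
move=> mA mF AF.
rewrite (fsbig_seq _ (fun i => mu (F i)) (index_enum_uniq I)).
apply: content_sub_fsum => // x /AF[i _ Fi].
by exists i => //=; rewrite mem_index_enum.
Qed.

(** * Small open cells up to a set of small measure *)

Section partition.
Context {R : realType} {S : ptopologicalType}.
Variables (lam : {measure set (BorelS S) -> \bar R}) (U : set (set S)).
Variable c : nat -> set S.
Hypotheses (hS : hausdorff_space S) (lf : locally_finite lam).
Hypotheses (ringU : ring_of_sets U) (Ulam : U `<=` lambda_cont_sets lam).
Hypotheses (bc : basis_seq c) (Uc : forall i, U (c i)).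

Lemma ring_rc B : U B -> rc_borel B. Proof. by move=> /Ulam[]. Qed.

Lemma ring_measurable (B : set S) : U B -> measurable (B : set (BorelS S)).
Proof. by move=> /ring_rc[]. Qed.

Lemma lam_fin_num B : rc_borel B -> lam B \is a fin_num.
Proof. by move=> rB; rewrite ge0_fin_numE// lf. Qed.

Lemma compact_closure_rc (B : set S) : rc_borel B -> compact (closure B).
Proof. by move=> [_]; rewrite precompactE. Qed.

Lemma inner_open (W : set S) (e : R) : 0 < e -> U W ->
  exists V, [/\ U V, open V, V `<=` W & (lam (W `\` V) < e%:E)%E].
Proof.
move=> e0 UW; have [rW W0] := Ulam UW.
have mW := ring_measurable UW.
have oi : open (interior W) := open_interior W.
pose G n := bunion c [seq i <- iota 0 n | `[< c i `<=` interior W >]].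
have GW n : G n `<=` interior W.
  by move=> x [i /=]; rewrite mem_filter => /andP[/asboolP + _]; exact.
have capG : \bigcap_n (W `\` G n) = W `\` interior W.
  apply/seteqP; split => [x h|x [Wx nix] n _]; last first.
    by split => // /GW.
  split; first by have [] := h 0%N I.
  move=> ix; have [i ci ciW] := bc.2 x _ oi ix.
  have [_] := h i.+1 I; apply; exists i => //.
  by rewrite /mkset mem_filter mem_iota leq0n add0n ltnSn !andbT; apply/asboolP.
have UG n : U (G n) by exact: ring_bunion.
have lWi : (lam (W `\` interior W) < e%:E)%E.
  rewrite (@subset_measure0 _ _ _ lam _ (closure W `\` interior W))//.
  - by apply: measurableD => //; exact: borel_open.
  - by apply: measurableD; [apply: borel_closed; exact: closed_closure|exact: borel_open].
  - by move=> x [Wx ix]; split => //; exact: subset_closure.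
have : lam \o (fun n => W `\` G n) @ \oo --> lam (\bigcap_n (W `\` G n)).
  apply: nonincreasing_cvg_mu => //=.
  - apply: le_lt_trans (lf rW); apply: le_measure; rewrite ?inE//.
    by apply: measurableD => //; exact: ring_measurable.
  - by move=> n; apply: measurableD => //; exact: ring_measurable.
  - rewrite capG; apply: measurableD => //; exact: borel_open.
  - move=> n m nm; apply/subsetPset => x [Wx Gx]; split => // -[i /=].
    rewrite mem_filter mem_iota /= add0n => /andP[ciW im] cx.
    apply: Gx; exists i => //=; rewrite mem_filter ciW mem_iota/= add0n.
    exact: leq_trans nm.
rewrite capG => /(_ _ (open_ereal_lt' lWi))[n _ /(_ n (leqnn n)) hn].
exists (G n); split => //; first exact: open_bunion.
by move=> x /GW; exact: interior_subset.
Qed.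

(** Without atoms, [outer_open] gives every point an open neighbourhood of small measure. *)
Lemma small_cover (K : set S) (e : R) : non_atomic lam -> 0 < e -> compact K ->
  exists2 s : seq nat, (forall i, i \in s -> (lam (c i) < e%:E)%E) &
    K `<=` bunion c s.
Proof.
move=> na e0 cK; apply: compact_subcover => // x Kx.
have [||N [UN oN xN Ne]] := @outer_open R S lam U c [set x] e hS lf ringU ring_rc bc Uc.
- exact: compact_set1.
- by rewrite na.
have [i cx cN] := bc.2 x N oN (xN _ erefl); exists i => //.
apply: le_lt_trans Ne; apply: le_measure; rewrite ?inE//; exact: ring_measurable.
Qed.

(** The cells are the atoms of the Boolean algebra generated by the [A i] and a cover by sets of
    measure below [e], each shrunk to an open set. What the closures lose is compact and contained
    in null boundaries and shrinking losses, hence has an open neighbourhood [N] of small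
    measure. *)
Lemma open_partition (I : finType) (A : I -> set S) (e : R) :
  non_atomic lam -> 0 < e -> (forall i, U (A i)) -> (forall i, open (A i)) ->
  exists (T : finType) (V : T -> set S) (N : set S),
  [/\ forall t, [/\ U (V t), open (V t) & (lam (V t) < e%:E)%E],
      forall t t', t != t' -> V t `&` V t' = set0,
      forall t i, V t `<=` A i \/ V t `&` closure (A i) = set0,
      [/\ U N, open N & (lam N < e%:E)%E] /\
      \bigcup_(i in setT) closure (A i) `<=` N `|` \bigcup_(t in setT) V t &
      (\sum_t lam (V t) <= lam (\bigcup_(i in setT) A i))%E].
Proof.
move=> na e0 UA oA.
pose K := \bigcup_(i in [set: I]) closure (A i).
have cK : compact K.
  rewrite /K -(bigsetU_fset_set _ finite_finset).
  by apply: bigsetU_compact => i _; apply: compact_closure_rc; exact: ring_rc.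
have mA i := ring_measurable (UA i).
have [s sD Ks] := small_cover na e0 cK.
pose D (l : 'I_(size s)) := c (nth 0%N s l).
pose X (k : I + 'I_(size s)) := match k with inl i => A i | inr l => D l end.
have UX k : U (X k) by case: k => [i|l] /=; [exact: UA|exact: Uc].
(* A cell is indexed by the set of generators that contain it. Lying in some [A i] bounds the total
   measure of the cells, lying in some [D l] makes each of them small. *)
pose T : finType := {set (I + 'I_(size s))}.
pose cell (t : T) : set S :=
  [set x | (exists i, A i x) /\ (exists l, D l x) /\
     forall k, X k x <-> k \in t].
have Ucell t : U (cell t).
  have [[i it]|ni] := pselect (exists i, inl i \in t); last first.
    rewrite (_ : cell t = set0); first exact: ring_set0.
    apply/seteqP; split => // x [[i Ax] [_ h]]; apply: ni; exists i.
    by apply/h.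
  have [[l lt]|nl] := pselect (exists l, inr l \in t); last first.
    rewrite (_ : cell t = set0); first exact: ring_set0.
    apply/seteqP; split => // x [_ [[l Dx] h]]; apply: nl; exists l.
    by apply/h.
  rewrite (_ : cell t = A i `&` [set x | forall k, X k x <-> k \in t]).
    exact: ring_cell.
  apply/seteqP; split => [x [_ [_ h]]|x [Ax h]]; first by split => //; exact/(h (inl i)).
  by split; [exists i|split => //; exists l; exact/(h (inr l))].
have mcell t := ring_measurable (Ucell t).
(* The successor in the denominator makes the sum of the shrinking losses strictly less than [e]. *)
pose e' := e / (#|T|.+1)%:R.
have e'0 : 0 < e' by rewrite divr_gt0// ltr0n.
have /choice[V hV] t := inner_open e'0 (Ucell t).
have mV t : measurable (V t : set (BorelS S)) by have [/ring_measurable] := hV t.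
have Vcell t : V t `<=` cell t by have [] := hV t.
have dV t t' : t != t' -> V t `&` V t' = set0.
  move=> tt'; apply/seteqP; split => // x [/Vcell[_ [_ h]] /Vcell[_ [_ h']]].
  move: tt' => /eqP; apply; apply/setP => k.
  by apply/idP/idP => [/h/h'|/h'/h].
have mUV : measurable (\bigcup_(t in [set: T]) V t : set (BorelS S)).
  by apply: fin_bigcup_measurable => // t _; exact: mV.
have mK : measurable (K : set (BorelS S)).
  by apply: borel_closed; exact: compact_closed.
have lK : (lam (K `\` \bigcup_(t in setT) V t) < e%:E)%E.
  pose F (k : I + T) : set (BorelS S) := match k with
    inl i => closure (A i) `\` interior (A i) | inr t => cell t `\` V t end.
  have mF k : measurable (F k).
    case: k => [i|t] /=; last exact: measurableD.
    apply: measurableD; first by apply: borel_closed; exact: closed_closure.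
    by apply: borel_open; exact: open_interior.
  apply: (@le_lt_trans _ _ (\sum_k lam (F k))%E).
    apply: measure_bigcup_le => //; first exact: measurableD.
    move=> x [Kx nVx]; have [i _ Ax] := Kx.
    have [iA|niA] := pselect (interior (A i) x); last by exists (inl i).
    have {}Ax := interior_subset iA.
    have [j /= js cx] := Ks x Kx.
    pose t : T := [set k | `[< X k x >]]%SET.
    exists (inr t) => //=; split; last by move=> Vx; apply: nVx; exists t.
    split; first by exists i.
    split; last by move=> k; rewrite inE; split => /asboolP.
    have jlt : (index j s < size s)%N by rewrite index_mem.
    by exists (Ordinal jlt); rewrite /D /= nth_index.
  rewrite big_sumType/= big1 ?add0e; last first.
    by move=> i _; have [] := Ulam (UA i).
  apply: (@le_lt_trans _ _ (\sum_(t : T) e'%:E)%E).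
    by apply: lee_sum => t _; apply: ltW; have [] := hV t.
  rewrite sumEFin lte_fin big_const iter_addr addr0 -mulr_natr /e'.
  rewrite mulrAC ltr_pdivrMr ?ltr0n// ltr_pM2l// ltr_nat ltnS.
  exact: leqnn.
have cKV : compact (K `\` \bigcup_(t in [set: T]) V t).
  apply: (subclosed_compact _ cK); last by move=> x [].
  apply: closedI; first exact: compact_closed.
  by apply: open_closedC; apply: bigcup_open => t _; have [] := hV t.
have [N [UN oN KN Ne]] := outer_open hS lf ringU ring_rc bc Uc cKV lK.
exists T, V, N; split => //.
- move=> t; have [UV oV Vc _] := hV t; split => //.
  have [[l lt]|nl] := pselect (exists l, inr l \in t).
    apply: (@le_lt_trans _ _ (lam (D l))); last by apply: sD; exact: mem_nth.
    apply: le_measure; rewrite ?inE//; first exact: (ring_measurable (Uc _)).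
    by move=> x /Vc[_ [_ h]]; apply/(h (inr l)).
  rewrite (_ : V t = set0) ?measure0//; apply/seteqP; split => // x /Vc[_ [[l Dx] h]].
  by apply: nl; exists l; apply/h.
- move=> t i; have [UV oV Vc _] := hV t.
  have [it|it] := boolP (inl i \in t).
    by left => x /Vc[_ [_ h]]; apply/(h (inl i)).
  (* An open set that meets the closure of [A i] meets [A i] itself. *)
  right; apply/seteqP; split => // x [Vx clx].
  have [|y [Ay /Vc[_ [_ h]]]] := clx (V t); first by apply: open_nbhs_nbhs; split.
  by have := (h (inl i)).1 Ay; rewrite (negbTE it).
- split => // x Kx.
  have [Vx|nVx] := pselect ((\bigcup_(t in [set: T]) V t) x); [by right|left].
  by apply: KN; split.
- rewrite (fsbig_seq _ (fun t => lam (V t)) (index_enum_uniq T)).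
  rewrite -measure_fin_bigcup//; last first.
    move=> t t' _ _ [x Vx]; apply/eqP/negPn/negP => tt'.
    by have : set0 x by rewrite -(dV _ _ tt').
  apply: le_measure; rewrite ?inE//.
  + by apply: fin_bigcup_measurable => // t _; exact: mV.
  + by apply: fin_bigcup_measurable => // i _; exact: mA.
  + by move=> x [t _ /Vcell[[i Ax] _]]; exists i.
Qed.

End partition.

Section fine_probability.
Context d (Om : measurableType d) (R : realType) (P : probability Om R).

Lemma fine_probabilityD (A B : set Om) : measurable A -> measurable B ->
  fine (P (A `&` B)) = fine (P A) - fine (P (A `\` B)).
Proof.
move=> mA mB; apply: EFin_inj; rewrite EFinB !fineK ?fin_num_measure//.
- rewrite (measureDI P mA mB) addeAC subee ?add0e//.
  by rewrite fin_num_measure//; exact: measurableD.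
- exact: measurableD.
- exact: measurableI.
Qed.

Lemma fine_probability_dist (A B F : set Om) (b : R) :
  measurable A -> measurable B -> measurable F -> fine (P F) <= b ->
  (forall w, ~ F w -> A w <-> B w) -> `|fine (P A) - fine (P B)| <= b.
Proof.
move=> mA mB mF Fb AB.
have h (A' B' : set Om) : measurable A' -> measurable B' ->
    (forall w, ~ F w -> A' w -> B' w) -> fine (P A') <= fine (P B') + b.
  move=> mA' mB' AB'; apply: le_trans (lerD (lexx _) Fb).
  rewrite -lee_fin EFinD !fineK ?fin_num_measure//.
  have mBF : measurable (B' `|` F) by exact: measurableU.
  apply: (@le_trans _ _ (P (B' `|` F))).
    apply: le_measure; rewrite ?inE// => w Aw.
    by have [Fw|nFw] := pselect (F w); [right|left; exact: AB'].
  by rewrite (le_trans (measureU2 _ _ _)).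
by rewrite ler_distl; apply/andP; split; [rewrite lerBlDr|]; apply: h => // w /AB[].
Qed.

End fine_probability.

Section point_process_theory.
Context {R : realType} {S : ptopologicalType}.
Local Notation measS := {measure set (BorelS S) -> \bar R}.

Lemma lf_counting_nat (nu : measS) (B : set S) : lf_counting nu -> rc_borel B ->
  exists k : nat, nu B = k%:R%:E.
Proof.
move=> [lnu cnu] rB; have [//|nuB] := cnu B rB.1.
by have := lnu B rB; rewrite nuB ltxx.
Qed.

Lemma point_process_eq_measurable d (Om : measurableType d) (xi : Om -> measS)
    (B : set S) x : point_process xi -> rc_borel B -> measurable [set w | xi w B = x].
Proof. by move=> [_ mxi] rB; apply: measurable_eq_cst; exact: mxi. Qed.

End point_process_theory.

(** * Void and hitting probabilities of the cells *)

Section hits.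
Context {R : realType} {S : ptopologicalType}.
Local Notation measS := {measure set (BorelS S) -> \bar R}.
Variables (lam : measS) (U : set (set S)).
Hypotheses (ringU : ring_of_sets U) (Ulam : U `<=` lambda_cont_sets lam).
Variables (T : finType) (V : T -> set S).
Hypotheses (UV : forall t, U (V t)) (oV : forall t, open (V t)).

(** Stated for sequences so that a single Poisson process is covered as a constant sequence. *)
Definition poisson_counts d (Om : measurableType d) (P : probability Om R)
    (xi : nat -> Om -> measS) := forall B, U B -> open B -> forall k : nat,
  (fun n => fine (P [set w | xi n w B = k%:R%:E])) @ \oo --> poisson_p (fine (lam B)) k.

Definition void_hit (s0 s1 : seq T) : set measS :=
  [set nu : measS | (forall t, t \in s0 -> nu (V t) = 0%E) /\
           (forall t, t \in s1 -> nu (V t) != 0%E)].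

(** Inclusion-exclusion, one hit set at a time. Avoiding all sets of [s0] means avoiding their
    union, which is again an open member of [U]; so only one-set laws occur. *)
Fixpoint void_hit_lim (s0 s1 : seq T) : R :=
  if s1 is t :: s1' then void_hit_lim s0 s1' - void_hit_lim (t :: s0) s1'
  else poisson_p (fine (lam (\bigcup_(t in [set` s0]) V t))) 0.

Lemma measurable_void_hit d (Om : measurableType d) (xi : Om -> measS) s0 s1 :
  point_process xi -> measurable [set w | void_hit s0 s1 (xi w)].
Proof.
move=> pxi.
have mz t : measurable [set w | xi w (V t) = 0%E].
  by apply: point_process_eq_measurable => //; exact: (ring_rc Ulam (UV t)).
rewrite (_ : mkset _ = (\bigcap_(t in [set` s0]) [set w | xi w (V t) = 0%E]) `&`
   \bigcap_(t in [set` s1]) ~` [set w | xi w (V t) = 0%E]).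
  apply: measurableI; apply: fin_bigcap_measurable => // t _.
  exact: measurableC.
apply/seteqP; split => w [h0 h1]; split => t ts; [exact: h0| |exact: h0|].
  by apply/eqP; exact: h1.
by apply/eqP; exact: h1.
Qed.

Lemma void_hit_cvg d (Om : measurableType d) (P : probability Om R)
    (xi : nat -> Om -> measS) s0 s1 : (forall n, point_process (xi n)) ->
  poisson_counts P xi ->
  (fun n => fine (P [set w | void_hit s0 s1 (xi n w)])) @ \oo --> void_hit_lim s0 s1.
Proof.
move=> pxi cxi; elim: s1 s0 => [|t s1 ih] s0 /=.
  have UW (s : seq T) : U (\bigcup_(t in [set` s]) V t).
    elim: s => [|t s ih].
      rewrite (_ : \bigcup_(t in _) _ = set0); first exact: ring_set0.
      by apply/seteqP; split => // x [].
    rewrite (_ : \bigcup_(t in _) _ = V t `|` \bigcup_(t in [set` s]) V t).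
      by have [_ [UU _]] := ringU; exact: UU.
    apply/seteqP; split => [x [u /=]|x [Vx|[u /= us Vx]]].
    - by rewrite inE => /orP[/eqP-> Vx|us Vx]; [left|right; exists u].
    - by exists t => //=; rewrite inE eqxx.
    - by exists u => //=; rewrite inE us orbT.
  pose W := \bigcup_(t in [set` s0]) V t.
  have oW : open W by apply: bigcup_open => u _.
  rewrite (_ : (fun n => _) = (fun n => fine (P [set w | xi n w W = 0%:R%:E]))).
    by apply: cxi => //; exact: UW.
  apply/funext => n; congr (fine (P _)); apply/seteqP; split => w /=.
    move=> [h _]; apply/eqP; rewrite eq_le measure_ge0 andbT.
    have := @measure_bigcup_le _ (BorelS S) R (xi n w) {t | t \in s0} W (fun t => V (sval t)).
    rewrite big1; last by move=> [u us] _; exact: h.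
    apply.
    - exact: (ring_measurable Ulam (UW s0)).
    - by move=> u; exact: (ring_measurable Ulam (UV _)).
    - by move=> x [u us Vx]; exists (exist _ u us).
  move=> W0; split => // u us; apply: subset_measure0 W0.
  - exact: (ring_measurable Ulam (UV u)).
  - exact: (ring_measurable Ulam (UW s0)).
  - by move=> x Vx; exists u.
rewrite (_ : (fun n => _) = (fun n =>
    fine (P [set w | void_hit s0 s1 (xi n w)]) -
    fine (P [set w | void_hit (t :: s0) s1 (xi n w)]))).
  by apply: cvgB; exact: ih.
apply/funext => n.
have mz : measurable [set w | xi n w (V t) = 0%E].
  by apply: point_process_eq_measurable => //; exact: (ring_rc Ulam (UV t)).
have mvh := measurable_void_hit s0 s1 (pxi n).
rewrite (_ : [set w | void_hit (t :: s0) s1 (xi n w)] =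
   [set w | void_hit s0 s1 (xi n w)] `\` ~` [set w | xi n w (V t) = 0%E]).
  rewrite -fine_probabilityD//; last exact: measurableC.
  congr (fine (P _)); apply/seteqP; split => w /=.
    move=> [h0 h1]; split; last by apply/eqP; apply: h1; rewrite inE eqxx.
    by split => // u us; apply: h1; rewrite inE us orbT.
  move=> [[h0 h1] /eqP ht]; split => // u; rewrite inE => /orP[/eqP->//|].
  exact: h1.
rewrite setDE setCK; apply/seteqP; split => w /=.
  move=> [h0 h1]; split; last by apply: h0; rewrite inE eqxx.
  by split => // u us; apply: h0; rewrite inE us orbT.
move=> [[h0 h1] ht]; split => // u; rewrite inE => /orP[/eqP->//|].
exact: h0.
Qed.

End hits.

(** * Events determined by finitely many counts *)

Section joint_law.
Context {R : realType} {S : ptopologicalType}.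
Local Notation measS := {measure set (BorelS S) -> \bar R}.
Variables (lam : measS) (U : set (set S)) (c : nat -> set S).
Hypotheses (hS : hausdorff_space S) (lf : locally_finite lam).
Hypothesis na : non_atomic lam.
Hypotheses (ringU : ring_of_sets U) (Ulam : U `<=` lambda_cont_sets lam).
Hypotheses (bc : basis_seq c) (Uc : forall i, U (c i)).
Variables (I : finType) (A : I -> set S).
Hypotheses (UA : forall i, U (A i)) (oA : forall i, open (A i)).

Definition determined (G : set measS) :=
  forall nu nu' : measS, lf_counting nu -> lf_counting nu' ->
    (forall i, nu (A i) = nu' (A i)) ->
    (forall i, nu (closure (A i)) = nu' (closure (A i))) -> G nu -> G nu'.

Section fixed_partition.
Variables (T : finType) (V : T -> set S) (N : set S).
Hypotheses (UV : forall t, U (V t)) (oV : forall t, open (V t)).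
Hypothesis dV : forall t t', t != t' -> V t `&` V t' = set0.
Hypothesis VA : forall t i, V t `<=` A i \/ V t `&` closure (A i) = set0.
Hypotheses (UN : U N) (oN : open N).
Hypothesis AN : \bigcup_(i in setT) closure (A i) `<=` N `|` \bigcup_(t in setT) V t.

Let mU B : U B -> measurable (B : set (BorelS S)) := @ring_measurable _ _ _ _ Ulam B.

(** For such measures the counts of the [A i] and of their closures are functions of the set of
    occupied cells. *)
Definition good (nu : measS) :=
  nu N = 0%E /\ forall t, nu (V t) = 0%E \/ nu (V t) = 1%E.

Definition hit (nu : measS) : {set T} := [set t | nu (V t) != 0%E]%SET.

Lemma void_hitE (nu : measS) (s : {set T}) :
  void_hit V (enum (~: s)) (enum s) nu <-> hit nu = s.
Proof.
split=> [[h0 h1]|<-].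
  apply/setP => t; rewrite inE; have [ts|ts] := boolP (t \in s).
    by apply: h1; rewrite mem_enum.
  by apply/negbTE; rewrite negbK; apply/eqP/h0; rewrite mem_enum inE.
split => t; rewrite mem_enum !inE ?negbK//; by move/eqP.
Qed.

(** [N] carries no mass and a cell lies in [A i] or misses its closure, so only the cells inside
    [A i] contribute, each by 0 or 1, whichever set between [A i] and its closure is measured. *)
Lemma good_mass (nu : measS) i (B : set S) : good nu -> A i `<=` B ->
  B `<=` closure (A i) -> measurable (B : set (BorelS S)) ->
  nu B = (\sum_(t in hit nu | `[< V t `<=` A i >]) 1)%E.
Proof.
move=> [nN nV] AB BA mB.
pose W := \bigcup_(t in [set t | `[< V t `<=` A i >]]) V t.
have mW : measurable (W : set (BorelS S)).
  by apply: fin_bigcup_measurable => // t _; exact: mU.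
have WB : W `<=` B by move=> x [t /asboolP VtA Vx]; exact/AB/VtA.
have -> : nu B = nu W.
  apply/eqP; rewrite eq_le; apply/andP; split; last by apply: le_measure; rewrite ?inE.
  apply: (@le_trans _ _ (nu (N `|` W))).
    apply: le_measure; rewrite ?inE//; first by apply: measurableU => //; exact: mU.
    move=> x Bx; have clx := BA _ Bx.
    have : (N `|` \bigcup_(t in setT) V t) x by apply: AN; exists i.
    case=> [Nx|[t _ Vx]]; [by left|right].
    exists t => //=; apply/asboolP; have [//|Vc0] := VA t i.
    by have : set0 x by rewrite -Vc0.
  apply: (le_trans (measureU2 _ _ _)) => //; first exact: mU.
  by rewrite [X in (X + _)%E](_ : _ = 0%E)// add0e.
rewrite /W.
rewrite (_ : [set t | `[< V t `<=` A i >]] = [set` [seq t <- index_enum T | `[< V t `<=` A i >]]]); last first.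
  by apply/seteqP; split => t /=; rewrite mem_filter mem_index_enum andbT.
rewrite measure_fin_bigcup//; last 2 first.
- move=> t t' _ _ [x Vx]; apply/eqP/negPn/negP => tt'.
  by have : set0 x by rewrite -(dV tt').
- by move=> t _; exact: mU.
rewrite -fsbig_seq; last by rewrite filter_uniq// index_enum_uniq.
rewrite big_filter [RHS]big_mkcondl; apply: eq_bigr => t _.
by rewrite inE; case: eqP => // Vt; have [//|] := nV t.
Qed.

Lemma good_determined (G : set measS) (nu nu' : measS) : determined G ->
  lf_counting nu -> lf_counting nu' -> good nu -> good nu' -> hit nu = hit nu' ->
  G nu -> G nu'.
Proof.
move=> detG lnu lnu' gnu gnu' hh; apply: detG => // i.
  by rewrite !(@good_mass _ i)// ?hh//; [exact: subset_closure|exact: mU|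
    exact: subset_closure|exact: mU].
have mcl : measurable (closure (A i) : set (BorelS S)).
  by apply: borel_closed; exact: closed_closure.
by rewrite !(@good_mass _ i)// ?hh//; exact: subset_closure.
Qed.

(** One good witness in [G] is enough: by [good_determined] every other good measure with this
    pattern is in [G] too. *)
Definition hit_pattern (G : set measS) (s : {set T}) :=
  exists nu : measS, [/\ lf_counting nu, good nu, G nu & hit nu = s].

(** Unless [N] is occupied or some cell has two points, membership in [G] is read off the occupied
    cells. The right-hand side is a union bound for this bad event, in terms of one-set laws. *)
Lemma hit_approx d (Om : measurableType d) (P : probability Om R)
    (zeta : Om -> measS) (G : set measS) :
  point_process zeta -> determined G -> measurable [set w | G (zeta w)] ->
  `| fine (P [set w | G (zeta w)]) -
     \sum_(s : {set T} | `[< hit_pattern G s >])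
        fine (P [set w | void_hit V (enum (~: s)) (enum s) (zeta w)]) | <=
  (1 - fine (P [set w | zeta w N = 0%:R%:E])) +
  \sum_t (1 - fine (P [set w | zeta w (V t) = 0%:R%:E])
            - fine (P [set w | zeta w (V t) = 1%:R%:E])).
Proof.
move=> pz detG mG.
have mvh s : measurable [set w | void_hit V (enum (~: s)) (enum s) (zeta w)].
  exact: (measurable_void_hit Ulam).
have hvh s : [set w | void_hit V (enum (~: s)) (enum s) (zeta w)] =
    [set w | hit (zeta w) = s].
  by apply/seteqP; split => w /void_hitE.
pose B := [set w | hit_pattern G (hit (zeta w))].
have BE s : B `&` [set w | hit (zeta w) = s] =
    if `[< hit_pattern G s >] then [set w | hit (zeta w) = s] else set0.
  case: asboolP => hs; apply/seteqP; split => w //; first by move=> [].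
    by move=> ws; split => //; rewrite /B /mkset ws.
  by move=> [Bw ws]; apply: hs; rewrite -ws.
have mBs s : measurable (B `&` [set w | hit (zeta w) = s]).
  by rewrite BE -hvh; case: ifP.
have mB : measurable B.
  rewrite (_ : B = \bigcup_(s in [set: {set T}]) (B `&` [set w | hit (zeta w) = s])).
    by apply: fin_bigcup_measurable => //; exact: finite_finset.
  by apply/seteqP; split => [w Bw|w [s _ []]//]; exists (hit (zeta w)).
rewrite (_ : \sum_(s : {set T} | _) _ = fine (P B)); last first.
  apply: EFin_inj; rewrite fineK ?fin_num_measure// -sumEFin.
  rewrite (@measure_fibers _ _ _ _ _ _ (fun w => hit (zeta w)))// [LHS]big_mkcond.
  apply: eq_bigr => s _; rewrite BE; case: ifP => _; last by rewrite measure0.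
  by rewrite fineK ?fin_num_measure// hvh.
have mz B' x : U B' -> measurable [set w | zeta w B' = x].
  by move=> UB; apply: point_process_eq_measurable => //; exact: (ring_rc Ulam UB).
pose E (o : option T) := if o is Some t then
  ~` ([set w | zeta w (V t) = 0%:R%:E] `|` [set w | zeta w (V t) = 1%:R%:E])
  else ~` [set w | zeta w N = 0%:R%:E].
have mE o : measurable (E o).
  by case: o => [t|]; apply: measurableC; [apply: measurableU|]; exact: mz.
have mUE : measurable (\bigcup_(o in [set: option T]) E o).
  by apply: fin_bigcup_measurable => //; exact: finite_finset.
apply: (@fine_probability_dist _ _ _ P _ _ (\bigcup_(o in setT) E o)) => //.
  apply: (@le_trans _ _ (\sum_(o : option T) fine (P (E o)))).
    rewrite -lee_fin fineK ?fin_num_measure// -sumEFin.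
    under eq_bigr do rewrite fineK ?fin_num_measure//.
    exact: measure_bigcup_le.
  rewrite big_option /= fine_probabilityC; last exact: mz.
  rewrite lerD2l; apply: ler_sum => t _.
  rewrite fine_probabilityC; last by apply: measurableU; exact: mz.
  rewrite measureU; [|exact: mz|exact: mz|].
    by rewrite fineD ?fin_num_measure ?opprD ?addrA//; exact: mz.
  by apply/seteqP; split => // w [/= -> [/eqP]]; rewrite eqr_nat.
move=> w nF.
have gw : good (zeta w).
  split; first by apply: contrapT => Nw; apply: nF; exists None.
  move=> t; apply: contrapT => Vw; apply: nF; exists (Some t) => //.
have lw := pz.1 w.
split => [Gw|[nu [lnu gnu Gnu hnu]]]; first by exists (zeta w).
exact: (good_determined detG lnu lw gnu gw hnu Gnu).
Qed.

End fixed_partition.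

(** The probabilities under [xi n] and under [eta] are both close to [Lim], which depends on [G],
    [lam] and the cells but not on the process. *)
Lemma joint_cvg (G : set measS) d (Om : measurableType d) (P : probability Om R)
    (xi : nat -> Om -> measS) d' (Om' : measurableType d') (Q : probability Om' R)
    (eta : Om' -> measS) : determined G ->
  (forall n, point_process (xi n)) -> point_process eta ->
  poisson_counts lam U P xi -> poisson_counts lam U Q (fun=> eta) ->
  (forall n, measurable [set w | G (xi n w)]) -> measurable [set w | G (eta w)] ->
  (fun n => fine (P [set w | G (xi n w)])) @ \oo --> fine (Q [set w | G (eta w)]).
Proof.
move=> detG pxi peta cxi ceta mxi meta.
have UUA : rc_borel (\bigcup_(i in [set: I]) A i).
  split.
    by apply: fin_bigcup_measurable => // i _; exact: (ring_measurable Ulam).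
  exists (\bigcup_(i in [set: I]) closure (A i)).
    by apply: subset_bigcup => i _; exact: subset_closure.
  split.
    rewrite -(bigsetU_fset_set _ finite_finset).
    by apply: bigsetU_compact => i _; apply: compact_closure_rc; exact: (ring_rc Ulam).
  rewrite -(bigsetU_fset_set _ finite_finset).
  by apply: closed_bigsetU => i _; exact: closed_closure.
pose L := fine (lam (\bigcup_(i in [set: I]) A i)).
have L0 : 0 <= L by rewrite fine_ge0.
apply/cvgrPdist_le => e e0.
(* Makes [r + r * L] equal to [e / 4]: [r] bounds the mass of [N], and [r * L] the sum of the
   squared masses of the cells. *)
pose r := e / (4 * (1 + L)).
have r0 : 0 < r by rewrite divr_gt0// mulr_gt0// ltr_wpDr.
have [T [V [N [UV dV VA [[UN oN Nr] AN] sV]]]] :=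
  open_partition hS lf ringU Ulam bc Uc na r0 UA oA.
have UVt t : U (V t) by have [] := UV t.
have oVt t : open (V t) by have [] := UV t.
pose Gam (s : {set T}) := `[< hit_pattern V N G s >].
pose Lim := \sum_(s : {set T} | Gam s) void_hit_lim lam V (enum (~: s)) (enum s).
pose bad d (Om : measurableType d) (P : probability Om R) (zeta : Om -> measS) :=
  (1 - fine (P [set w | zeta w N = 0%:R%:E])) +
  \sum_t (1 - fine (P [set w | zeta w (V t) = 0%:R%:E])
            - fine (P [set w | zeta w (V t) = 1%:R%:E])).
pose blim := (1 - poisson_p (fine (lam N)) 0) +
  \sum_t (1 - poisson_p (fine (lam (V t))) 0 - poisson_p (fine (lam (V t))) 1).
have lamV t : fine (lam (V t)) <= r.
  have [_ _ /ltW Vr] := UV t; rewrite -lee_fin fineK//.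
  exact: (lam_fin_num lf (ring_rc Ulam (UVt t))).
have blim_le : blim <= e / 4.
  (* Both bounds follow from [1 - a <= expR (- a)]: a Poisson variable is positive with probability
     at most [a] and exceeds 1 with probability at most [a * a]. *)
  have p0 (a : R) : 1 - poisson_p a 0 <= a.
    rewrite /poisson_p expr0 fact0 divr1 mulr1.
    by have := expR_ge1Dx (- a); lra.
  have p1 (a : R) : 0 <= a -> 1 - poisson_p a 0 - poisson_p a 1 <= a * a.
    move=> a0; rewrite /poisson_p expr0 fact0 expr1 factS fact0 !divr1 mulr1.
    by have := expR_ge1Dx (- a); nra.
  apply: (@le_trans _ _ (r + r * L)).
    apply: lerD.
      apply: (le_trans (p0 _)); rewrite -lee_fin fineK ?ltW//.
      exact: (lam_fin_num lf (ring_rc Ulam UN)).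
    apply: (@le_trans _ _ (\sum_t r * fine (lam (V t)))).
      apply: ler_sum => t _; apply: le_trans (p1 _ _) _; first by rewrite fine_ge0.
      by apply: ler_wpM2r => //; rewrite fine_ge0.
    rewrite -mulr_sumr; apply: ler_wpM2l; first exact: ltW.
    rewrite /L -lee_fin -sumEFin fineK.
      by under eq_bigr do rewrite fineK ?(lam_fin_num lf (ring_rc Ulam (UVt _)))//.
    exact: (lam_fin_num lf UUA).
  rewrite -[X in X + _]mulr1 -mulrDr /r invfM !mulrA mulfVK//.
  by rewrite gt_eqF// ltr_wpDr.
(* For large [n] the bad event costs at most [e / 4 + e / 8], the convergence of the void and
   hitting probabilities [e / 8]. *)
have main d0 (Om0 : measurableType d0) (P0 : probability Om0 R)
    (zeta : nat -> Om0 -> measS) : (forall n, point_process (zeta n)) ->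
    poisson_counts lam U P0 zeta -> (forall n, measurable [set w | G (zeta n w)]) ->
    \forall n \near \oo, `|fine (P0 [set w | G (zeta n w)]) - Lim| <= e / 2.
  move=> pz cz mz.
  have e8 : 0 < e / 8 by rewrite divr_gt0.
  have badc : (fun n => bad _ _ P0 (zeta n)) @ \oo --> blim.
    apply: cvgD; first by apply: cvgB; [exact: cvg_cst|exact: cz].
    apply: cvg_sumr => t _.
    by apply: cvgB; [apply: cvgB; [exact: cvg_cst|exact: cz]|exact: cz].
  have limc : (fun n => \sum_(s : {set T} | Gam s)
      fine (P0 [set w | void_hit V (enum (~: s)) (enum s) (zeta n w)])) @ \oo --> Lim.
    by apply: cvg_sumr => s _; exact: (void_hit_cvg ringU Ulam).
  move/cvgrPdist_le : badc => /(_ _ e8) near1.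
  move/cvgrPdist_le : limc => /(_ _ e8) near2.
  near=> n.
  have h1 : `|blim - bad _ _ P0 (zeta n)| <= e / 8 by near: n.
  have h2 : `|Lim - \sum_(s : {set T} | Gam s)
      fine (P0 [set w | void_hit V (enum (~: s)) (enum s) (zeta n w)])| <= e / 8.
    by near: n.
  have := hit_approx UVt dV VA UN AN P0 (pz n) detG (mz n).
  rewrite -/(bad _ _ P0 (zeta n)) -/(Gam _).
  move: h1 h2; set b := bad _ _ _ _; set s := \sum_(s | _) _.
  set g := fine _; move: b s g => b s g; rewrite !ler_norml.
  move=> /andP[h1 h2] /andP[h3 h4] /andP[h5 h6]; apply/andP; split; lra.
have [n0 _ /(_ n0 (leqnn _)) heta] := main _ _ Q (fun=> eta) (fun=> peta) ceta (fun=> meta).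
have := main _ _ P xi pxi cxi mxi; apply: filterS => n.
move: heta; rewrite !ler_norml => /andP[h1 h2] /andP[h3 h4]; apply/andP; split; lra.
Unshelve. all: by end_near. Qed.

End joint_law.

(** * The vague topology on counting measures *)

Section integral_of_counting_measure.
Context {R : realType} {S : ptopologicalType}.
Local Notation measS := {measure set (BorelS S) -> \bar R}.

(** Serves to compare two measures with the same masses [k i]: both integrals are close to the same
    finite sum. *)
Lemma integ_approx (nu : measS) (I : finType) (V : I -> set S) (b : I -> R)
    (k : I -> nat) (h : S -> R) (W : set S) (e : R) :
  (forall i, measurable (V i : set (BorelS S))) ->
  (forall i j, i != j -> V i `&` V j = set0) ->
  (forall i, nu (V i) = (k i)%:R%:E) ->
  measurable (W : set (BorelS S)) -> nu (W `\` \bigcup_(i in setT) V i) = 0%E ->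
  measurable_fun [set: BorelS S] h -> (forall x, 0 <= h x) ->
  (forall x, ~ W x -> h x = 0) -> (forall i, 0 <= b i) -> 0 <= e ->
  (forall i x, V i x -> `|h x - b i| <= e) ->
  `|integ nu h - \sum_i (k i)%:R * b i| <= e * \sum_i (k i)%:R.
Proof.
move=> mV dV nuV mW nuW mh h0 hW b0 e0 hV.
pose D : set (BorelS S) := \big[setU/set0]_(i <- index_enum I) V i.
have DE : D = \bigcup_(i in setT) V i.
  rewrite /D -bigcup_seq; apply/seteqP; split => [x [i _ Vx]|x [i _ Vx]]; exists i => //=.
  exact: mem_index_enum.
have mD : measurable D by apply: bigsetU_measurable.
have mhE : measurable_fun [set: BorelS S] (EFin \o h) by exact/measurable_EFinP.
have intD : (\int[nu]_(x in [set: BorelS S]) (h x)%:E = \int[nu]_(x in D) (h x)%:E)%E.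
  rewrite -(setUv D) ge0_integral_setU//=.
  - rewrite [X in (_ + X)%E](_ : _ = 0%E) ?adde0//.
    rewrite (@ge0_ae_eq_integral _ _ _ nu _ _ (cst 0%E))//=.
    + by rewrite integral0.
    + exact: measurableC.
    + exact: measurable_funTS.
    + by move=> x _; rewrite lee_fin.
    + exists (W `\` D); split.
      * exact: measurableD.
      * by rewrite DE.
      * move=> x /= /not_implyP[nDx hx]; split => //.
        by apply: contrapT => /hW hx0; apply: hx; rewrite hx0.
  - exact: measurableC.
  - by rewrite setUv.
  - by move=> x _; rewrite lee_fin.
  - by rewrite disj_set2E setICr.
rewrite /integ intD ge0_integral_bigsetU//; last 4 first.
- exact: index_enum_uniq.
- move=> i j _ _ [x Vx]; apply/eqP/negPn/negP => ij.
  by have : set0 x by rewrite -(dV _ _ ij).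
- exact: measurable_funTS.
- by move=> x _; rewrite lee_fin.
have upper i : (\int[nu]_(x in V i) (h x)%:E <= ((b i + e) * (k i)%:R)%:E)%E.
  rewrite EFinM -nuV -integral_cst//; apply: ge0_le_integral => //.
  - by move=> x _; rewrite lee_fin.
  - exact: measurable_funTS.
  - by move=> x Vx; rewrite lee_fin -lerBlDl; apply: le_trans (ler_norm _) (hV _ _ Vx).
have lower i : ((b i * (k i)%:R)%:E <= \int[nu]_(x in V i) (h x)%:E + (e * (k i)%:R)%:E)%E.
  rewrite !EFinM -nuV -!integral_cst// -ge0_integralD//=; last exact: measurable_funTS.
  2: by move=> x _; rewrite lee_fin.
  apply: ge0_le_integral => //.
  - by move=> x _; rewrite lee_fin.
  - by apply: emeasurable_funD => //; exact: measurable_funTS.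
  - move=> x Vx; rewrite -EFinD lee_fin addrC -lerBlDr.
    by have := hV _ _ Vx; rewrite distrC; apply: le_trans; exact: ler_norm.
have finV (j : I) : (\int[nu]_(x in V j) (h x)%:E)%E \is a fin_num.
  rewrite ge0_fin_numE; first exact: le_lt_trans (upper j) (ltry _).
  by apply: integral_ge0 => x _; rewrite lee_fin.
rewrite -sum_fine; last by move=> i _; exact: finV.
rewrite -sumrB mulr_sumr; apply: (le_trans (ler_norm_sum _ _ _)).
apply: ler_sum => i _.
move: (upper i) (lower i); rewrite -[X in (X <= _)%E]fineK// -[X in (_ <= X + _)%E]fineK//.
rewrite -EFinD !lee_fin => h1 h2.
rewrite ler_norml; apply/andP; split.
  by move: h2; rewrite mulrC; lra.
by move: h1; rewrite mulrDl [b i * _]mulrC; lra.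
Qed.

End integral_of_counting_measure.

(** * Countably many constraints that refine vague neighbourhoods *)

Section vague_base.
Context {R : realType} {S : ptopologicalType}.
Local Notation measS := {measure set (BorelS S) -> \bar R}.
Variables (U : set (set S)) (c : nat -> set S).
Hypotheses (hS : hausdorff_space S) (regS : @regular_space S).
Hypotheses (ringU : ring_of_sets U) (Urc : forall B, U B -> rc_borel B).
Hypotheses (bc : basis_seq c) (Uc : forall i, U (c i)).

(** A countable type of codes: basic sets with a lower bound on their mass, and a list for the
    region that is bounded above. *)
Definition base_index := (seq (nat * nat) * seq nat)%type.

(* With disjoint [c p.1], these constraints force [nu] to have mass exactly
   [p.2] on [c p.1] and no other mass in the closure of [bunion c g.2]. *)
Definition base_set (g : base_index) : set measS :=
  [set nu : measS | (forall p, p \in g.1 -> (p.2%:R%:E <= nu (c p.1))%E) /\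
    (nu (closure (bunion c g.2)) <= (\sum_(p <- g.1) p.2)%N%:R%:E)%E].

(** Masses are integers, so an open set whose mass is below that of [x] plus one half has no further
    mass. *)
Lemma lf_counting_nbhs (mu : measS) (x : S) : lf_counting mu ->
  exists V, [/\ U V, open V, V x & mu V = mu [set x]].
Proof.
move=> lmu; have [B Ux] : exists B, U B /\ B x.
  by have [i ci _] := bc.2 x setT openT I; exists (c i).
have rx : rc_borel [set x].
  split; first by apply: borel_closed; exact: (accessible_closed_set1 (hausdorff_accessible hS)).
  by case: Ux => /Urc[_ pB] Bx; apply: precompact_subset pB => y ->.
have [k muk] := lf_counting_nat lmu rx.
have [|V [UV oV xV Vk]] := @outer_open R S mu U c [set x] (k%:R + 2^-1) hS lmu.1
  ringU Urc bc Uc (@compact_set1 _ x).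
  by rewrite muk lte_fin ltrDl invr_gt0.
have [l mul] := lf_counting_nat lmu (Urc UV).
exists V; split => //; first exact: xV.
rewrite muk mul; congr (_%:R%:E); apply/eqP; rewrite eqn_leq; apply/andP; split.
  rewrite -ltnS -(ltr_nat R); apply: (lt_le_trans (y := k%:R + 2^-1)).
    by move: Vk; rewrite mul lte_fin.
  by rewrite -[k.+1%:R]natr1 lerD2l invf_le1// ler1n.
rewrite -(ler_nat R) -lee_fin -muk -mul; apply: le_measure; rewrite ?inE//.
- exact: rx.1.
- by apply: borel_open.
Qed.

Lemma separate_points (m : nat) (a : 'I_m -> S) : injective a ->
  exists Z : 'I_m -> set S, (forall i, nbhs (a i) (Z i)) /\
    (forall i j, i != j -> Z i `&` Z j = set0).
Proof.
move=> inja.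
have /choice[A hA] (p : 'I_m * 'I_m) : exists AB : set S * set S, p.1 != p.2 ->
    [/\ nbhs (a p.1) AB.1, nbhs (a p.2) AB.2 & AB.1 `&` AB.2 = set0].
  have [->|ij] := eqVneq p.1 p.2; first by exists (set0, set0).
  have : a p.1 != a p.2 by apply: contra_neq ij => /inja.
  move: hS; rewrite open_hausdorff => /[apply] -[AB [/set_mem A1 /set_mem A2]].
  move=> [opA opB /eqP AB0]; exists AB => _; split => //.
  - by apply: open_nbhs_nbhs; split.
  - by apply: open_nbhs_nbhs; split.
exists (fun i => [set x | forall j, i != j -> (A (i, j)).1 x /\ (A (j, i)).2 x]).
split=> [i|i j ij].
  apply: filter_forall => j; have [->|ij] := eqVneq i j; first exact: nearW.
  have [h1 _ _] := hA (i, j) ij; have [|_ h2 _] := hA (j, i); first by rewrite eq_sym.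
  by near=> x => _; split; near: x.
apply/seteqP; split => // x [/(_ j ij)[h1 _]].
rewrite eq_sym in ij; move=> /(_ i ij)[_ h2]; rewrite eq_sym in ij.
by have [_ _ /= A0] := hA (i, j) ij; have : set0 x by rewrite -A0.
Unshelve. all: by end_near. Qed.

Lemma closure_bigcup_fin (I : finType) (F : I -> set S) :
  closure (\bigcup_(i in [set: I]) F i) `<=` \bigcup_(i in [set: I]) closure (F i).
Proof.
have cl : closed (\bigcup_(i in [set: I]) closure (F i)).
  rewrite -(bigsetU_fset_set _ finite_finset).
  by apply: closed_bigsetU => i _; exact: closed_closure.
rewrite [X in _ `<=` X](closure_id _).1//; apply: closureS.
by apply: subset_bigcup => i _; exact: subset_closure.
Qed.

(** Locally all the mass sits at one point, by [lf_counting_nbhs]; compactness leaves finitely many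
    such points. *)
Lemma lf_counting_atoms (mu : measS) (K : set S) : lf_counting mu -> compact K ->
  exists s : seq S, uniq s /\ mu (K `\` [set` s]) = 0%E.
Proof.
move=> lmu cK.
have clK := compact_closed hS cK.
have cl1 (x : S) : measurable ([set x] : set (BorelS S)).
  by apply: borel_closed; exact: (accessible_closed_set1 (hausdorff_accessible hS)).
have [x Kx|s sP Ks] := compact_subcover
    (P := fun i => exists y, c i y /\ mu (c i) = mu [set y]) bc cK.
  have [V [UV oV Vx muV]] := lf_counting_nbhs x lmu.
  have [i cx cV] := bc.2 x V oV Vx; exists i => //; exists x; split => //.
  apply/eqP; rewrite eq_le; apply/andP; split.
    rewrite -muV; apply: le_measure; rewrite ?inE//.
    - exact: (Urc (Uc i)).1.
    - exact: (Urc UV).1.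
  apply: le_measure; rewrite ?inE//; first exact: (Urc (Uc i)).1.
  by move=> _ ->.
have /choice[y hy] i : exists y, i \in s -> c i y /\ mu (c i) = mu [set y].
  by have [/sP[y hy]|] := boolP (i \in s); [exists y|exists point].
pose t := undup [seq y i | i <- s]; exists t; split; first exact: undup_uniq.
have mt : measurable ([set` t] : set (BorelS S)).
  apply: borel_closed; rewrite (_ : [set` t] = \bigcup_(x in [set` t]) [set x]).
    rewrite bigcup_seq; apply: closed_bigsetU => x _.
    exact: (accessible_closed_set1 (hausdorff_accessible hS)).
  by apply/seteqP; split => [x tx|x [_ /= ? ->]//]; exists x.
apply/eqP; rewrite eq_le measure_ge0 andbT.
have mc i := (Urc (Uc i)).1.
have := @measure_bigcup_le _ (BorelS S) R mu 'I_(size s) (K `\` [set` t])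
  (fun j => c (nth 0%N s j) `\` [set y (nth 0%N s j)]).
rewrite big1.
  apply.
  - apply: measurableD => //; exact: borel_closed.
  - by move=> j; apply: measurableD.
  - move=> x [Kx ntx]; have [i /= is_ cx] := Ks x Kx.
    have ilt : (index i s < size s)%N by rewrite index_mem.
    exists (Ordinal ilt) => //=; rewrite nth_index//; split => // xy.
    by apply: ntx; rewrite /= mem_undup xy map_f.
move=> j _; have [cy muc] := hy (nth 0%N s j) (mem_nth _ (ltn_ord j)).
have rj := Urc (Uc (nth 0%N s j)).
rewrite measureD//; last exact: lmu.1.
rewrite (_ : _ `&` _ = [set y (nth 0%N s j)]); last first.
  by rewrite setIidr// => _ ->.
apply: (etrans (congr1 (fun z => z - mu [set y (nth 0%N s j)])%E muc)).
by rewrite subee// ge0_fin_numE// -muc; exact: lmu.1.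
Qed.

End vague_base.

Lemma measurable_fun_continuous {R : realType} {S : ptopologicalType} (h : S -> R) :
  continuous h -> measurable_fun [set: BorelS S] h.
Proof.
move=> ch; apply: (measurability _ (RGenOInfty.measurableE R)) => //.
move=> _ [_ [r ->] <-]; rewrite setTI.
apply: borel_open; apply: open_comp; last exact: interval_open.
by move=> x _; exact: ch.
Qed.

Section vague_base_lemma.
Context {R : realType} {S : ptopologicalType}.
Local Notation measS := {measure set (BorelS S) -> \bar R}.
Variables (U : set (set S)) (c : nat -> set S).
Hypotheses (hS : hausdorff_space S) (regS : @regular_space S).
Hypotheses (ringU : ring_of_sets U) (Urc : forall B, U B -> rc_borel B).
Hypotheses (bc : basis_seq c) (Uc : forall i, U (c i)).

(** The lower bounds on the disjoint [V i] add up to the upper bound on [W], so none of them is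
    strict and no mass is left over. *)
Lemma tight_masses (nu : measS) (m : nat) (V : 'I_m -> set S) (k : 'I_m -> nat)
    (W : set S) : lf_counting nu -> rc_borel W ->
  (forall i, measurable (V i : set (BorelS S))) ->
  (forall i j, i != j -> V i `&` V j = set0) -> (forall i, V i `<=` W) ->
  (forall i, ((k i)%:R%:E <= nu (V i))%E) -> (nu W <= (\sum_i k i)%N%:R%:E)%E ->
  (forall i, nu (V i) = (k i)%:R%:E) /\ nu (W `\` \bigcup_(i in setT) V i) = 0%E.
Proof.
move=> lnu rW mV dV VW kV Wk.
have rV i : rc_borel (V i) by apply: rc_borelS (VW i) rW.
have /choice[n nV] i := lf_counting_nat lnu (rV i).
pose D : set (BorelS S) := \bigcup_(i in setT) V i.
have mD : measurable D by apply: fin_bigcup_measurable.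
have mWD : measurable (W `\` D : set (BorelS S)) by apply: measurableD => //; exact: rW.1.
have rWD : rc_borel (W `\` D) by apply: rc_borelS rW => // x [].
have [r nr] := lf_counting_nat lnu rWD.
have nD : nu D = (\sum_i n i)%N%:R%:E.
  rewrite /D (_ : \bigcup_(i in setT) V i = \bigcup_(i in [set` index_enum 'I_m]) V i).
    rewrite measure_fin_bigcup//.
      rewrite -fsbig_seq ?index_enum_uniq// natr_sum -sumEFin.
      by apply: eq_bigr => i _; exact: nV.
    move=> i j _ _ [x Vx]; apply/eqP/negPn/negP => ij.
    by have : set0 x by rewrite -(dV _ _ ij).
  by apply/seteqP; split => x [i _ Vx]; exists i => //=; exact: mem_index_enum.
have nW : nu W = (\sum_i n i + r)%N%:R%:E.
  rewrite (_ : W = D `|` (W `\` D)); last first.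
    by rewrite setUDr setDv setD0 setUidr// => x [i _ /VW].
  by rewrite measureU ?setDIK// natrD EFinD -nr -nD.
have kn i : (k i <= n i)%N by have := kV i; rewrite nV lee_fin ler_nat.
have nk : (\sum_i n i + r <= \sum_i k i)%N by have := Wk; rewrite nW lee_fin ler_nat.
have kns : (\sum_i k i <= \sum_i n i)%N by apply: leq_sum.
have r0 : r = 0%N.
  apply/eqP; rewrite -leqn0 -(leq_add2l (\sum_i n i)) addn0.
  exact: leq_trans nk kns.
split; last by rewrite nr r0.
have : (\sum_i (n i - k i) == 0)%N.
  by rewrite sumnB// subn_eq0; rewrite r0 addn0 in nk.
rewrite sum_nat_eq0 => /forallP h i.
rewrite nV; congr (_%:R%:E); apply/eqP; rewrite eqn_leq kn andbT.
by have := h i; rewrite implyTb subn_eq0.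
Qed.

(** A small basic set around each atom of [mu], in a compact region containing the supports of the
    test functions, is asked to keep the mass of the atom. By [tight_masses] there is no other mass
    in the region, so the integrals stay close to those of [mu]. *)
Lemma vague_base (F : measS -> R) (mu : measS) (t : R) :
  vague_continuous F -> lf_counting mu -> t < F mu ->
  exists g, base_set c g mu /\
    forall nu, lf_counting nu -> base_set c g nu -> t < F nu.
Proof.
move=> cF lmu tF.
have [|q [hs [hC [e e0 hF]]]] := cF mu lmu (F mu - t); first by rewrite subr_gt0.
pose K := \bigcup_(i in [set: 'I_q]) closure [set x | hs i x != 0].
have cK : compact K.
  rewrite /K -(bigsetU_fset_set _ finite_finset).
  by apply: bigsetU_compact => i _; have [_ []] := hC i.
have [s0 Ks0] := compact_bunion bc cK.
have rcb s : rc_borel (bunion c s) by apply: Urc; exact: ring_bunion.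
have rclb s : rc_borel (closure (bunion c s)) by exact: rc_borel_closure.
have cW0 : compact (closure (bunion c s0)) by exact: compact_closure_rc.
have [ats [uats muats]] := lf_counting_atoms hS ringU Urc bc Uc lmu cW0.
pose m := size ats.
pose a (i : 'I_m) := nth point ats i.
have inja : injective a.
  move=> i j /eqP; rewrite /a nth_uniq ?ltn_ord// => /eqP; exact: val_inj.
have clset1 (x : S) : closed [set x].
  exact: (accessible_closed_set1 (hausdorff_accessible hS)).
have ms1 (x : S) : measurable ([set x] : set (BorelS S)) by exact: borel_closed.
have /choice[N hN] i := lf_counting_nbhs hS ringU Urc bc Uc (a i) lmu.
have rN i : rc_borel (N i) by apply: Urc; have [] := hN i.
have /choice[k hk] i : exists k : nat, mu [set a i] = k%:R%:E.
  have [_ _ _ <-] := hN i; exact: lf_counting_nat.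
pose tot := (\sum_i k i)%N.
(* Both integrals lie within [r * tot] of the same sum, and [2 * r * tot < e]. *)
pose r := e / (2 * (tot%:R + 1)).
have r0 : 0 < r by rewrite divr_gt0// mulr_gt0// ltr_wpDl.
have [Z [Zn Zd]] := separate_points hS inja.
(* [Z i] makes the sets disjoint, [N i] leaves them no mass but that of [a i], and the last
   condition keeps every test function near its value at [a i]. Regularity extends this to the
   closures, on which the upper bound bears. *)
have /choice[j hj] i : exists j, c j (a i) /\ closure (c j) `<=`
    [set y | [/\ Z i y, N i y & forall l, `|hs l y - hs l (a i)| <= r]].
  have /regS[B Ba BZ] : nbhs (a i) [set y | [/\ Z i y, N i y &
      forall l, `|hs l y - hs l (a i)| <= r]].
    have [_ oN aN _] := hN i.
    have nN : nbhs (a i) (N i) by apply: open_nbhs_nbhs; split.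
    have nh : \forall y \near a i, forall l, `|hs l y - hs l (a i)| <= r.
      apply: filter_forall => l.
      have [ch _] := hC l; have /cvgrPdist_le/(_ _ r0) := ch (a i).
      by apply: filterS => y; rewrite distrC.
    near=> y; split; near: y => //; exact: Zn.
  move: Ba; rewrite nbhsE => -[B' [oB' B'a] B'B].
  have [l cl clB] := bc.2 _ _ oB' B'a.
  by exists l; split => //; apply: subset_trans BZ; apply: closureS; exact: subset_trans B'B.
pose V i := c (j i).
have mV i : measurable (V i : set (BorelS S)) by have [] := Urc (Uc (j i)).
pose w := s0 ++ [seq j i | i <- enum 'I_m].
pose g : base_index := ([seq (j i, k i) | i <- enum 'I_m], w).
have totE : (\sum_(p <- g.1) p.2)%N = tot by rewrite /= big_map big_enum.
have cjw i : j i \in w by rewrite mem_cat map_f ?orbT// mem_enum.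
have VW i : V i `<=` closure (bunion c w).
  by move=> x Vx; apply: subset_closure; exists (j i) => //=.
have dV i i' : i != i' -> V i `&` V i' = set0.
  move=> ii'; apply/seteqP; split => // x [Vx V'x].
  have [_ /(_ x (subset_closure Vx))[Zx _ _]] := hj i.
  have [_ /(_ x (subset_closure V'x))[Z'x _ _]] := hj i'.
  by rewrite -(Zd _ _ ii').
exists g.
have gmass (nu : measS) : lf_counting nu -> base_set c g nu ->
    (forall i, nu (V i) = (k i)%:R%:E) /\
    nu (closure (bunion c w) `\` \bigcup_(i in setT) V i) = 0%E.
  move=> lnu [g1 g2]; apply: tight_masses => //; last by rewrite totE in g2.
  by move=> i; apply: (g1 (j i, k i)); apply: map_f; rewrite mem_enum.
have gmu : base_set c g mu.
  split=> [p /mapP[i _ ->] /=|].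
    rewrite -hk; apply: le_measure; rewrite ?inE//; first exact: mV.
    by move=> _ ->; have [] := hj i.
  rewrite totE /=.
  pose X (o : option 'I_m) : set (BorelS S) := if o is Some i then closure (V i)
    else closure (bunion c s0) `\` [set` ats].
  have mats : measurable ([set` ats] : set (BorelS S)).
    rewrite (_ : [set` ats] = \bigcup_(x in [set` ats]) [set x]).
      by apply: fin_bigcup_measurable.
    by apply/seteqP; split => [x tx|x [_ /= ? ->]//]; exists x.
  have mX o : measurable (X o).
    case: o => [i|] /=; first by apply: borel_closed; exact: closed_closure.
    by apply: measurableD => //; apply: borel_closed; exact: closed_closure.
  have := @measure_bigcup_le _ (BorelS S) R mu _ (closure (bunion c w)) X (rclb w).1 mX.
  rewrite big_option/= muats add0e => h.
  apply: (le_trans (h _)).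
    move=> x clx.
    have := @closure_bigcup_fin S (option 'I_m)
      (fun o => if o is Some i then V i else bunion c s0) x.
    case.
      apply: closureS clx => y [l /=]; rewrite mem_cat => /orP[ls cy|/mapP[i _ ->] cy].
        by exists None => //; exists l.
      by exists (Some i).
    move=> [i|] _ clVx; first by exists (Some i).
    have [xa|xa] := boolP (x \in ats); last by exists None => //; split => //; exact/negP.
    have ilt : (index x ats < m)%N by rewrite index_mem.
    exists (Some (Ordinal ilt)) => //=; apply: subset_closure.
    have [+ _] := hj (Ordinal ilt).
    by rewrite /a /= nth_index.
  rewrite /tot natr_sum -sumEFin; apply: lee_sum => i _.
  rewrite -hk; have [_ _ _ <-] := hN i.
  apply: le_measure; rewrite ?inE.
  - by apply: borel_closed; exact: closed_closure.
  - exact: (rN i).1.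
  - by move=> x; have [_ /[apply] -[]] := hj i.
split=> // nu lnu gnu.
have est (nu' : measS) l : lf_counting nu' -> base_set c g nu' ->
    `|integ nu' (hs l) - \sum_i (k i)%:R * hs l (a i)| <= r * tot%:R.
  move=> lnu' gnu'; have [nV nW] := gmass nu' lnu' gnu'.
  have [ch [h0 _]] := hC l.
  rewrite /tot natr_sum.
  apply: (@integ_approx _ _ nu' _ V _ k (hs l) (closure (bunion c w))) => //.
  - exact: (rclb w).1.
  - exact: measurable_fun_continuous.
  - move=> x nWx; apply/eqP; apply: contra_notT nWx => hx.
    apply: subset_closure; have [i /= is0 cx] : bunion c s0 x.
      by apply: Ks0; exists l => //; exact: subset_closure.
    by exists i => //=; rewrite mem_cat is0.
  - exact: ltW.
  - by move=> i x Vx; have [_ /(_ x (subset_closure Vx))[_ _]] := hj i.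
have : `|F nu - F mu| < F mu - t.
  apply: hF => // l.
  have := est nu l lnu gnu; have := est mu l lmu gmu.
  set z := \sum_(i < m) _; set x := integ nu _; set y := integ mu _ => h1 h2.
  have -> : x - y = (x - z) - (y - z) by rewrite opprB addrA subrK.
  apply: (le_lt_trans (ler_normB _ _)); apply: (le_lt_trans (lerD h2 h1)).
  have er : r * (2 * (tot%:R + 1)) = e.
    by rewrite /r divfK// gt_eqF// mulr_gt0// ltr_wpDl.
  have aux (u v : R) : 0 < u -> u * v + u * v < u * (2 * (v + 1)) by move=> ?; lra.
  by rewrite -[X in _ < X]er; exact: aux.
rewrite ltr_norml => /andP[+ _].
by rewrite ltrBrDl opprB addrCA subrr addr0.
Unshelve. all: by end_near. Qed.

End vague_base_lemma.

(** * The sets [{F > t}] as increasing limits *)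

Section open_sets.
Context {R : realType} {S : ptopologicalType}.
Local Notation measS := {measure set (BorelS S) -> \bar R}.
Variables (U : set (set S)) (c : nat -> set S).
Hypotheses (hS : hausdorff_space S) (regS : @regular_space S).
Hypotheses (ringU : ring_of_sets U) (Urc : forall B, U B -> rc_borel B).
Hypotheses (bc : basis_seq c) (Uc : forall i, U (c i)).

Lemma measurable_base_set d (Om : measurableType d) (xi : Om -> measS) g :
  point_process xi -> measurable [set w | base_set c g (xi w)].
Proof.
move=> [_ mxi].
rewrite (_ : mkset _ =
   (\bigcap_(p in [set` g.1]) [set w | (p.2%:R%:E <= xi w (c p.1))%E]) `&`
   [set w | (xi w (closure (bunion c g.2)) <= (\sum_(p <- g.1) p.2)%N%:R%:E)%E]).
  apply: measurableI.
    apply: fin_bigcap_measurable => // p _.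
    rewrite -[X in measurable X]setTI; apply: emeasurable_fun_c_infty => //.
    by apply: mxi; exact: Urc.
  rewrite -[X in measurable X]setTI; apply: emeasurable_fun_infty_c => //.
  by apply: mxi; apply: rc_borel_closure; apply: Urc; exact: ring_bunion.
by apply/seteqP; split => w [h1 h2].
Qed.

Variable F : measS -> R.
Hypothesis cF : vague_continuous F.

(** Restricting to the first [m] codes makes each stage depend on finitely many counts; the stages
    increase to [{F > t}]. *)
Definition base_below (t : R) (m : nat) : set measS :=
  [set nu : measS | exists g, [/\ g \in pmap unpickle (iota 0 m),
    forall nu' : measS, lf_counting nu' -> base_set c g nu' -> t < F nu' &
    base_set c g nu]].

Lemma base_below_gt t m (nu : measS) : lf_counting nu -> base_below t m nu -> t < F nu.
Proof. by move=> lnu [g [_ + gnu]]; exact. Qed.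

Lemma gt_base_below t (nu : measS) : lf_counting nu -> t < F nu ->
  exists m, base_below t m nu.
Proof.
move=> lnu tF; have [g [gnu gt]] := vague_base hS regS ringU Urc bc Uc cF lnu tF.
exists (choice.pickle g).+1, g; split => //.
rewrite mem_pmap; apply/mapP; exists (choice.pickle g); last by rewrite pickleK.
by rewrite mem_iota add0n leq0n ltnSn.
Qed.

Lemma base_below_nd t : nondecreasing_seq (base_below t).
Proof.
move=> m n mn; apply/subsetPset => nu [g [gm h gnu]]; exists g; split => //.
move: gm; rewrite !mem_pmap => /mapP[x xm ->]; apply/mapP; exists x => //.
by move: xm; rewrite !mem_iota !add0n => /andP[_ xm]; exact: leq_trans mn.
Qed.

Lemma measurable_base_below d (Om : measurableType d) (xi : Om -> measS) t m :
  point_process xi -> measurable [set w | base_below t m (xi w)].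
Proof.
move=> pxi.
rewrite (_ : mkset _ = \bigcup_(g in [set` pmap unpickle (iota 0 m)] `&`
   [set g | forall nu' : measS, lf_counting nu' -> base_set c g nu' -> t < F nu'])
   [set w | base_set c g (xi w)]).
  apply: fin_bigcup_measurable; first exact: finite_setIl.
  by move=> g _; exact: measurable_base_set.
by apply/seteqP; split => [w [g [gm h gw]]|w [g [gm h] gw]]; exists g.
Qed.

Lemma gt_bigcup d (Om : measurableType d) (xi : Om -> measS) t :
  point_process xi ->
  [set w | t < F (xi w)] = \bigcup_m [set w | base_below t m (xi w)].
Proof.
move=> [lxi _]; apply/seteqP; split => [w tF|w [m _]]; last exact: base_below_gt.
by have [m] := gt_base_below (lxi w) tF; exists m.
Qed.

Lemma measurable_vague_continuous d (Om : measurableType d) (xi : Om -> measS) :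
  point_process xi -> measurable_fun [set: Om] (fun w => F (xi w)).
Proof.
move=> pxi; apply: (measurability _ (RGenOInfty.measurableE R)) => //.
move=> _ [_ [t ->] <-]; rewrite setTI.
rewrite [X in measurable X](_ : _ = [set w | t < F (xi w)]); last first.
  by apply/seteqP; split => w; rewrite /preimage /= in_itv/= andbT.
rewrite gt_bigcup//; apply: bigcupT_measurable => m.
exact: measurable_base_below.
Qed.

Lemma measurable_gt d (Om : measurableType d) (xi : Om -> measS) t :
  point_process xi -> measurable [set w | t < F (xi w)].
Proof.
move=> pxi; rewrite gt_bigcup//; apply: bigcupT_measurable => m.
exact: measurable_base_below.
Qed.

Lemma base_below_determined t m : exists (n : nat) (A : 'I_n -> set S),
  [/\ forall i, U (A i), forall i, open (A i) & determined A (base_below t m)].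
Proof.
(* Singleton lists give the sets with lower bounds, the lists [g.2] the regions whose closures are
   bounded above; both kinds have the form [bunion]. *)
pose L := flatten [seq g.2 :: [seq [:: p.1] | p <- g.1] |
  g <- pmap unpickle (iota 0 m) : seq base_index].
exists (size L), (fun i => bunion c (nth [::] L i)); split.
- by move=> i; exact: ring_bunion.
- by move=> i; exact: open_bunion.
move=> nu nu' lnu lnu' hA hcl [g [gm h [g1 g2]]]; exists g; split => //.
have inL s : s \in L -> exists i : 'I_(size L), nth [::] L i = s.
  move=> sL; have slt : (index s L < size L)%N by rewrite index_mem.
  by exists (Ordinal slt); rewrite /= nth_index.
split=> [p pg|].
  have [|i hi] := inL [:: p.1].
    apply/flattenP; exists (g.2 :: [seq [:: p.1] | p <- g.1]); first exact: map_f.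
    by rewrite inE map_f ?orbT.
  have := hA i; rewrite hi (_ : bunion c [:: p.1] = c p.1) => [<-|]; first exact: g1.
  apply/seteqP; split => [x [j /=]|x cx]; first by rewrite inE => /eqP->.
  by exists p.1 => //=; rewrite inE.
have [|i hi] := inL g.2.
  apply/flattenP; exists (g.2 :: [seq [:: p.1] | p <- g.1]); first exact: map_f.
  by rewrite inE eqxx.
by have := hcl i; rewrite hi => <-.
Qed.

End open_sets.

(** * Layer-cake approximation of expectations *)

Section step_functions.
Context {R : realType}.
Implicit Types (u y : R).

(** A staircase of step [u] below a nonnegative [y], within [u] of it up to height [k.+1%:R * u].
    Its expectation is a combination of probabilities of upper level sets. *)
Definition steps u k y : R := u * \sum_(i < k) (i.+1%:R * u < y)%R%:R.

Lemma stepsS u k y : steps u k.+1 y = steps u k y + u * (k.+1%:R * u < y)%R%:R.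
Proof. by rewrite /steps big_ord_recr/= mulrDr. Qed.

Lemma steps_full u k y : 0 < u -> k%:R * u < y -> steps u k y = u * k%:R.
Proof.
move=> u0 ky; rewrite /steps (eq_bigr (fun=> 1)).
  by rewrite sumr_const card_ord.
move=> i _; rewrite (le_lt_trans _ ky)//.
by apply: ler_wpM2r; [exact: ltW|rewrite ler_nat; exact: ltn_ord].
Qed.

Lemma steps_le u k y : 0 < u -> 0 <= y -> steps u k y <= y.
Proof.
move=> u0 y0; elim: k => [|k ih]; first by rewrite /steps big_ord0 mulr0.
rewrite stepsS; have [ky|_] := ltP; last by rewrite mulr0 addr0.
rewrite steps_full//.
  by rewrite -mulrDr natr1 mulrC ltW.
by apply: lt_trans ky; rewrite ltr_pM2r// ltr_nat.
Qed.

Lemma steps_ge u k y : 0 < u -> y <= k.+1%:R * u -> y <= steps u k y + u.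
Proof.
move=> u0; elim: k => [|k ih] yk.
  by rewrite /steps big_ord0 mulr0 add0r -[leRHS]mul1r.
rewrite stepsS; have [ky|yk'] := ltP (k.+1%:R * u) y; last first.
  by rewrite mulr0 addr0; exact: ih.
rewrite steps_full//; last by apply: lt_trans ky; rewrite ltr_pM2r// ltr_nat.
by rewrite -!mulrDr natr1 -[X in _ + X]mulr1 -mulrDr natr1 mulrC.
Qed.

Lemma integral_steps d (Om : measurableType d) (P : probability Om R)
    (f : Om -> R) u k : 0 < u -> measurable_fun [set: Om] f ->
  (forall w, 0 <= f w) -> (forall w, f w <= k.+1%:R * u) ->
  u * \sum_(i < k) fine (P [set w | i.+1%:R * u < f w])
    <= fine (\int[P]_w (f w)%:E)%E /\
  fine (\int[P]_w (f w)%:E)%E <=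
    u * \sum_(i < k) fine (P [set w | i.+1%:R * u < f w]) + u.
Proof.
move=> u0 mf f0 fk.
pose A (i : 'I_k) := [set w | i.+1%:R * u < f w].
have mA i : measurable (A i).
  rewrite (_ : A i = [set w | ((i.+1%:R * u)%:E < (f w)%:E)%E]).
    rewrite -[X in measurable X]setTI; apply: emeasurable_fun_o_infty => //.
    exact/measurable_EFinP.
  by apply/seteqP; split => w; rewrite /A /= lte_fin.
have stE w : (steps u k (f w))%:E = (\sum_(i < k) u%:E * (\1_(A i) w)%:E)%E.
  rewrite /steps mulr_sumr -sumEFin; apply: eq_bigr => i _.
  rewrite -EFinM indicE; congr (u * _%:R)%:E.
  by have [h|h] := boolP (_ < _); [rewrite mem_set|rewrite memNset//; apply/negP].
have mind i : measurable_fun [set: Om] (fun w => u%:E * (\1_(A i) w)%:E)%E.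
  by apply: measurable_funeM; apply/measurable_EFinP; exact: measurable_indic.
have mst : measurable_fun [set: Om] (fun w => (steps u k (f w))%:E).
  rewrite (_ : (fun w => _) = (fun w => \sum_(i < k) u%:E * (\1_(A i) w)%:E)%E).
    by apply: emeasurable_sum.
  by apply/funext => w; exact: stE.
have st0 w : (0 <= (steps u k (f w))%:E)%E.
  by rewrite lee_fin /steps; apply: mulr_ge0; [exact: ltW|exact: sumr_ge0].
have ist : (\int[P]_w (steps u k (f w))%:E)%E = (u * \sum_(i < k) fine (P (A i)))%:E.
  under eq_integral do rewrite stE.
  rewrite ge0_integral_sum//; last by move=> i w _; rewrite -EFinM lee_fin mulr_ge0// ltW.
  rewrite mulr_sumr -sumEFin; apply: eq_bigr => i _.
  rewrite ge0_integralZl_EFin//; last 2 first.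
  - by apply/measurable_EFinP; exact: measurable_indic.
  - exact: ltW.
  by rewrite integral_indic// setIT EFinM fineK// fin_num_measure.
have mfE : measurable_fun [set: Om] (fun w => (f w)%:E) by exact/measurable_EFinP.
have lo : ((u * \sum_(i < k) fine (P (A i)))%:E <= \int[P]_w (f w)%:E)%E.
  rewrite -ist; apply: ge0_le_integral => //.
  by move=> w _; rewrite lee_fin steps_le.
have hi : (\int[P]_w (f w)%:E <= (u * \sum_(i < k) fine (P (A i)) + u)%:E)%E.
  rewrite EFinD -ist -[X in (_ + X)%E]mule1 -(measure_probability_setT P).
  rewrite -integral_cst// -ge0_integralD//; last by move=> w _; rewrite lee_fin ltW.
  apply: ge0_le_integral => //.
    by move=> w _; rewrite lee_fin.
    by apply: emeasurable_funD.
  by move=> w _; rewrite -EFinD lee_fin steps_ge.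
have fn : (\int[P]_w (f w)%:E)%E \is a fin_num.
  rewrite ge0_fin_numE; first exact: le_lt_trans hi (ltry _).
  by apply: integral_ge0 => w _; rewrite lee_fin.
by split; rewrite -lee_fin fineK.
Qed.

End step_functions.

(** * Convergence in distribution *)

Section bounded_expectation.
Context d (Om : measurableType d) {R : realType} (P : probability Om R).
Variables (f : Om -> R) (M : R).
Hypotheses (mf : measurable_fun [set: Om] f) (fM : forall w, `|f w| <= M).

Lemma bounded_integrable : P.-integrable [set: Om] (EFin \o f).
Proof.
apply: measurable_bounded_integrable => //.
  by rewrite (le_lt_trans _ (ltry 1))// measure_probability_setT.
exists M; split; first by rewrite num_real.
by move=> x Mx w _ /=; rewrite (le_trans (fM w))// ltW.
Qed.

Lemma bounded_integral_fin : (\int[P]_w (f w)%:E)%E \is a fin_num.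
Proof. exact: (integrable_fin_num _ bounded_integrable). Qed.

Lemma integral_affine (a s : R) :
  fine (\int[P]_w (a + s * f w)%R%:E)%E = a + s * fine (\int[P]_w (f w)%:E)%E.
Proof.
have bi := bounded_integrable.
have is_ : P.-integrable [set: Om] (EFin \o (fun w => s * f w)).
  exact: (integrableZl measurableT s bi).
have ia : P.-integrable [set: Om] (EFin \o (fun=> a)).
  by apply: finite_measure_integrable_cst.
have -> : ((\int[P]_w ((a + s * f w)%R)%:E) = a%:E + s%:E * \int[P]_w (f w)%:E)%E.
  rewrite (_ : (\int[P]_w _)%E =
      (\int[P]_w ((EFin \o (fun=> a)) \+ (EFin \o (fun w => (s * f w)%R))) w)%E) //.
  rewrite integralD_EFin//; congr (_ + _)%E.
    by rewrite [LHS]integral_cst// measure_probability_setT mule1.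
  by rewrite -integralZl.
by rewrite -[X in (_ * X)%E]fineK ?bounded_integral_fin.
Qed.

End bounded_expectation.

Section weak_convergence.
Context {R : realType} {S : ptopologicalType}.
Local Notation measS := {measure set (BorelS S) -> \bar R}.
Variables (lam : measS) (U : set (set S)) (c : nat -> set S).
Hypotheses (hS : hausdorff_space S) (regS : @regular_space S).
Hypotheses (lf : locally_finite lam) (na : non_atomic lam).
Hypotheses (ringU : ring_of_sets U) (Ulam : U `<=` lambda_cont_sets lam).
Hypotheses (bc : basis_seq c) (Uc : forall i, U (c i)).
Context d (Om : measurableType d) (P : probability Om R) (xi : nat -> Om -> measS).
Context d' (Om' : measurableType d') (Q : probability Om' R) (eta : Om' -> measS).
Hypotheses (pxi : forall n, point_process (xi n)) (peta : point_process eta).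
Hypotheses (cxi : poisson_counts lam U P xi) (ceta : poisson_counts lam U Q (fun=> eta)).

Let Urc B : U B -> rc_borel B := @ring_rc _ _ _ _ Ulam B.

(** The stage of [base_below] is chosen for [eta] alone; [joint_cvg] carries its probability over to
    [xi n], for which it still lies in [{F > t}]. *)
Lemma gt_liminf (F : measS -> R) (t e : R) : vague_continuous F -> 0 < e ->
  \forall n \near \oo, fine (Q [set w | t < F (eta w)]) - e <=
                       fine (P [set w | t < F (xi n w)]).
Proof.
move=> cF e0.
have mb d0 (Om0 : measurableType d0) (x : Om0 -> measS) m : point_process x ->
    measurable [set w | base_below c F t m (x w)].
  exact: (measurable_base_below ringU Urc Uc).
have mg d0 (Om0 : measurableType d0) (x : Om0 -> measS) : point_process x ->
    measurable [set w | t < F (x w)].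
  exact: (measurable_gt hS regS ringU Urc bc Uc cF).
have [m hm] : exists m, fine (Q [set w | t < F (eta w)]) - e / 2 <=
    fine (Q [set w | base_below c F t m (eta w)]).
  have cvg : (fun m => fine (Q [set w | base_below c F t m (eta w)])) @ \oo -->
      fine (Q [set w | t < F (eta w)]).
    apply: fine_cvg; rewrite fineK ?fin_num_measure//; last exact: mg.
    rewrite (gt_bigcup hS regS ringU Urc bc Uc cF)//.
    apply: nondecreasing_cvg_mu.
    - by move=> m; exact: mb.
    - by apply: bigcupT_measurable => m; exact: mb.
    - move=> m n mn; apply/subsetPset => w.
      by have /subsetPset := @base_below_nd _ _ c F t _ _ mn; exact.
  have e20 : 0 < e / 2 by rewrite divr_gt0.
  have /cvgrPdist_le/(_ _ e20)/filter_ex[m h] := cvg.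
  exists m; move: h; rewrite ler_norml => /andP[_]; lra.
have [k [A [UA oA dA]]] := base_below_determined ringU bc Uc F t m.
have cvgP := joint_cvg hS lf na ringU Ulam bc Uc UA oA dA pxi peta cxi ceta
  (fun n => mb _ _ _ m (pxi n)) (mb _ _ _ m peta).
have e20 : 0 < e / 2 by rewrite divr_gt0.
have := cvgP; move=> /cvgrPdist_le/(_ _ e20); apply: filterS => n.
rewrite ler_norml => /andP[_ h].
have : fine (P [set w | base_below c F t m (xi n w)]) <= fine (P [set w | t < F (xi n w)]).
  apply: fine_probability_le; [exact: mb|exact: mg|].
  by move=> w; apply: base_below_gt; have [] := pxi n.
move: h hm; lra.
Qed.

Lemma expectation_liminf (F : measS -> R) (M e : R) : vague_continuous F ->
  (forall nu, lf_counting nu -> 0 <= F nu <= M) -> 0 < e ->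
  \forall n \near \oo, fine (\int[Q]_w (F (eta w))%:E)%E - e <=
                       fine (\int[P]_w (F (xi n w))%:E)%E.
Proof.
move=> cF FM e0.
(* One [u] is lost by the staircase under [eta] and one by comparing level-set probabilities; a
   third is slack. *)
pose u := e / 3; have u0 : 0 < u by rewrite divr_gt0.
pose k := Num.truncn (M / u).
have Mk : M <= k.+1%:R * u.
  by rewrite -ler_pdivrMr// ltW// truncnS_gt.
have mF d0 (Om0 : measurableType d0) (x : Om0 -> measS) : point_process x ->
    measurable_fun [set: Om0] (fun w => F (x w)).
  exact: (measurable_vague_continuous hS regS ringU Urc bc Uc cF).
have st d0 (Om0 : measurableType d0) (P0 : probability Om0 R) (x : Om0 -> measS)
    (px : point_process x) := @integral_steps _ _ _ P0 (fun w => F (x w)) u k u0 (mF _ _ _ px)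
  (fun w => proj1 (andP (FM _ (px.1 w)))) (fun w => le_trans (proj2 (andP (FM _ (px.1 w)))) Mk).
(* The [k] errors of this size sum to at most 1 and thus cost at most [u]. *)
have ek0 : (0 : R) < k.+1%:R^-1 by rewrite invr_gt0.
have : \forall n \near \oo, forall i : 'I_k,
    fine (Q [set w | i.+1%:R * u < F (eta w)]) - k.+1%:R^-1 <=
    fine (P [set w | i.+1%:R * u < F (xi n w)]).
  by apply: filter_forall => i; exact: gt_liminf.
apply: filterS => n hn.
have [_ hQ] := st _ _ Q _ peta; have [hP _] := st _ _ P _ (pxi n).
have : \sum_(i < k) fine (Q [set w | i.+1%:R * u < F (eta w)]) <=
    \sum_(i < k) fine (P [set w | i.+1%:R * u < F (xi n w)]) + 1.
  have k1 : k.+1%:R^-1 *+ k <= 1 :> R.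
    by rewrite -[leLHS]mulr_natl ler_pdivrMr// mul1r ler_nat.
  apply: le_trans (lerD (lexx _) k1).
  rewrite -[X in _ *+ X](card_ord k) -sumr_const -big_split/=.
  by apply: ler_sum => i _; rewrite -lerBlDr; exact: hn.
move=> /(ler_wpM2l (ltW u0)); move: hQ hP; rewrite mulrDr mulr1.
have ue : e = 3 * u by rewrite /u mulrC divfK.
by rewrite ue; lra.
Qed.

Lemma expectation_cvg : conv_in_dist P xi Q eta.
Proof.
move=> F [M FM] cF.
have mF d0 (Om0 : measurableType d0) (x : Om0 -> measS) : point_process x ->
    measurable_fun [set: Om0] (fun w => F (x w)).
  exact: (measurable_vague_continuous hS regS ringU Urc bc Uc cF).
have FMx d0 (Om0 : measurableType d0) (x : Om0 -> measS) : point_process x ->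
    forall w, `|F (x w)| <= M by move=> [lx _] w; exact: FM.
have aff d0 (Om0 : measurableType d0) (P0 : probability Om0 R) (x : Om0 -> measS)
    (px : point_process x) := @integral_affine _ _ _ P0 _ _ (mF _ _ _ px) (FMx _ _ _ px).
have fin d0 (Om0 : measurableType d0) (P0 : probability Om0 R) (x : Om0 -> measS)
    (px : point_process x) := @bounded_integral_fin _ _ _ P0 _ _ (mF _ _ _ px) (FMx _ _ _ px).
have low (s e : R) : `|s| = 1 -> 0 < e -> \forall n \near \oo,
    s * fine (\int[Q]_w (F (eta w))%:E)%E - e <= s * fine (\int[P]_w (F (xi n w))%:E)%E.
  move=> s1 e0.
  have cG : vague_continuous (fun nu => M + s * F nu).
    move=> mu lmu e' e'0; have [k [hs [hC [dl dl0 h]]]] := cF mu lmu e' e'0.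
    exists k, hs; split => //; exists dl => // nu lnu hnu.
    by rewrite opprD addrACA subrr add0r -mulrBr normrM s1 mul1r; exact: h.
  have G0 nu : lf_counting nu -> 0 <= M + s * F nu <= M + M.
    move=> lnu; have : `|s * F nu| <= M by rewrite normrM s1 mul1r; exact: FM.
    by rewrite ler_norml => /andP[h1 h2]; apply/andP; split; lra.
  apply: filterS (expectation_liminf cG G0 e0) => n.
  by rewrite !aff//; lra.
rewrite -[X in _ --> X]fineK ?fin//.
apply: cvg_EFin; first by near=> n; exact: fin.
apply/cvgrPdist_le => e e0.
have h1 := low 1 e (normr1 _) e0.
have h2 := low (- 1) e (normrN1 _) e0.
near=> n; rewrite /= ler_norml.
have : 1 * fine (\int[Q]_w (F (eta w))%:E)%E - e <= 1 * fine (\int[P]_w (F (xi n w))%:E)%E.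
  by near: n.
have : -1 * fine (\int[Q]_w (F (eta w))%:E)%E - e <= -1 * fine (\int[P]_w (F (xi n w))%:E)%E.
  by near: n.
by move=> g1 g2; apply/andP; split; lra.
Unshelve. all: by end_near.
Qed.

End weak_convergence.

(** * From convergence in distribution to counts *)

Section urysohn.
Context {R : realType} {S : ptopologicalType}.
Local Notation measS := {measure set (BorelS S) -> \bar R}.

(** Complete regularity separates single points of [K] from the complement of [V]; finitely many
    separating functions, below one half on basic sets that cover [K], are glued. *)
Lemma compact_urysohn (c : nat -> set S) (K V : set S) :
  completely_regular_space S -> hausdorff_space S -> basis_seq c ->
  compact K -> open V -> precompact V -> K `<=` V ->
  exists2 h : S -> R, Ccplus h &
    (forall x, \1_K x <= h x) /\ (forall x, h x <= \1_V x).
Proof.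
move=> crS hS bc cK oV pV KV.
pose P i := exists f : S -> R, [/\ continuous f, forall x, f x <= 1,
  forall x, ~ V x -> f x = 1 & forall x, c i x -> f x < 2^-1].
have [x Kx|s sP Ks] := compact_subcover (P := P) bc cK.
  have nVx : ~ (~` V) x by apply; exact: KV.
  have [f [cf f01 fx fV]] := (@uniform_separatorP _ R _ _).1 (crS x _ (open_closedC oV) nVx).
  have fx0 : f x = 0 by apply: fx; exists x.
  have of_ : open (f @^-1` `]-oo, 2^-1[).
    by apply: open_comp; [move=> y _; exact: cf|exact: interval_open].
  have xf : (f @^-1` `]-oo, 2^-1[) x by rewrite /preimage/= in_itv/= fx0 invr_gt0.
  have [i ci cif] := bc.2 x _ of_ xf.
  exists i => //; exists f; split => //.
  + by move=> y; have /f01 : range f (f y) by []; rewrite /= in_itv/= => /andP[].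
  + by move=> y nVy; apply: fV; exists y.
have /choice[f hf] i : exists f : S -> R, [/\ continuous f, forall x, f x <= 1 &
    i \in s -> (forall x, ~ V x -> f x = 1) /\ (forall x, c i x -> f x < 2^-1)].
  have [/sP[f [*]]|_] := boolP (i \in s); first by exists f.
  by exists (fun=> 0); split => // x; exact: cvg_cst.
(* For [i] in [s] the term vanishes off [V] and exceeds 1 on [c i], so the sum exceeds 1 on [K]; it
   is then truncated at 1. *)
pose g x := \sum_(i <- s) 2 * (1 - f i x).
have t0 i x : 0 <= 2 * (1 - f i x).
  by have [_ f1 _] := hf i; rewrite mulr_ge0// subr_ge0.
have g0 x : 0 <= g x by exact: sumr_ge0.
have cg : continuous g.
  apply: continuous_big => [|i _ x].
    exact: add_continuous.
  have [cf _ _] := hf i.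
  by apply: cvgM; [exact: cvg_cst|apply: cvgB; [exact: cvg_cst|exact: cf]].
have gV x : ~ V x -> g x = 0.
  move=> nVx; rewrite /g big_seq big1// => i si.
  by have [_ _ /(_ si)[fV _]] := hf i; rewrite fV// subrr mulr0.
exists (fun x => Num.min 1 (g x)); last split.
- split; last split.
  + by move=> x; apply: continuous_min; [exact: cvg_cst|exact: cg].
  + by move=> x; rewrite le_min ler01 g0.
  + apply: (@subclosed_compact _ _ (closure V)); first exact: closed_closure.
      by move: pV; rewrite precompactE.
    apply: closureS => x /= gx; apply: contrapT => /gV gx0.
    by move/eqP: gx; apply; rewrite gx0; apply/min_idPr.
- move=> x; rewrite indicE; have [/set_mem Kx|_] := boolP (x \in K); last first.
    by rewrite le_min ler01 g0.
  have [i /= si cx] := Ks _ Kx.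
  have [_ _ /(_ si)[_ /(_ x cx) fx]] := hf i.
  have s0 : 0 <= \sum_(j <- rem i s) 2 * (1 - f j x) by exact: sumr_ge0.
  by rewrite le_min lexx /= /g (big_rem i)//=; move: fx s0; lra.
- move=> x; rewrite indicE; have [_|/negP nVx] := boolP (x \in V).
    by rewrite ge_min lexx.
  by rewrite gV ?ge_min ?lexx ?orbT// => Vx; apply: nVx; exact: mem_set.
Qed.

End urysohn.

(** * Continuous indicators of upper tails *)

Section ramp.
Context {R : realType}.

(** A continuous substitute for the indicator of [{x > k}], exact on natural numbers and hence on
    counts. *)
Definition ramp (k : nat) (x : R) : R := Num.min 1 (Num.max 0 (x - k%:R)).

Lemma ramp_itv k x : 0 <= ramp k x <= 1.
Proof. by rewrite /ramp le_min ler01 le_max lexx ge_min lexx. Qed.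

Lemma ramp_mono k x y : x <= y -> ramp k x <= ramp k y.
Proof.
move=> xy; rewrite /ramp le_min ge_min lexx/= ge_min ge_max !le_max lexx/=.
by rewrite lerD2r xy !orbT.
Qed.

Lemma ramp_lipschitz k x y : `|ramp k x - ramp k y| <= `|x - y|.
Proof.
have h a b : a <= b -> ramp k b - ramp k a <= b - a.
  move=> ab; rewrite /ramp.
  case: (leP 0 (a - k%:R)); case: (leP 0 (b - k%:R));
    case: (leP 1 (a - k%:R)); case: (leP 1 (b - k%:R)); case: (leP (1 : R) 0); lra.
have [xy|/ltW xy] := leP y x.
  by rewrite !ger0_norm ?subr_ge0//; [exact: h|exact: (ramp_mono _ xy)].
by rewrite distrC [leRHS]distrC !ger0_norm ?subr_ge0//; [exact: h|exact: (ramp_mono _ xy)].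
Qed.

Lemma ramp_nat k m : ramp k m%:R = (k < m)%:R.
Proof.
rewrite /ramp; have [km|mk] := ltnP k m.
  rewrite (_ : Num.max 0 (m%:R - k%:R) = m%:R - k%:R); last first.
    by apply/max_idPr; rewrite subr_ge0 ler_nat ltnW.
  by apply/min_idPl; rewrite -natrB ?ler1n ?subn_gt0// ltnW.
rewrite (_ : Num.max 0 (m%:R - k%:R) = 0); first by apply/min_idPr.
by apply/max_idPl; rewrite subr_le0 ler_nat.
Qed.

End ramp.

Section integral_bounds.
Context {R : realType} {S : ptopologicalType}.
Local Notation measS := {measure set (BorelS S) -> \bar R}.
Variables (nu : measS) (h : S -> R).
Hypotheses (lnu : locally_finite nu) (ch : Ccplus h).

Let mh : measurable_fun [set: BorelS S] (EFin \o h).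
Proof. by apply/measurable_EFinP; apply: measurable_fun_continuous; case: ch. Qed.

Let h0 x : (0 <= (h x)%:E)%E.
Proof. by rewrite lee_fin; case: ch => _ []. Qed.

Let integral_le (W : set S) : rc_borel W -> (forall x, h x <= \1_W x) ->
  (\int[nu]_(x in [set: BorelS S]) (h x)%:E <= nu W)%E.
Proof.
move=> [mW pW] hW; rewrite -[nu W]/(nu (W : set (BorelS S))) -[X in nu X]setIT.
rewrite -integral_indic//; apply: ge0_le_integral => //.
  by apply/measurable_EFinP; exact: measurable_indic.
by move=> x _; rewrite lee_fin.
Qed.

Lemma integ_le (W : set S) : rc_borel W -> (forall x, h x <= \1_W x) ->
  integ nu h <= fine (nu W).
Proof.
move=> rW hW; have iW := integral_le rW hW; have nW := lnu rW.
apply: fine_le => //; rewrite ge0_fin_numE//; last exact: integral_ge0.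
exact: le_lt_trans iW nW.
Qed.

Lemma integ_ge (B W : set S) : measurable (B : set (BorelS S)) -> rc_borel W ->
  (forall x, \1_B x <= h x) -> (forall x, h x <= \1_W x) ->
  fine (nu B) <= integ nu h.
Proof.
move=> mB rW Bh hW; have iW := integral_le rW hW; have nW := lnu rW.
have iB : (nu B <= \int[nu]_(x in [set: BorelS S]) (h x)%:E)%E.
  rewrite -[nu B]/(nu (B : set (BorelS S))) -[X in nu X]setIT -integral_indic//.
  apply: ge0_le_integral => //.
    by apply/measurable_EFinP; exact: measurable_indic.
  by move=> x _; rewrite lee_fin.
have iy := le_lt_trans iW nW.
apply: fine_le => //; rewrite ge0_fin_numE//; last exact: integral_ge0.
exact: le_lt_trans iB iy.
Qed.

End integral_bounds.

Section counts_of_limit.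
Context {R : realType} {S : ptopologicalType}.
Local Notation measS := {measure set (BorelS S) -> \bar R}.

Lemma ramp_vague_continuous (h : S -> R) k : Ccplus h ->
  vague_continuous (fun nu : measS => ramp k (integ nu h)).
Proof.
move=> ch mu _ e e0; exists 1%N, (fun=> h); split => //; exists e => // nu _ hnu.
by apply: le_lt_trans (ramp_lipschitz _ _ _) (hnu ord0).
Qed.

Lemma ramp_bounded (h : S -> R) k : bounded_on_N (fun nu : measS => ramp k (integ nu h)).
Proof.
exists 1 => nu _; have /andP[r0 r1] := ramp_itv k (integ nu h).
by rewrite ger0_norm.
Qed.

Lemma measurable_count_gt d (Om : measurableType d) (xi : Om -> measS) (B : set S) k :
  point_process xi -> rc_borel B -> measurable [set w | (k%:R%:E < xi w B)%E].
Proof.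
move=> [_ mxi] rB; rewrite -[X in measurable X]setTI.
by apply: emeasurable_fun_o_infty => //; exact: mxi.
Qed.

Variables (lam : measS) (U : set (set S)) (c : nat -> set S).
Hypotheses (hS : hausdorff_space S) (crS : completely_regular_space S).
Hypotheses (lf : locally_finite lam).
Hypotheses (ringU : ring_of_sets U) (Ulam : U `<=` lambda_cont_sets lam).
Hypotheses (bc : basis_seq c) (Uc : forall i, U (c i)).

Let Urc B : U B -> rc_borel B := @ring_rc _ _ _ _ Ulam B.
Let regS : @regular_space S := completely_regular_regular (R := R) crS.

Let measurable_ramp d (Om : measurableType d) (xi : Om -> measS) h k :
  point_process xi -> Ccplus h ->
  measurable_fun [set: Om] (fun w => ramp k (integ (xi w) h)).
Proof.
move=> pxi ch.
exact: (measurable_vague_continuous hS regS ringU Urc bc Uc (ramp_vague_continuous k ch)).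
Qed.

Let fin_ramp d (Om : measurableType d) (P : probability Om R) (xi : Om -> measS) h k :
  point_process xi -> Ccplus h ->
  (\int[P]_w (ramp k (integ (xi w) h))%:E)%E \is a fin_num.
Proof.
move=> pxi ch; apply: (@bounded_integral_fin _ _ _ P _ 1 (measurable_ramp k pxi ch)).
by move=> w; have /andP[r0 r1] := ramp_itv k (integ (xi w) h); rewrite ger0_norm.
Qed.

Let indic_count (nu : measS) (B : set S) k : lf_counting nu -> rc_borel B ->
  ramp k (fine (nu B)) = (k%:R%:E < nu B)%E%:R.
Proof.
move=> lnu rB; have [m ->] := lf_counting_nat lnu rB.
by rewrite /= ramp_nat lte_fin ltr_nat.
Qed.

Let expectation_indic d (Om : measurableType d) (P : probability Om R) (A : set Om) :
  measurable A -> (\int[P]_w (\1_A w)%:E)%E = (fine (P A))%:E.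
Proof. by move=> mA; rewrite integral_indic// setIT fineK// fin_num_measure. Qed.

Lemma expectation_ramp_le d (Om : measurableType d) (P : probability Om R)
    (xi : Om -> measS) h k (W : set S) : point_process xi -> Ccplus h -> rc_borel W ->
  (forall x, h x <= \1_W x) ->
  fine (\int[P]_w (ramp k (integ (xi w) h))%:E)%E <= fine (P [set w | (k%:R%:E < xi w W)%E]).
Proof.
move=> pxi ch rW hW; have mW := measurable_count_gt k pxi rW.
rewrite -lee_fin -expectation_indic// fineK ?fin_ramp//; apply: ge0_le_integral => //.
- by move=> w _; rewrite lee_fin; have /andP[] := ramp_itv k (integ (xi w) h).
- by apply/measurable_EFinP; exact: measurable_ramp.
- by apply/measurable_EFinP; exact: measurable_indic.
move=> w _; rewrite lee_fin.
have lxi := pxi.1 w.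
apply: le_trans (ramp_mono k (integ_le lxi.1 ch rW hW)) _.
rewrite indic_count// indicE; have [kw|_] := boolP (_ < _)%E; last by case: (_ \in _).
by rewrite mem_set.
Qed.

Lemma expectation_ramp_ge d (Om : measurableType d) (P : probability Om R)
    (xi : Om -> measS) h k (B W : set S) : point_process xi -> Ccplus h ->
  rc_borel B -> rc_borel W ->
  (forall x, \1_B x <= h x) -> (forall x, h x <= \1_W x) ->
  fine (P [set w | (k%:R%:E < xi w B)%E]) <= fine (\int[P]_w (ramp k (integ (xi w) h))%:E)%E.
Proof.
move=> pxi ch rB rW Bh hW; have mB := measurable_count_gt k pxi rB.
rewrite -lee_fin -expectation_indic// fineK ?fin_ramp//; apply: ge0_le_integral => //.
- by apply/measurable_EFinP; exact: measurable_indic.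
- by apply/measurable_EFinP; exact: measurable_ramp.
move=> w _; rewrite lee_fin.
have lxi := pxi.1 w.
apply: (le_trans _ (ramp_mono k (integ_ge lxi.1 ch rB.1 rW Bh hW))).
rewrite indic_count// indicE; have [|] := boolP (_ \in _); last by [].
by move/set_mem => /= kw; rewrite kw.
Qed.

Context d (Om : measurableType d) (P : probability Om R) (xi : nat -> Om -> measS).
Context d' (Om' : measurableType d') (Q : probability Om' R) (eta : Om' -> measS).
Hypotheses (pxi : forall n, point_process (xi n)) (peta : poisson_process Q eta lam).
Hypothesis cvg_xi : conv_in_dist P xi Q eta.

Lemma poisson_void_le (N : set S) (e : R) : rc_borel N -> (lam N < e%:E)%E ->
  fine (Q [set w | eta w N != 0%E]) <= e.
Proof.
move=> rN Ne; have mN : measurable [set w | eta w N = 0%E].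
  exact: (point_process_eq_measurable _ peta.1 rN).
rewrite (_ : [set w | _] = ~` [set w | eta w N = 0%E]); last first.
  by apply/seteqP; split => w /= /eqP.
rewrite fine_probabilityC// (peta.2.1 N rN 0%N) /= /poisson_p expr0 mulr1 fact0 divr1.
have lN := lf rN.
have : fine (lam N) < e by rewrite -lte_fin fineK// ge0_fin_numE.
have := expR_ge1Dx (- fine (lam N)); lra.
Qed.

Lemma count_gt_cvg (B : set S) k : U B -> open B ->
  (fun n => fine (P [set w | (k%:R%:E < xi n w B)%E])) @ \oo -->
  fine (Q [set w | (k%:R%:E < eta w B)%E]).
Proof.
move=> UB oB; apply/cvgrPdist_le => e e0.
have [rB B0] := Ulam UB.
have cB : compact (closure B) by exact: compact_closure_rc rB.
have e20 : 0 < e / 2 by rewrite divr_gt0.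
(* The boundary of the open set [B] is compact and null, which is what [outer_open] needs. *)
have [N [UN oN BN lN]] : exists N, [/\ U N, open N, closure B `\` B `<=` N &
    (lam N < (e / 2)%:E)%E].
  apply: (outer_open hS lf ringU Urc bc Uc).
    apply: (subclosed_compact _ cB); last by move=> x [].
    by rewrite setDE; apply: closedI; [exact: closed_closure|exact: open_closedC].
  by move: B0; rewrite (interior_id _).1// => ->; rewrite lte_fin.
have rN := Urc UN.
have UBN : U (B `|` N) by case: ringU => _ [+ _]; exact.
have rBN := Urc UBN.
have cK : compact (closure B `\` N).
  apply: (subclosed_compact _ cB); last by move=> x [].
  by rewrite setDE; apply: closedI; [exact: closed_closure|exact: open_closedC].
have KB : closure B `\` N `<=` B.
  by move=> x [clx nNx]; apply: contrapT => nBx; exact/nNx/BN.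
(* [f] bounds the count of [B] from below and [g], obtained next, from above; their indicator bounds
   differ from that of [B] only inside [N]. *)
have [f cf [Kf fB]] := @compact_urysohn R _ c _ _ crS hS bc cK oB rB.2 KB.
have clBN : closure B `<=` B `|` N.
  move=> x clx; have [Bx|nBx] := pselect (B x); [by left|right; exact: BN].
have [g cg [Bg gBN]] := @compact_urysohn R _ c _ _ crS hS bc cB (openU oB oN) rBN.2 clBN.
have rK : rc_borel (closure B `\` N).
  apply: (rc_borelS _ KB rB).
  by apply: measurableD; [apply: borel_closed; exact: closed_closure|exact: rN.1].
have rcB : rc_borel (closure B) by exact: rc_borel_closure.
have B_g x : \1_B x <= g x.
  rewrite indicE; have [/set_mem/subset_closure Bx|_] := boolP (x \in B).
    by apply: le_trans (Bg x); rewrite indicE mem_set.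
  by case: cg => _ [].
have QN : fine (Q [set w | eta w N != 0%E]) <= e / 2 by exact: poisson_void_le.
(* Sets that differ only inside [N] have equal counts unless [N] is occupied, which costs at most
   [e / 2] under [Q]. *)
have dist (B1 B2 : set S) : rc_borel B1 -> rc_borel B2 -> B1 `<=` B2 -> B2 `<=` B1 `|` N ->
    fine (Q [set w | (k%:R%:E < eta w B2)%E]) <= fine (Q [set w | (k%:R%:E < eta w B1)%E]) + e / 2.
  move=> r1 r2 B12 B21.
  have : `|fine (Q [set w | (k%:R%:E < eta w B2)%E]) - fine (Q [set w | (k%:R%:E < eta w B1)%E])| <= e / 2.
    apply: (fine_probability_dist _ _ _ QN).
    - exact: measurable_count_gt peta.1 r2.
    - exact: measurable_count_gt peta.1 r1.
    - rewrite (_ : [set w | _] = ~` [set w | eta w N = 0%E]); last first.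
        by apply/seteqP; split => w /= /eqP.
      by apply: measurableC; exact: (point_process_eq_measurable _ peta.1 rN).
    move=> w /= /negP; rewrite negbK => /eqP etaN.
    suff -> : eta w B1 = eta w B2 by [].
    apply/eqP; rewrite eq_le; apply/andP; split.
      by apply: le_measure; rewrite ?inE//; [exact: r1.1|exact: r2.1].
    apply: (@le_trans _ _ (eta w (B1 `|` N))).
      apply: le_measure; rewrite ?inE//; first exact: r2.1.
      by apply: measurableU; [exact: r1.1|exact: rN.1].
    apply: (le_trans (measureU2 _ _ _)); [exact: r1.1|exact: rN.1|].
    have etaN0 : (eta w N <= 0)%E by rewrite etaN.
    by rewrite -[leRHS]adde0; exact: leeD.
  by move=> /ler_normlP[_]; lra.
have lo := expectation_ramp_ge Q k peta.1 cf rK rB Kf fB.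
have hi := expectation_ramp_le Q k peta.1 cg rBN gBN.
have d1 : fine (Q [set w | (k%:R%:E < eta w B)%E]) <=
    fine (Q [set w | (k%:R%:E < eta w (closure B `\` N))%E]) + e / 2.
  apply: dist => // x Bx; have [Nx|nNx] := pselect (N x); [by right|left].
  by split => //; exact: subset_closure.
have d2 : fine (Q [set w | (k%:R%:E < eta w (B `|` N))%E]) <=
    fine (Q [set w | (k%:R%:E < eta w B)%E]) + e / 2 by apply: dist.
have cvgF h : Ccplus h -> \forall n \near \oo,
    `|fine (\int[Q]_w (ramp k (integ (eta w) h))%:E)%E -
      fine (\int[P]_w (ramp k (integ (xi n w) h))%:E)%E| <= e / 2.
  move=> ch.
  have := cvg_xi (ramp_bounded h k) (ramp_vague_continuous k ch).
  rewrite -[X in _ --> X]fineK ?(fin_ramp Q _ peta.1)// => /fine_cvgP[_] /cvgrPdist_le; exact.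
near=> n.
have hf : `|fine (\int[Q]_w (ramp k (integ (eta w) f))%:E)%E -
      fine (\int[P]_w (ramp k (integ (xi n w) f))%:E)%E| <= e / 2.
  by near: n; exact: cvgF.
have hg : `|fine (\int[Q]_w (ramp k (integ (eta w) g))%:E)%E -
      fine (\int[P]_w (ramp k (integ (xi n w) g))%:E)%E| <= e / 2.
  by near: n; exact: cvgF.
have lo' := expectation_ramp_le P k (pxi n) cf rB fB.
have hi' := expectation_ramp_ge P k (pxi n) cg rB rBN B_g gBN.
move: hf hg lo lo' hi hi' d1 d2; rewrite !ler_norml => /andP[? ?] /andP[? ?] *.
by apply/andP; split; lra.
Unshelve. all: by end_near.
Qed.

Lemma count_pmf_cvg (B : set S) k : U B -> open B ->
  (fun n => fine (P [set w | xi n w B = k%:R%:E])) @ \oo --> poisson_p (fine (lam B)) k.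
Proof.
move=> UB oB; have rB := Urc UB.
have -> : poisson_p (fine (lam B)) k = fine (Q [set w | eta w B = k%:R%:E]).
  by rewrite (peta.2.1 B rB k).
(* A difference of two tails; for [k = 0] the first tail is the whole space, of probability 1. *)
have pmf d0 (Om0 : measurableType d0) (P0 : probability Om0 R) (x : Om0 -> measS) :
    point_process x -> fine (P0 [set w | x w B = k%:R%:E]) =
    (if k is k'.+1 then fine (P0 [set w | (k'%:R%:E < x w B)%E]) else 1) -
    fine (P0 [set w | (k%:R%:E < x w B)%E]).
  move=> px; have mB j := measurable_count_gt j px rB.
  have xn w : exists m : nat, x w B = m%:R%:E by exact: lf_counting_nat (px.1 w) rB.
  case: k mB => [|k'] mB.
    rewrite -fine_probabilityC//; congr (fine (P0 _)).
    apply/seteqP; split => w /=; have [m ->] := xn w.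
      by move=> ->; rewrite ltxx.
    by move/negP; rewrite -leNgt lee_fin ler_nat leqn0 => /eqP->.
  have mE : measurable [set w | x w B = k'.+1%:R%:E].
    exact: (point_process_eq_measurable _ px rB).
  have -> : [set w | x w B = k'.+1%:R%:E] =
      [set w | (k'%:R%:E < x w B)%E] `&` [set w | x w B = k'.+1%:R%:E].
    by apply/seteqP; split => [w /= xk|w []//]; split => //; rewrite xk lte_fin ltr_nat.
  rewrite fine_probabilityD//; congr (_ - fine (P0 _)).
  apply/seteqP; split => w /=; have [m ->] := xn w; rewrite !lte_fin !ltr_nat.
    by move=> [km] /eqP; rewrite eqe eqr_nat => mk; rewrite ltn_neqAle eq_sym mk.
  move=> km; split; first exact: ltnW.
  by move=> /eqP; rewrite eqe eqr_nat => /eqP mk; rewrite mk ltnn in km.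
rewrite pmf; last exact: peta.1.
under eq_cvg do rewrite pmf//.
apply: cvgB; last exact: count_gt_cvg.
by case: k {pmf} => [|k]; [exact: cvg_cst|exact: count_gt_cvg].
Qed.

Lemma count_tail d0 (Om0 : measurableType d0) (P0 : probability Om0 R) (x : Om0 -> measS)
    (B : set S) e : point_process x -> rc_borel B -> 0 < e ->
  exists K : nat, fine (P0 [set w | (K%:R%:E < x w B)%E]) <= e.
Proof.
move=> px rB e0.
have mB j := measurable_count_gt j px rB.
have F0 : \bigcap_(j : nat) [set w | (j%:R%:E < x w B)%E] = set0.
  apply/seteqP; split => // w xw; have [m xm] := lf_counting_nat (px.1 w) rB.
  by have := xw m I; rewrite /= xm ltxx.
have : (fun j => fine (P0 [set w | (j%:R%:E < x w B)%E])) @ \oo --> (0 : R).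
  apply: fine_cvg; rewrite -[X in _ --> X](measure0 P0) -F0.
  apply: nonincreasing_cvg_mu => //.
  - by rewrite (le_lt_trans (probability_le1 _ _)) ?ltry.
  - by rewrite F0.
  - move=> i j ij; apply/subsetPset => w /=; apply: le_lt_trans.
    by rewrite lee_fin ler_nat.
move=> /cvgrPdist_le/(_ _ e0)/filter_ex[K].
by rewrite sub0r normrN ger0_norm ?fine_ge0// => PK; exists K.
Qed.

Lemma count_tight (B : set S) : U B -> open B -> tight_seq P (fun n w => xi n w B).
Proof.
move=> UB oB e e0; have rB := Urc UB.
have e20 : 0 < e / 2 by rewrite divr_gt0.
have [K0 QK] := count_tail Q peta.1 rB e20.
have /cvgrPdist_le/(_ _ e20)[n0 _ hn] := @count_gt_cvg B K0 UB oB.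
have /choice[K PK] n := count_tail P (pxi n) rB e0.
(* [K0] serves all [n] from [n0] on; the sum dominates the individual bounds of the finitely many
   earlier [n]. *)
pose M := (K0 + \sum_(i < n0) K i)%N.
have bound n (j : nat) : (j <= M)%N ->
    fine (P [set w | (j%:R%:E < xi n w B)%E]) <= e ->
    (P [set w | (M%:R%:E < xi n w B)%E] <= e%:E)%E.
  move=> jM; have mB i := measurable_count_gt i (pxi n) rB.
  rewrite -lee_fin fineK ?fin_num_measure//; apply: le_trans.
  apply: le_measure; rewrite ?inE// => w /=; apply: le_lt_trans.
  by rewrite lee_fin ler_nat.
exists M%:R => n; have [nn0|n0n] := ltnP n n0.
  apply: bound (PK n).
  by rewrite /M (bigD1 (Ordinal nn0))//= addnCA leq_addr.
apply: (bound n K0); first by rewrite leq_addr.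
by have := hn n n0n; rewrite /= ler_norml => /andP[? ?]; lra.
Qed.

Lemma poisson_pS (a : R) k : k.+1%:R * poisson_p a k.+1 = a * poisson_p a k.
Proof.
rewrite /poisson_p exprS factS natrM.
by field; rewrite nat1r !pnatr_eq0 -lt0n fact_gt0.
Qed.

Lemma count_recurrence (B : set S) k : U B -> open B ->
  (fun n => k.+1%:R * fine (P [set w | xi n w B = (k.+1%:R)%:E])
            - fine (lam B) * fine (P [set w | xi n w B = (k%:R)%:E]))
    @ \oo --> (0 : R).
Proof.
move=> UB oB; rewrite -[X in _ --> X](subrr (k.+1%:R * poisson_p (fine (lam B)) k.+1)).
rewrite {2}poisson_pS; apply: cvgB; apply: cvgM; try exact: cvg_cst.
  exact: count_pmf_cvg.
exact: count_pmf_cvg.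
Qed.

End counts_of_limit.

Theorem theorem1p1 (R : realType) (S : ptopologicalType)
    (d : measure_display) (Omega : measurableType d)
    (P : probability Omega R)
    (xi : nat -> Omega -> {measure set (BorelS S) -> \bar R})
    (lam : {measure set (BorelS S) -> \bar R})
    (U : set (set S)) :
  hausdorff_space S ->
  locally_compact [set: S] ->
  @second_countable S ->
  (forall n, point_process (xi n)) ->
  non_atomic lam ->
  locally_finite lam ->
  ring_of_sets U ->
  U `<=` lambda_cont_sets lam ->
  (exists2 C : set (set S), countable C /\ basis C & C `<=` U) ->
  ( ((forall B : set S, U B -> open B ->
        tight_seq P (fun n w => xi n w B)) /\
     (forall B : set S, U B -> open B -> forall k : nat,
        (fun n => k.+1%:R * fine (P [set w | xi n w B = (k.+1%:R)%:E])
                  - fine (lam B) * fine (P [set w | xi n w B = (k%:R)%:E]))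
        @ \oo --> (0 : R)))
  <->
    exists (d' : measure_display) (Omega' : measurableType d')
           (Q : probability Omega' R)
           (eta : Omega' -> {measure set (BorelS S) -> \bar R}),
      poisson_process Q eta lam /\ conv_in_dist P xi Q eta ).
Proof.
move=> hS lcS _ pxi na lf ringU Ulam [C [cC bC] CU].
have crS := locally_compact_completely_regular (R := R) lcS hS.
have [c bc Cc] := basis_seq_exists cC bC.
have Uc i : U (c i) by exact: CU.
have Urc B : U B -> rc_borel B by exact: (ring_rc Ulam).
split=> [[tight rec]|[d' [Om' [Q [eta [peta cvg_xi]]]]]]; last first.
  split=> B UB oB.
    exact: (count_tight hS crS lf ringU Ulam bc Uc pxi peta cvg_xi).
  by move=> k; exact: (count_recurrence hS crS lf ringU Ulam bc Uc pxi peta cvg_xi).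
have [d' [Om' [Q [eta peta]]]] := poisson_process_exists bc (fun i => Urc _ (Uc i)) lf.
exists d', Om', Q, eta; split => //.
apply: (expectation_cvg hS (completely_regular_regular (R := R) crS) lf na ringU Ulam
  bc Uc pxi peta.1) => B UB oB k; have rB := Urc _ UB.
- apply: (tight_poisson (fun n => (pxi n).2 B rB) _ (tight B UB oB) (rec B UB oB)).
  by move=> n w; exact: lf_counting_nat ((pxi n).1 w) rB.
- by under eq_cvg do rewrite (peta.2.1 B rB k); exact: cvg_cst.
Qed.
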